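(* Let $M$ be a smooth seven-dimensional manifold equipped with an $Sp(1)Sp(1)$ structure (with local 1-forms $\eta_s$, local fundamental 2-forms $\omega_s$, $s=1,2,3$, and horizontal metric $g_H$) such that the 3-form $$\phi=2\omega_1\wedge\eta_1+2\omega_2\wedge\eta_2-2\omega_3\wedge\eta_3+2\eta_1\wedge\eta_2\wedge\eta_3$$ is globally defined and, for some constant $\tau\neq0$, the structure equations $d\eta_i=2\omega_i+2\tau\,\eta_j\wedge\eta_k$ hold for any cyclic permutation $(i,j,k)$ of $(1,2,3)$. Then for any constant $a$ the manifold $M\times I$, where $I\subset\mathbb R$ is an interval with coordinate $u$ on which $u>0$ and $\tau u^{5/3}-a>0$, has a parallel $Spin(7)$ structure given by the following metric and fundamental 4-form: $$g=u\,g_H+\frac{\tau u^{5/3}-a}{5u^{2/3}}\big((\eta_1)^2+(\eta_2)^2+(\eta_3)^2\big)+\frac{5u^{2/3}}{36(\tau u^{5/3}-a)}\,du^2,\qquad \psi=F_1\wedge F_1+F_2\wedge F_2-F_3\wedge F_3,$$ where locally, for any cyclic permutation $(i,j,k)$ of $(1,2,3)$, $$F_i(u)=u\,\omega_i-\epsilon_i\frac{\tau u^{5/3}-a}{5u^{2/3}}\,\eta_j\wedge\eta_k-\epsilon_i\frac16\,\eta_i\wedge du,\qquad \epsilon_1=\epsilon_2=1,\ \epsilon_3=-1.$$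
   Context: $Sp(1)Sp(1)$ structure on a 7-dimensional Riemannian manifold $M$: a codimension three distribution $H$ which is locally the kernel of an $\mathbb R^3$-valued 1-form $\eta=(\eta_1,\eta_2,\eta_3)$, together with the metric $g_H$ on $H$ and a rank-three bundle $\mathbb Q\subset\mathrm{End}(H)$ locally generated by almost complex structures $I_1,I_2,I_3$ with $I_1I_2=-I_2I_1=I_3$, $I_1I_2I_3=-\mathrm{id}_H$, $g_H(I_s\cdot,I_s\cdot)=g_H$. The $\eta_s$ are orthonormal on the orthogonal complement $V$ of $H$. The local fundamental 2-forms are $\omega_s(X,Y)=g_H(I_sX,Y)$ on $H$, extended by zero on $V$; $g_H$ is likewise extended by zero on $V$. ''$\phi$ is globally defined'' means that the local expressions for $\phi$ agree on overlaps. A $Spin(7)$ structure on an 8-manifold is given by a metric $g$ and a 4-form $\psi$ which at each point is, in a suitable $g$-orthonormal coframe, a fixed nonzero constant multiple of the standard (Cayley) 4-form on $\mathbb R^8$ whose stabilizer is $Spin(7)$; it is parallel if $\psi$ is parallel for the Levi-Civita connection of $g$ (so the holonomy of $g$ is contained in $Spin(7)$), equivalently $d\psi=0$. *)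

(* Defs.v *)
From HB Require Import structures.
From mathcomp Require Import all_boot all_order all_algebra perm.
From mathcomp Require Import all_classical all_reals all_analysis.

Set Implicit Arguments.
Unset Strict Implicit.
Unset Printing Implicit Defensive.

Import Order.TTheory GRing.Theory Num.Theory numFieldNormedType.Exports.

Local Open Scope classical_set_scope.
Local Open Scope ring_scope.

(* C^k regularity on an open set U, by iterated directional derivatives. *)
Fixpoint Ck_on (R : realType) (V W : normedModType R) (U : set V) (k : nat)
    (f : V -> W) : Prop :=
  (forall x, U x -> {for x, continuous f}) /\
  (if k is k'.+1 then
     forall v, (forall x, U x -> derivable f x v) /\ Ck_on U k' ('D_v f)
   else True).

Definition smooth_on (R : realType) (V W : normedModType R) (U : set V)
  (f : V -> W) : Prop := forall k, Ck_on U k f.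

(* The points of the manifold are those of the open subset
   \bigcup_c cdom c of [man_space]; [cinv c] is only meaningful on the image of
   [cdom c]. *)
Record manifold (R : realType) (n : nat) := Manifold {
  man_space : topologicalType ;
  chart : Type ;
  cdom : chart -> set man_space ;
  cmap : chart -> man_space -> 'rV[R]_n ;
  cinv : chart -> 'rV[R]_n -> man_space ;
  space_hausdorff : hausdorff_space man_space ;
  space_second_countable : @second_countable man_space ;
  cdom_open : forall c, open (cdom c) ;
  cmap_open : forall c, open (cmap c @` cdom c) ;
  cmapK : forall c p, cdom c p -> cinv c (cmap c p) = p ;
  cmap_continuous : forall c p, cdom c p -> {for p, continuous (cmap c)} ;
  cinv_continuous : forall c x, (cmap c @` cdom c) x ->
    {for x, continuous (cinv c)} ;
  transition_smooth : forall c c',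
    smooth_on (cmap c @` (cdom c `&` cdom c')) (cmap c' \o cinv c) }.

Section ProductLemmas.
Context {R : realType}.

Lemma Ck_on_cst (V W : normedModType R) (U : set V) k (w : W) :
  Ck_on U k (fun=> w).
Proof.
elim: k w => [|k IH] w; (split; first by move=> x _; exact: cst_continuous).
  by [].
move=> v; split=> [x _|]; first exact: derivable_cst.
have -> : 'D_v (fun=> w) = (fun=> 0 : W) by apply/funext => x; exact: derive_cst.
exact: IH.
Qed.

Lemma smooth_on_id (V : normedModType R) (U : set V) : smooth_on U (@id V).
Proof.
case=> [|k]; (split; first by move=> x _; exact: cvg_id).
  by [].
move=> v; split=> [x _|]; first exact: derivable_id.
have -> : 'D_v (@id V) = (fun=> v) by apply/funext => x; exact: derive_id.
exact: Ck_on_cst.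
Qed.

Lemma continuous_mx (T : topologicalType) m n (f : T -> 'M[R]_(m, n)) (x : T) :
  (forall i j, {for x, continuous (fun y => f y i j)}) -> {for x, continuous f}.
Proof.
move=> fx; apply/cvgrPdist_le => /= e e0; near=> y.
rewrite /Num.Def.normr/= mx_normrE (bigmax_le _ (ltW e0))//= => i _.
rewrite !mxE/=; move: i; near: y; apply: filter_forall => /= i.
exact: ((cvgrPdist_le _ _).1 (fx i.1 i.2)).
Unshelve. all: by end_near. Qed.

Lemma continuous_row_mx (T : topologicalType) m n (f : T -> 'rV[R]_m)
    (g : T -> 'rV[R]_n) (x : T) :
  {for x, continuous f} -> {for x, continuous g} ->
  {for x, continuous (fun y => row_mx (f y) (g y))}.
Proof.
move=> fx gx; apply: continuous_mx => i j.
case: (split_ordP j) => l ->.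
  under [X in {for x, continuous X}]eq_fun do rewrite row_mxEl.
  by apply: (@continuous_comp _ _ _ f (fun M => M i l)) => //;
    exact: coord_continuous.
under [X in {for x, continuous X}]eq_fun do rewrite row_mxEr.
by apply: (@continuous_comp _ _ _ g (fun M => M i l)) => //;
  exact: coord_continuous.
Qed.

Lemma lsubmx_continuous m n : continuous (@lsubmx R 1 m n).
Proof.
move=> x; apply: continuous_mx => i j.
under [X in {for x, continuous X}]eq_fun do rewrite mxE.
exact: coord_continuous.
Qed.

Lemma rsubmx_continuous m n : continuous (@rsubmx R 1 m n).
Proof.
move=> x; apply: continuous_mx => i j.
under [X in {for x, continuous X}]eq_fun do rewrite mxE.
exact: coord_continuous.
Qed.

Lemma derivable_row_mx (V : normedModType R) m n (f : V -> 'rV[R]_m)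
    (g : V -> 'rV[R]_n) x v :
  derivable f x v -> derivable g x v ->
  derivable (fun y => row_mx (f y) (g y)) x v.
Proof.
move=> /derivable_mxP fx /derivable_mxP gx; apply/derivable_mxP => i j.
case: (split_ordP j) => l ->.
  by under eq_fun do rewrite row_mxEl; exact: fx.
by under eq_fun do rewrite row_mxEr; exact: gx.
Qed.

Lemma derive_row_mx (V : normedModType R) m n (f : V -> 'rV[R]_m)
    (g : V -> 'rV[R]_n) x v :
  derivable f x v -> derivable g x v ->
  'D_v (fun y => row_mx (f y) (g y)) x = row_mx ('D_v f x) ('D_v g x).
Proof.
move=> fx gx; rewrite (derive_mx (derivable_row_mx fx gx)) (derive_mx fx) (derive_mx gx).
apply/matrixP => i j; rewrite mxE; case: (split_ordP j) => l ->.
  by under eq_fun do rewrite row_mxEl; rewrite row_mxEl mxE.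
by under eq_fun do rewrite row_mxEr; rewrite row_mxEr mxE.
Qed.

Lemma eq_Ck_on (V W : normedModType R) (U : set V) k (f g : V -> W) :
  open U -> (forall x, U x -> f x = g x) -> Ck_on U k f -> Ck_on U k g.
Proof.
move=> oU; elim: k f g => [|k IH] f g fg [fc fd].
  split=> // x Ux; rewrite /prop_for /continuous_at -(fg x Ux).
  apply: cvg_trans (fc x Ux); apply: near_eq_cvg.
  by near=> y; apply: fg; near: y; exact: open_nbhs_nbhs.
have nfg x : U x -> {near x, f =1 g}.
  by move=> Ux; near=> y; apply: fg; near: y; exact: open_nbhs_nbhs.
split=> [x Ux|v].
  rewrite /prop_for /continuous_at -(fg x Ux).
  by apply: cvg_trans (fc x Ux); apply: near_eq_cvg; exact: nfg.
have [df cf] := fd v; split=> [x Ux|].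
  by apply: near_eq_derivable (df x Ux); exact: nfg.
by apply: IH cf => x Ux; apply: near_eq_derive; exact: nfg.
Unshelve. all: by end_near. Qed.

Lemma open_lrsubmx m n (U : set 'rV[R]_m) (U' : set 'rV[R]_n) :
  open U -> open U' -> open [set y | U (lsubmx y) /\ U' (rsubmx y)].
Proof.
move=> oU oU'; apply: openI; apply: open_comp => // x _.
  exact: lsubmx_continuous.
exact: rsubmx_continuous.
Qed.

Lemma Ck_on_row_mx m n (U : set 'rV[R]_m) (U' : set 'rV[R]_n)
    (f : 'rV[R]_m -> 'rV[R]_m) (g : 'rV[R]_n -> 'rV[R]_n) k :
  open U -> open U' -> Ck_on U k f -> Ck_on U' k g ->
  Ck_on [set y | U (lsubmx y) /\ U' (rsubmx y)] k
    (fun y => row_mx (f (lsubmx y)) (g (rsubmx y))).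
Proof.
move=> oU oU'; elim: k f g => [|k IH] f g [fc fd] [gc gd]; split.
1,3: move=> x [Ux U'x]; apply: continuous_row_mx;
  [apply: (@continuous_comp _ _ _ lsubmx f); [exact: lsubmx_continuous|exact: fc]
  |apply: (@continuous_comp _ _ _ rsubmx g); [exact: rsubmx_continuous|exact: gc]].
  by [].
move=> v.
have [dfv cfv] := fd (lsubmx v); have [dgv cgv] := gd (rsubmx v).
have quot (V : normedModType R) p (L : 'rV[R]_(m + n) -> 'rV[R]_p)
    (h : 'rV[R]_p -> V) (x : 'rV[R]_(m + n)) : linear L ->
    (fun t : R => t^-1 *: ((h \o L \o shift x) (t *: v) - h (L x))) =
    (fun t : R => t^-1 *: ((h \o shift (L x)) (t *: L v) - h (L x))).
  by move=> Ll; apply/funext => t /=; rewrite Ll.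
have lL : linear (@lsubmx R 1 m n) by move=> a x y; rewrite linearP.
have lR : linear (@rsubmx R 1 m n) by move=> a x y; rewrite linearP.
have dl x : U (lsubmx x) -> derivable (f \o lsubmx) x v.
  by move=> Ux; rewrite /derivable quot//; exact: dfv.
have dr x : U' (rsubmx x) -> derivable (g \o rsubmx) x v.
  by move=> Ux; rewrite /derivable quot//; exact: dgv.
split=> [x [Ux U'x]|].
  by apply: derivable_row_mx; [exact: dl|exact: dr].
apply: (eq_Ck_on _ _ (IH _ _ cfv cgv)); first exact: open_lrsubmx.
move=> x [Ux U'x]; rewrite derive_row_mx; [|exact: dl|exact: dr].
by congr row_mx; rewrite /derive quot.
Qed.

Lemma second_countable_R : @second_countable R.
Proof.
exists [set B | exists c r : rat, B = ball (ratr c : R) (ratr r : R)].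
  apply: (@sub_countable _ _ _
    ((fun cr : rat * rat => ball (ratr cr.1 : R) (ratr cr.2 : R)) @` setT)).
    by apply: subset_card_le => _ [c [r ->]]; exists (c, r).
  exact: (card_le_trans (card_image_le _ _) (countableP _)).
split=> [_ [c [r ->]]|x A /=]; first exact: ball_open.
rewrite nbhsE => -[B [oB Bx] BA].
have [c [r /= [xb bB]]] := open_subball_rat oB (mem_set Bx).
exists (ball (ratr c : R) (ratr r : R)); last exact: subset_trans BA.
by split; [exists c, r|exact/set_mem].
Qed.

Lemma hausdorff_prod (T T' : topologicalType) :
  hausdorff_space T -> hausdorff_space T' -> hausdorff_space (T * T')%type.
Proof.
move=> hT hT' [p p'] [q q'] cl; congr pair.
  apply: hT => A B pA qB.
  have [|| [x y] [/= Ax Bx]] := cl (A `*` setT) (B `*` setT).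
  - by exists (A, setT) => //; split=> //; exact: filterT.
  - by exists (B, setT) => //; split=> //; exact: filterT.
  by exists x; split; [exact: Ax.1|exact: Bx.1].
apply: hT' => A B pA qB.
have [|| [x y] [/= Ax Bx]] := cl (setT `*` A) (setT `*` B).
- by exists (setT, A) => //; split=> //; exact: filterT.
- by exists (setT, B) => //; split=> //; exact: filterT.
by exists y; split; [exact: Ax.2|exact: Bx.2].
Qed.

Lemma open_prod (T T' : topologicalType) (A : set T) (B : set T') :
  open A -> open B -> open (A `*` B).
Proof.
move=> oA oB; rewrite openE => -[x y] [/= Ax By]; exists (A, B) => //.
by split; apply: open_nbhs_nbhs.
Qed.

Lemma second_countable_prod (T T' : topologicalType) :
  @second_countable T -> @second_countable T' ->
  @second_countable (T * T')%type.
Proof.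
move=> [B cB [oB bB]] [B' cB' [oB' bB']].
exists ((fun bb : set T * set T' => bb.1 `*` bb.2) @` (B `*` B')).
  exact: (card_le_trans (card_image_le _ _) (countableX cB cB')).
split=> [_ [[b b'] [/= Bb B'b'] <-]|[x y] A /= [[C C'] /= [xC yC'] CA]].
  by apply: open_prod; [exact: oB|exact: oB'].
have [b [Bb bx] bC] := bB _ _ xC; have [b' [B'b' by_] bC'] := bB' _ _ yC'.
exists (b `*` b'); first by split=> //; exists (b, b').
by move=> z [/bC ? /bC' ?]; exact: CA.
Qed.

Lemma open_transition n (M : manifold R n) (c c' : chart M) :
  open (cmap c @` (cdom c `&` cdom c')).
Proof.
rewrite openE => _ [p [cp c'p] <-].
have Up : (cmap c @` cdom c) (cmap c p) by exists p.
have := cinv_continuous Up; rewrite /prop_for /continuous_at cmapK// => cc.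
have Vp : \forall y \near cmap c p, cdom c' (cinv c y).
  by apply: cc; apply: open_nbhs_nbhs; split=> //; exact: cdom_open.
have Up' : \forall y \near cmap c p, (cmap c @` cdom c) y.
  by apply: open_nbhs_nbhs; split=> //; exact: cmap_open.
rewrite /interior; near=> y.
have [q cq qy] : (cmap c @` cdom c) y by near: y.
exists q => //; split=> //.
by rewrite -(cmapK cq) qy; near: y.
Unshelve. all: by end_near. Qed.

End ProductLemmas.

Section Product.
Context {R : realType} {m n : nat} (M : manifold R m) (N : manifold R n).

Definition pdom (c : chart M * chart N) := cdom c.1 `*` cdom c.2.
Definition pmap (c : chart M * chart N) (p : man_space M * man_space N) : 'rV[R]_(m + n) :=
  row_mx (cmap c.1 p.1) (cmap c.2 p.2).
Definition pinv (c : chart M * chart N) (y : 'rV[R]_(m + n)) :=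
  (cinv c.1 (lsubmx y), cinv c.2 (rsubmx y)).

Lemma pimage c c' (P : set (man_space M)) (Q : set (man_space N)) :
  pmap (c, c') @` (P `*` Q) =
  [set y | (cmap c @` P) (lsubmx y) /\ (cmap c' @` Q) (rsubmx y)].
Proof.
apply/seteqP; split=> [_ [[p q] [/= Pp Qq] <-]|y [[p Pp py] [q Qq qy]]] /=.
  by rewrite row_mxKl row_mxKr; split; [exists p|exists q].
by exists (p, q) => //; rewrite /pmap /= py qy hsubmxK.
Qed.

Lemma pdom_open c : open (pdom c).
Proof. by apply: open_prod; exact: cdom_open. Qed.

Lemma pmap_open c : open (pmap c @` pdom c).
Proof.
by case: c => c c'; rewrite pimage; apply: open_lrsubmx; exact: cmap_open.
Qed.

Lemma pmapK c p : pdom c p -> pinv c (pmap c p) = p.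
Proof.
by case: p => p q [/= cp cq]; rewrite /pinv row_mxKl row_mxKr !cmapK.
Qed.

Lemma pmap_continuous c p : pdom c p -> {for p, continuous (pmap c)}.
Proof.
move=> [cp cq]; apply: continuous_row_mx.
  apply: (@continuous_comp _ _ _ fst (cmap c.1)); first exact: cvg_fst.
  exact: cmap_continuous.
apply: (@continuous_comp _ _ _ snd (cmap c.2)); first exact: cvg_snd.
exact: cmap_continuous.
Qed.

Lemma pinv_continuous c x : (pmap c @` pdom c) x -> {for x, continuous (pinv c)}.
Proof.
case: c => c c'; rewrite pimage => -[cx c'x].
have cl : {for x, continuous (cinv c \o @lsubmx R 1 m n)}.
  by apply: continuous_comp; [exact: lsubmx_continuous|exact: cinv_continuous].
have cr : {for x, continuous (cinv c' \o @rsubmx R 1 m n)}.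
  by apply: continuous_comp; [exact: rsubmx_continuous|exact: cinv_continuous].
exact: cvg_pair cl cr.
Qed.

Lemma ptransition_smooth c c' :
  smooth_on (pmap c @` (pdom c `&` pdom c')) (pmap c' \o pinv c).
Proof.
case: c c' => c1 c2 [c1' c2'] k.
have -> : pdom (c1, c2) `&` pdom (c1', c2') =
    (cdom c1 `&` cdom c1') `*` (cdom c2 `&` cdom c2').
  by apply/seteqP; split=> [[p q] [[? ?] [? ?]]|[p q] [[? ?] [? ?]]].
rewrite pimage; exact: (Ck_on_row_mx
  (@open_transition _ _ M c1 c1') (@open_transition _ _ N c2 c2')
  (@transition_smooth _ _ M c1 c1' k) (@transition_smooth _ _ N c2 c2' k)).
Qed.

Definition prod_manifold : manifold R (m + n) :=
  Manifold (hausdorff_prod (@space_hausdorff _ _ M) (@space_hausdorff _ _ N))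
    (second_countable_prod (@space_second_countable _ _ M)
       (@space_second_countable _ _ N))
    pdom_open pmap_open pmapK pmap_continuous pinv_continuous
    ptransition_smooth.

End Product.

Section Interval.
Context {R : realType} (I : set R) (oI : open I).

Definition imap (_ : unit) (u : R) : 'rV[R]_1 := const_mx u.
Definition iinv (_ : unit) (x : 'rV[R]_1) : R := x 0 0.

Lemma iimage : imap tt @` I = [set x | I (x 0 0)].
Proof.
apply/seteqP; split=> [_ [u Iu <-]|x Ix] /=; first by rewrite mxE.
by exists (x 0 0) => //; apply/rowP => i; rewrite !ord1 mxE.
Qed.

Lemma imap_open c : open (imap c @` I).
Proof.
case: c; rewrite iimage; apply: open_comp => // x _; exact: coord_continuous.
Qed.

Lemma imapK c u : I u -> iinv c (imap c u) = u.
Proof. by rewrite /iinv mxE. Qed.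

Lemma imap_continuous c u : I u -> {for u, continuous (imap c)}.
Proof.
move=> _; apply: continuous_mx => i j.
by under [X in {for u, continuous X}]eq_fun do rewrite mxE; exact: cvg_id.
Qed.

Lemma iinv_continuous c x : (imap c @` I) x -> {for x, continuous (iinv c)}.
Proof. by move=> _; exact: coord_continuous. Qed.

Lemma itransition_smooth c c' : smooth_on (imap c @` (I `&` I)) (imap c' \o iinv c).
Proof.
have -> : imap c' \o iinv c = id.
  by apply/funext => x; apply/rowP => i; rewrite !ord1 mxE.
exact: smooth_on_id.
Qed.

Definition interval_manifold : manifold R 1 :=
  Manifold (@Rhausdorff R) second_countable_R (fun=> oI) imap_open imapK
    imap_continuous iinv_continuous itransition_smooth.

End Interval.

Section Tensors.
Context {R : realType}.

(* The value at a point, in coordinates, of a covariant k-tensor on R^n. *)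
Definition mform (n k : nat) := ('I_k -> 'rV[R]_n) -> R.

Definition ev1 n (a : mform n 1) (v : 'rV[R]_n) : R := a (fun=> v).

Definition ev2 n (a : mform n 2) (v w : 'rV[R]_n) : R := a (tnth [tuple v; w]).

Definition tsquare n (a : mform n 1) : mform n 2 :=
  fun v => ev1 a (v 0) * ev1 a (v 1).

Definition is_multilinear n k (a : mform n k) : Prop :=
  forall (v : 'I_k -> 'rV[R]_n) (i : 'I_k),
    linear (fun x : 'rV[R]_n => a (dfwith v i x) : R^o).

Definition is_alternating n k (a : mform n k) : Prop :=
  forall (v : 'I_k -> 'rV[R]_n) (i j : 'I_k), i != j -> v i = v j -> a v = 0.

(* Normalized so that (a /\ b)(v, w) = a(v) b(w) - a(w) b(v) for 1-forms. *)
Definition wedge n p q (a : mform n p) (b : mform n q) : mform n (p + q) :=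
  fun v => (p`! * q`!)%:R^-1 * \sum_(s : 'S_(p + q)) (-1) ^+ s *
    (a (fun i => v (s (lshift q i))) * b (fun j => v (s (rshift p j)))).

(* With constant vector fields v i; same normalization as [wedge]:
   (d a)(v, w) = v(a(w)) - w(a(v)) for a 1-form a. *)
Definition extd n k (a : 'rV[R]_n -> mform n k) (x : 'rV[R]_n) :
    mform n k.+1 :=
  fun v => \sum_(i < k.+1) (-1) ^+ i *
    'D_(v i) (fun y => a y (fun j => v (lift i j)) : R^o) x.

Section OnManifold.
Context {n : nat} (M : manifold R n).

Definition region (c : chart M) (W : set (man_space M)) : set 'rV[R]_n :=
  cmap c @` (cdom c `&` W).

Definition transition (c c' : chart M) (x : 'rV[R]_n) : 'rV[R]_n :=
  cmap c' (cinv c x).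

(* A tensor field is given by its local representatives in all charts; on an
   open set W it has to satisfy [is_tensor W], and its representatives are
   irrelevant off [region c W]. *)
Definition tensor (k : nat) := chart M -> 'rV[R]_n -> mform n k.

Definition is_tensor (W : set (man_space M)) k (a : tensor k) : Prop :=
  [/\ forall c x, region c W x -> is_multilinear (a c x),
      forall c v, smooth_on (region c W) (fun x => a c x v : R^o) &
      forall c c' x v, region c (cdom c' `&` W) x ->
        a c x v = a c' (transition c c' x)
                    (fun i => 'D_(v i) (transition c c') x)].

Definition is_form (W : set (man_space M)) k (a : tensor k) : Prop :=
  is_tensor W a /\ forall c x, region c W x -> is_alternating (a c x).

Definition is_metric (g : tensor 2) : Prop :=
  is_tensor setT g /\
  forall c x, region c setT x ->
    (forall v w, ev2 (g c x) v w = ev2 (g c x) w v) /\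
    (forall v, v != 0 -> 0 < ev2 (g c x) v v).

(* Fields of endomorphisms of the tangent spaces, in coordinates. *)
Definition endo := chart M -> 'rV[R]_n -> 'rV[R]_n -> 'rV[R]_n.

Definition is_endo (W : set (man_space M)) (J : endo) : Prop :=
  [/\ forall c x, region c W x -> linear (J c x),
      forall c v, smooth_on (region c W) (fun x => J c x v) &
      forall c c' x v, region c (cdom c' `&` W) x ->
        J c' (transition c c' x) ('D_v (transition c c') x) =
        'D_(J c x v) (transition c c') x].

Definition orthogonal (g : tensor 2) (H : chart M -> 'rV[R]_n -> set 'rV[R]_n)
    (c : chart M) (x : 'rV[R]_n) : set 'rV[R]_n :=
  [set v | forall w, H c x w -> ev2 (g c x) v w = 0].

(* Christoffel symbols Gamma^k_ij of the Levi-Civita connection of g. *)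
Definition christoffel (g : tensor 2) (c : chart M) (x : 'rV[R]_n)
    (i j k : 'I_n) : R :=
  let e (i : 'I_n) : 'rV[R]_n := delta_mx 0 i in
  let G y := \matrix_(i, j) ev2 (g c y) (e i) (e j) in
  let dG (i j l : 'I_n) := 'D_(e i) (fun y => G y j l : R^o) x in
  2^-1 * \sum_l invmx (G x) k l * (dG i j l + dG j i l - dG l i j).

(* (nabla_w a)(v_1, ..., v_k) for constant vector fields v_i, w. *)
Definition nabla (g : tensor 2) k (a : tensor k) (c : chart M)
    (x w : 'rV[R]_n) : mform n k :=
  fun v => 'D_w (fun y => a c y v : R^o) x -
    \sum_(m < k) a c x (dfwith v m (\row_l
      \sum_i \sum_j w 0 i * v m 0 j * christoffel g c x i j l)).

Definition is_parallel (g : tensor 2) k (a : tensor k) : Prop :=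
  forall c x w v, region c setT x -> nabla g a c x w v = 0.

End OnManifold.

(* The monomial dx_a /\ dx_b /\ dx_c /\ dx_d on R^8. *)
Definition dx4 (a b c d : nat) : mform 8 4 := fun v =>
  \det (\matrix_(i < 4, j < 4) v i 0 (inord (nth 0%N [:: a; b; c; d] j))).

(* The Cayley form in Joyce's convention, with indices starting from 0. *)
Definition cayley : mform 8 4 := fun v =>
  dx4 0 1 2 3 v + dx4 0 1 4 5 v + dx4 0 1 6 7 v + dx4 0 2 4 6 v
  - dx4 0 2 5 7 v - dx4 0 3 4 7 v - dx4 0 3 5 6 v - dx4 1 2 4 7 v
  - dx4 1 2 5 6 v - dx4 1 3 4 6 v + dx4 1 3 5 7 v + dx4 2 3 4 5 v
  + dx4 2 3 6 7 v + dx4 4 5 6 7 v.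

(* The columns of P are the coframe: v *m P lists the values on v. *)
Definition is_spin7 (N : manifold R 8) (g : tensor N 2) (psi : tensor N 4) :
    Prop :=
  [/\ is_metric g, is_form setT psi &
   exists2 k : R, k != 0 & forall c x, region c setT x ->
     exists P : 'M[R]_8,
       (forall v w, ev2 (g c x) v w =
          \sum_i (v *m P) 0 i * (w *m P) 0 i) /\
       (forall v, psi c x v = k * cayley (fun i => v i *m P))].

End Tensors.
Arguments mform : clear implicits.

Section Sp1Sp1.
Context {R : realType}.

(* The indices 1, 2, 3 are represented by 0, 1, 2 in Z/3. *)
Definition eps (s : 'I_3) : R := if s == 2 then -1 else 1.

(* H_x is given as a set of tangent vectors, and V is its orthogonal complement
   for sp_metric. The I_s and the elements of Q, which live on H, are extended
   by zero on V, as gH is. *)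
Record sp1sp1 (M : manifold R 7) := Sp1Sp1 {
  sp_metric : tensor M 2 ;
  sp_H : chart M -> 'rV[R]_7 -> set 'rV[R]_7 ;
  sp_gH : tensor M 2 ;
  sp_Q : chart M -> 'rV[R]_7 -> set ('rV[R]_7 -> 'rV[R]_7) ;
  sp_index : Type ;
  sp_dom : sp_index -> set (man_space M) ;
  sp_eta : sp_index -> 'I_3 -> tensor M 1 ;
  sp_I : sp_index -> 'I_3 -> endo M ;
  sp_metricP : is_metric sp_metric ;
  sp_dom_open : forall j, open (sp_dom j) ;
  sp_dom_cover : forall p c, cdom (m := M) c p -> exists j, sp_dom j p ;
  sp_eta_form : forall j s, is_form (sp_dom j) (sp_eta j s) ;
  sp_I_endo : forall j s, is_endo (sp_dom j) (sp_I j s) ;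
  sp_HE : forall j c x, region c (sp_dom j) x -> forall v,
    sp_H c x v <-> forall s, ev1 (sp_eta j s c x) v = 0 ;
  sp_eta_orthonormal : forall j c x, region c (sp_dom j) x ->
    exists xi : 'I_3 -> 'rV[R]_7, forall s t,
      [/\ orthogonal sp_metric sp_H c x (xi s),
          ev2 (sp_metric c x) (xi s) (xi t) = (s == t)%:R &
          ev1 (sp_eta j s c x) (xi t) = (s == t)%:R] ;
  sp_gH_tensor : is_tensor setT sp_gH ;
  sp_gHE : forall c x, region c setT x -> forall v w,
    sp_H c x v -> sp_H c x w ->
    ev2 (sp_gH c x) v w = ev2 (sp_metric c x) v w ;
  sp_gHV : forall c x, region c setT x -> forall v w,
    orthogonal sp_metric sp_H c x v ->
    ev2 (sp_gH c x) v w = 0 /\ ev2 (sp_gH c x) w v = 0 ;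
  sp_I_H : forall j s c x, region c (sp_dom j) x -> forall v,
    sp_H c x v -> sp_H c x (sp_I j s c x v) ;
  sp_I_V : forall j s c x, region c (sp_dom j) x -> forall v,
    orthogonal sp_metric sp_H c x v -> sp_I j s c x v = 0 ;
  sp_I_sqr : forall j s c x, region c (sp_dom j) x -> forall v,
    sp_H c x v -> sp_I j s c x (sp_I j s c x v) = - v ;
  sp_I_quaternion : forall j c x, region c (sp_dom j) x -> forall v,
    sp_H c x v ->
    let J s := sp_I j s c x in
    [/\ J 0 (J 1 v) = J 2 v, J 1 (J 0 v) = - J 2 v &
        J 0 (J 1 (J 2 v)) = - v] ;
  sp_I_isometry : forall j s c x, region c (sp_dom j) x -> forall v w,
    sp_H c x v -> sp_H c x w ->
    ev2 (sp_gH c x) (sp_I j s c x v) (sp_I j s c x w) =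
    ev2 (sp_gH c x) v w ;
  sp_QE : forall j c x, region c (sp_dom j) x -> forall E,
    sp_Q c x E <-> exists a : 'I_3 -> R,
      forall v, E v = \sum_s a s *: sp_I j s c x v }.

Section Forms.
Context {M : manifold R 7} (S : sp1sp1 M).

Definition sp_omega (j : sp_index S) (s : 'I_3) : tensor M 2 :=
  fun c x v => ev2 (sp_gH S c x) (sp_I j s c x (v 0)) (v 1).

Definition sp_phi (j : sp_index S) : tensor M 3 := fun c x =>
  let w s := sp_omega j s c x in
  let h s := sp_eta j s c x in
  2 *: (wedge (w 0) (h 0) : mform R 7 3) + 2 *: (wedge (w 1) (h 1) : mform R 7 3)
  - 2 *: (wedge (w 2) (h 2) : mform R 7 3)
  + 2 *: (wedge (wedge (h 0) (h 1)) (h 2) : mform R 7 3).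

Definition globally_defined k (a : sp_index S -> tensor M k) : Prop :=
  forall j j' c x, region c (sp_dom j `&` sp_dom j') x -> a j c x = a j' c x.

Definition structure_equations (tau : R) : Prop :=
  forall j (i : 'I_3) c x, region c (sp_dom j) x ->
    extd (sp_eta j i c) x =
      2 *: sp_omega j i c x
      + (2 * tau) *: (wedge (sp_eta j (i + 1) c x) (sp_eta j (i + 2) c x)
                       : mform R 7 2).

End Forms.

Section Cylinder.
Context (M : manifold R 7) (I : set R) (oI : open I).

Definition cylinder : manifold R 8 := prod_manifold M (interval_manifold oI).

Definition ucoord (y : 'rV[R]_8) : R := @rsubmx R 1 7 1 y 0 0.

Definition du : mform R 8 1 := fun v => ucoord (v 0).

Definition pullback k (a : tensor M k) : tensor cylinder k :=
  fun c y v => a c.1 (@lsubmx R 1 7 1 y) (fun i => @lsubmx R 1 7 1 (v i)).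

Context (S : sp1sp1 M) (tau a : R).

Definition bcoef (u : R) : R := (tau * u `^ (5 / 3) - a) / (5 * u `^ (2 / 3)).

Definition cyl_metric (j : sp_index S) : tensor cylinder 2 := fun c y =>
  let u := ucoord y in
  u *: pullback (sp_gH S) c y
  + bcoef u *: (\sum_(s < 3) tsquare (pullback (sp_eta j s) c y))
  + (5 * u `^ (2 / 3) / (36 * (tau * u `^ (5 / 3) - a))) *: tsquare du.

Definition cyl_F (j : sp_index S) (i : 'I_3) : tensor cylinder 2 := fun c y =>
  let u := ucoord y in
  let h s := pullback (sp_eta j s) c y in
  u *: pullback (sp_omega j i) c y
  - (eps i * bcoef u) *: (wedge (h (i + 1)) (h (i + 2)) : mform R 8 2)
  - (eps i / 6) *: (wedge (h i) du : mform R 8 2).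

Definition cyl_psi (j : sp_index S) : tensor cylinder 4 := fun c y =>
  let F i := cyl_F j i c y in
  (wedge (F 0) (F 0) : mform R 8 4) + (wedge (F 1) (F 1) : mform R 8 4)
  - (wedge (F 2) (F 2) : mform R 8 4).

End Cylinder.

End Sp1Sp1.

(* Main.v *)
Require Import Defs.
From mathcomp Require Import all_boot all_order all_algebra.
From mathcomp Require Import all_classical all_reals all_analysis.
From mathcomp Require Import perm ring lra.

(** The idea is to describe metric and 4-form by one orthonormal coframe and to
    deduce that the 4-form is parallel from its being closed.

    Let [b] denote the coefficient of the squares of the [eta_s] in the metric.
    Near every point there is a horizontal coframe [e_0, .., e_3] in which [gH]
    and the [omega_i] have their quaternionic normal form ([smooth_coframe]). In
    the coframe [sqrt u e_a, du / (6 sqrt b), sqrt b eta_1, sqrt b eta_2,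
    - sqrt b eta_3] the metric is standard and [psi] is twice the Cayley form
    ([cayley_standard], [local_coframe]).

    The signs in the definition of the [F_i] cancel in [psi], which is thus an
    expression in the triples [omega] and [eta] that is invariant under rotations
    ([signed_squares], [triple_form_rotation]). Two local gauges differ by a
    rotation, the same one for both triples ([gauge_rotation]); therefore the
    local expressions agree on overlaps.

    The structure equations give [d eta_i], and [d omega_i] is determined by
    [d (d eta_i) = 0], that is by the symmetry of second derivatives ([domega]).
    Together with the differential equation [(u b)' = (tau u + b) / 3] this makes
    [d psi], twice the sum of the [eps_i dF_i /\ F_i], vanish
    ([closed_identity], [cyl_psi_closed]).

    In an orthonormal coframe the covariant derivative of [psi] in the direction
    [w] is given by the action on the Cayley form of the connection matrix [A_w],
    which is skew. This action only depends on the seven coordinates of [A_w] in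
    so(8) modulo spin(7), and as the connection is torsion-free, [d psi] is the
    alternation of the covariant derivative. Its vanishing is a system of 56
    linear equations for 8 times 7 unknowns, which splits into eight nonsingular
    systems of size seven ([alt_system], [fernandez]); hence [psi] is parallel
    ([closed_parallel]). *)

Set Implicit Arguments.
Unset Strict Implicit.
Unset Printing Implicit Defensive.
Import Order.TTheory GRing.Theory Num.Theory numFieldNormedType.Exports.
Local Open Scope classical_set_scope.
Local Open Scope ring_scope.

(** * Directional derivatives *)

Section DirectionalDerivatives.
Context {R : realType} {V : normedModType R}.
Implicit Types (f g : V -> R^o) (x v w : V) (U : set V).

Lemma is_derive_line (W : normedModType R) (f : V -> W) x v (t : R) d :
  is_derive (t *: v + x) v f d ->
  is_derive t (1 : R) (fun h : R => f (h *: v + x)) d.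
Proof.
move=> [df dv].
have E : (fun h : R => h^-1 *: (((fun h : R => f (h *: v + x)) \o shift t) (h *: (1 : R)) - f (t *: v + x))) =
   (fun h : R => h^-1 *: ((f \o shift (t *: v + x)) (h *: v) - f (t *: v + x))).
  apply/funext => h /=; congr (_ *: (f _ - _)).
  by rewrite [_ *: 1]mulr1 scalerDl addrA.
by split; rewrite /derivable /derive E.
Qed.

Lemma is_derive_comp_scalar (g : R -> R) f x v (df dg : R) :
  is_derive x v f df -> is_derive (f x) (1 : R) g dg ->
  is_derive x v (fun y => g (f y) : R^o) (dg * df).
Proof.
move=> hf hg.
have hl : is_derive (0 : R) (1 : R) (fun h : R => f (h *: v + x)) df.
  by apply: is_derive_line; rewrite scale0r add0r.
have hg' : is_derive (f (0 *: v + x)) (1 : R) g dg by rewrite scale0r add0r.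
have d1 : derivable (fun h : R => g (f (h *: v + x)) : R^o) 0 1.
  apply: diff_derivable; apply: differentiable_comp.
    by apply/derivable1_diffP; case: hl.
  by apply/derivable1_diffP; case: hg'.
split; first exact/derivable1P.
have E : (fun h : R => h^-1 *: (((fun y => g (f y) : R^o) \o shift x) (h *: v) - g (f x))) =
  (fun h : R => h^-1 *: (((fun h : R => g (f (h *: v + x))) \o shift 0) (h *: (1:R)) - g (f (0 *: v + x)))).
  by apply/funext => h /=; rewrite addr0 scale0r add0r [_%:A]mulr1.
rewrite /derive E -/(derive (fun h : R => g (f (h *: v + x))) 0 1).
rewrite -derive1E (@derive1_comp _ (fun h : R => f (h *: v + x)) g).
- by rewrite !derive1E; case: hl => _ ->; case: hg' => _ ->.
- by case: hl.
- by case: hg'.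
Qed.

Lemma mean_value_line f (df : V -> R) x v (h : R) : 0 < h ->
  (forall t : R, 0 <= t <= h -> is_derive (t *: v + x) v f (df (t *: v + x))) ->
  exists2 t : R, 0 <= t <= h & f (h *: v + x) - f x = h * df (t *: v + x).
Proof.
move=> h0 fd.
have dl t : t \in `[0, h]%R ->
    is_derive t (1 : R) (fun h : R => f (h *: v + x)) (df (t *: v + x)).
  by rewrite in_itv /= => th; apply: is_derive_line; exact: fd.
pose F : R -> R := fun h => f (h *: v + x).
have cF : {within `[0, h], continuous F}.
  by apply: derivable_within_continuous => t /dl [].
have dF t : t \in `]0, h[%R -> is_derive t (1 : R) F (df (t *: v + x)).
  by move=> th; apply: dl; exact: subset_itv_oo_cc th.
have [t] := MVT_segment (ltW h0) dF cF.
rewrite in_itv /= => th; rewrite /F scale0r add0r subr0 mulrC => e.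
by exists t.
Qed.

(** Supplies the small parallelograms on which second differences are taken. *)
Lemma near_parallelogram (P : set V) x v w : nbhs x P ->
  exists2 r : R, 0 < r & forall s t : R,
    `|s| <= r -> `|t| <= r -> P (s *: v + (t *: w + x)).
Proof.
case/nbhs_normP => e /= e0 eP.
have d0 : 0 < `|v| + `|w| + 1 by rewrite ltr_wpDl// addr_ge0.
exists (e / (`|v| + `|w| + 1) / 2) => [|s t hs ht]; first by rewrite !divr_gt0.
apply: eP; rewrite /ball_ /=.
rewrite addrA opprD addrCA subrr addr0 normrN.
apply: (@le_lt_trans _ _ (e / (`|v| + `|w| + 1) / 2 * (`|v| + `|w|))).
  rewrite mulrDr; apply: (le_trans (ler_normD _ _)); rewrite !normrZ.
  by apply: lerD; apply: ler_wpM2r.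
apply: (@le_lt_trans _ _ (e / 2)); last by rewrite ltr_pdivrMr//; lra.
rewrite mulrAC ler_pM2r// mulrAC ler_pdivrMr// ler_pM2l//.
by rewrite lerDl.
Qed.

Lemma Ck_on_continuous (W : normedModType R) U k (f : V -> W) x :
  Ck_on U k f -> U x -> {for x, continuous f}.
Proof. by case: k => [|k] [fc _]; exact: fc. Qed.

Lemma Ck_on_derivable (W : normedModType R) U k (f : V -> W) x v :
  Ck_on U k.+1 f -> U x -> derivable f x v.
Proof. by move=> [_ /(_ v)[fd _]]; exact: fd. Qed.

Lemma Ck_on_derive (W : normedModType R) U k (f : V -> W) v :
  Ck_on U k.+1 f -> Ck_on U k ('D_v f).
Proof. by move=> [_ /(_ v)[_ ]]. Qed.

Lemma Ck_on_is_derive (W : normedModType R) U k (f : V -> W) x v :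
  Ck_on U k.+1 f -> U x -> is_derive x v f ('D_v f x).
Proof. by move=> cf Ux; apply: derivableP; exact: Ck_on_derivable cf Ux. Qed.

Lemma Ck_onW (W : normedModType R) U k (f : V -> W) :
  Ck_on U k.+1 f -> Ck_on U k f.
Proof.
elim: k f => [|k IH] f [fc fd]; split=> // v.
have [d c] := fd v; split=> //; exact: IH.
Qed.

(** Both mixed derivatives are limits of the same second difference, evaluated
    with the mean value theorem in the two possible orders. *)
Lemma derive_comm U f x v w : open U -> U x -> Ck_on U 2 f ->
  'D_v ('D_w f) x = 'D_w ('D_v f) x.
Proof.
move=> oU Ux cf.
have half (v1 v2 : V) (e : R) : 0 < e -> exists2 r : R, 0 < r & forall h, 0 < h <= r ->
    `|(f (h *: v1 + (h *: v2 + x)) - f (h *: v1 + x) - (f (h *: v2 + x) - f x)) -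
      h ^+ 2 * 'D_v2 ('D_v1 f) x| <= h ^+ 2 * e.
  move=> e0.
  have cD := Ck_on_continuous (Ck_on_derive v2 (Ck_on_derive v1 cf)) Ux.
  have /(near_parallelogram v2 v1) [r r0 rP] :
     \forall y \near x, U y /\ `|'D_v2 ('D_v1 f) x - 'D_v2 ('D_v1 f) y| <= e.
    near=> y; split; first by near: y; exact: open_nbhs_nbhs.
    by near: y; move/cvgrPdist_le : cD; apply.
  exists r => // h /andP[h0 hr].
  have r1 t : 0 <= t <= h -> `|t| <= r.
    by case/andP=> t0 th; rewrite ger0_norm// (le_trans th).
  have H1 t : 0 <= t <= h -> is_derive (t *: v1 + x) v1
     (fun y => f (y + h *: v2) - f y : R^o)
     ((fun y => 'D_v1 f (y + h *: v2) - 'D_v1 f y) (t *: v1 + x)).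
    move=> th.
    have d1 : is_derive (t *: v1 + x) v1 f ('D_v1 f (t *: v1 + x)).
      apply: Ck_on_is_derive cf _.
      have [||+ _] := rP 0 t; first by rewrite normr0 ltW.
        exact: r1.
      by rewrite scale0r add0r.
    apply: is_deriveB.
    have Uy : U (t *: v1 + x + h *: v2).
      have [||+ _] := rP h t; first by rewrite gtr0_norm.
        exact: r1.
      by rewrite addrC.
    have [dd _] := Ck_on_is_derive v1 cf Uy.
    have E : (fun k : R => k^-1 *: (((fun y => f (y + h *: v2)) \o shift (t *: v1 + x)) (k *: v1) - f (t *: v1 + x + h *: v2))) =
       (fun k : R => k^-1 *: ((f \o shift (t *: v1 + x + h *: v2)) (k *: v1) - f (t *: v1 + x + h *: v2))).
      by apply/funext => k /=; rewrite !addrA.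
    by split; rewrite /derivable /derive E.
  have [t th e1] := mean_value_line
    (df := fun y => 'D_v1 f (y + h *: v2) - 'D_v1 f y) h0 H1.
  have H2 s : 0 <= s <= h -> is_derive (s *: v2 + (t *: v1 + x)) v2 ('D_v1 f)
      ('D_v2 ('D_v1 f) (s *: v2 + (t *: v1 + x))).
    move=> sh; apply: Ck_on_is_derive (Ck_on_derive v1 cf) _.
    by have [||] := rP s t; rewrite ?r1.
  have [s sh e2] := mean_value_line (df := 'D_v2 ('D_v1 f)) h0 H2.
  have -> : f (h *: v1 + (h *: v2 + x)) - f (h *: v1 + x) - (f (h *: v2 + x) - f x) =
     h ^+ 2 * 'D_v2 ('D_v1 f) (s *: v2 + (t *: v1 + x)).
    rewrite expr2 -mulrA -e2 [h *: v2 + (t *: _ + _)]addrC -e1.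
    by rewrite -[h *: v1 + x + _]addrA [x + h *: v2]addrC; ring.
  rewrite -mulrBr normrM gtr0_norm ?exprn_gt0//.
  apply: ler_wpM2l; first by rewrite exprn_ge0// ltW.
  by rewrite distrC; have [||_ ] := rP s t; rewrite ?r1.
apply/eqP; rewrite -subr_eq0 -normr_le0; apply/ler_addgt0Pl => e e0.
rewrite addr0.
have e20 : 0 < e / 2 by rewrite divr_gt0.
have [r1 r10 h1] := half w v _ e20.
have [r2 r20 h2] := half v w _ e20.
pose h := Num.min r1 r2.
have hp : 0 < h by rewrite lt_min r10.
have {h1} := h1 h; rewrite hp ge_min lexx => /(_ isT).
have {h2} := h2 h; rewrite hp ge_min lexx orbT => /(_ isT).
rewrite [h *: w + (h *: v + x)]addrCA.
have swap (p q r s : R) : p - q - (r - s) = p - r - (q - s) by ring.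
rewrite (swap (f (h *: v + (h *: w + x))) (f (h *: w + x)) (f (h *: v + x))).
move: (f (h *: v + (h *: w + x)) - f (h *: v + x) - (f (h *: w + x) - f x)) => A.
clear swap.
move=> h2 h1.
have : h ^+ 2 * `|'D_v ('D_w f) x - 'D_w ('D_v f) x| <= h ^+ 2 * e.
  rewrite -[h ^+ 2 in X in X <= _]gtr0_norm ?exprn_gt0// -normrM.
  have -> : h ^+ 2 * ('D_v ('D_w f) x - 'D_w ('D_v f) x) =
    (A - h ^+ 2 * 'D_w ('D_v f) x) - (A - h ^+ 2 * 'D_v ('D_w f) x).
    by move: ('D_w _ _) ('D_v _ _) => p q; ring.
  apply: (le_trans (ler_normB _ _)); apply: (le_trans (lerD h2 h1)).
  by rewrite -mulrDr -splitr.
by rewrite ler_pM2l// exprn_gt0.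
Unshelve. all: by end_near. Qed.

(** The increment along [v + w] is an increment along [w] followed by one along
    [v]; by the mean value theorem the latter is a derivative in the direction
    [v] at a nearby point, so that continuity of [D_v f] gives the limit. *)
Lemma derive_dir_linear U f x v w (a : R) : open U -> U x -> Ck_on U 1 f ->
  'D_(a *: v + w) f x = a * 'D_v f x + 'D_w f x.
Proof.
move=> oU Ux cf.
have scl (b : R) u y : U y -> 'D_(b *: u) f y = b * 'D_u f y.
  move=> Uy.
  have d1 : is_derive (0 : R) (1 : R) (fun h : R => f (h *: u + y)) ('D_u f y).
    by apply: is_derive_line; rewrite scale0r add0r; apply: Ck_on_is_derive cf _.
  have db : is_derive (0 : R) (1 : R) (fun h : R => h * b : R^o) b.
    have -> : (fun h : R => h * b : R^o) = b *: (id : R^o -> R^o).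
      by apply/funext => h; rewrite mulrC.
    have := is_deriveZ b (is_derive_id (0 : R^o) (1 : R^o)).
    by rewrite [b *: 1]mulr1.
  have d1' : is_derive ((fun h => h * b) (0:R)) (1 : R)
     (fun h : R => f (h *: u + y)) ('D_u f y) by rewrite mul0r.
  have E : (fun h : R => h^-1 *: ((f \o shift y) (h *: (b *: u)) - f y)) =
    (fun h : R => h^-1 *: (((fun h : R => f ((h * b) *: u + y)) \o shift 0) (h *: (1:R)) - f ((0 * b) *: u + y))).
    by apply/funext => h /=; rewrite addr0 mul0r scale0r add0r [_%:A]mulr1 scalerA.
  rewrite {1}/derive E -/(derive (fun h : R => f ((h * b) *: u + y)) 0 1).
  rewrite -derive1E (@derive1_comp _ (fun h => h * b) (fun h : R => f (h *: u + y))).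
  - by rewrite !derive1E; case: db => _ ->; case: d1' => _ ->; rewrite mulrC.
  - by case: db.
  - by case: d1'.
rewrite -(scl a v x Ux); move: (a *: v) => {}v.
have dS : (fun h : R => h^-1 *: ((f \o shift x) (h *: (v + w)) - f x)) =
   (fun h : R => h^-1 *: (f (h *: v + (h *: w + x)) - f (h *: w + x))) +
   (fun h : R => h^-1 *: ((f \o shift x) (h *: w) - f x)).
  apply/funext => h /=; rewrite -[RHS]/(_ + _) -scalerDr; congr (_ *: _).
  by rewrite subrKA scalerDr addrA.
rewrite /derive dS; apply: cvg_lim => //; apply: cvgD; last first.
  exact: (Ck_on_derivable (v := w) cf Ux).
rewrite -/(derive f x v).
have cD := Ck_on_continuous (Ck_on_derive v cf) Ux.
apply/cvgrPdist_le => e e0.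
have /(near_parallelogram v w) [r r0 rP] :
   \forall y \near x, U y /\ `|'D_v f x - 'D_v f y| <= e.
  near=> y; split; first by near: y; exact: open_nbhs_nbhs.
  by near: y; move/cvgrPdist_le : cD; apply.
near=> h.
have h0 : h != 0 by near: h; exact: nbhs_dnbhs_neq.
have hr : `|h| <= r.
  by near: h; apply: nbhs_dnbhs; apply: (@nbhs0_le R R^o).
pose s : R := Num.sg h.
have H1 t : 0 <= t <= `|h| -> is_derive (t *: (s *: v) + (h *: w + x)) (s *: v) f
      ('D_(s *: v) f (t *: (s *: v) + (h *: w + x))).
  case/andP=> t0 th; apply: (Ck_on_is_derive _ cf).
  have [|//|Ut _] := rP (t * s) h; last by rewrite scalerA.
  by rewrite normrM normr_sg h0 mulr1 ger0_norm// (le_trans th).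
have nh : 0 < `|h| by rewrite normr_gt0.
have [t /andP[t0 th]] := mean_value_line (df := 'D_(s *: v) f) nh H1.
have [|//|Ut dt] := rP (t * s) h.
  by rewrite normrM normr_sg h0 mulr1 ger0_norm// (le_trans th).
rewrite scalerA [`|h| * s]mulrC mulr_sg_norm scalerA scl//.
rewrite mulrA [`|h| * s]mulrC mulr_sg_norm => ->.
by rewrite /GRing.scale /= mulrA mulVf// mul1r.
Unshelve. all: by end_near. Qed.

End DirectionalDerivatives.

(** * Smooth functions *)

Section SmoothFunctions.
Context {R : realType} {V : normedModType R}.
Implicit Types (f g : V -> R^o) (x v w : V) (U : set V).

Lemma Ck_on_subset (W : normedModType R) U U' k (f : V -> W) :
  U' `<=` U -> Ck_on U k f -> Ck_on U' k f.
Proof.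
move=> sU; elim: k f => [|k IH] f [fc fd].
  by split=> // x /sU; exact: fc.
split=> [x /sU|v]; first exact: fc.
have [d c] := fd v; split=> [x /sU|]; [exact: d|exact: IH].
Qed.

(** Smoothness will be read off from coframes that exist only near each point. *)
Lemma Ck_on_local (W : normedModType R) U k (f : V -> W) :
  (forall x, U x -> exists2 U' : set V, U' x & Ck_on U' k f) -> Ck_on U k f.
Proof.
elim: k f => [|k IH] f loc.
  by split=> // x /loc[U' U'x [fc _]]; exact: fc.
split=> [x /loc[U' U'x [fc _]]|v]; first exact: fc.
split=> [x /loc[U' U'x cf]|]; first exact: Ck_on_derivable cf U'x.
by apply: IH => x /loc[U' U'x cf]; exists U' => //; exact: Ck_on_derive.
Qed.

Lemma Ck_onD U k f g : open U ->
  Ck_on U k f -> Ck_on U k g -> Ck_on U k (fun x => f x + g x : R^o).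
Proof.
move=> oU; elim: k f g => [|k IH] f g cf cg.
  by split=> // x Ux; apply: continuousD; [exact: cf.1|exact: cg.1].
split=> [x Ux|v]; first by apply: continuousD; [exact: cf.1|exact: cg.1].
split=> [x Ux|].
  by apply: derivableD; [exact: Ck_on_derivable cf Ux|exact: Ck_on_derivable cg Ux].
apply: (eq_Ck_on oU _ (IH _ _ (Ck_on_derive v cf) (Ck_on_derive v cg))) => x Ux.
by rewrite deriveD//; [exact: Ck_on_derivable cf Ux|exact: Ck_on_derivable cg Ux].
Qed.

Lemma Ck_onM U k f g : open U ->
  Ck_on U k f -> Ck_on U k g -> Ck_on U k (fun x => f x * g x : R^o).
Proof.
move=> oU; elim: k f g => [|k IH] f g cf cg.
  by split=> // x Ux; apply: continuousM; [exact: cf.1|exact: cg.1].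
split=> [x Ux|v]; first by apply: continuousM; [exact: cf.1|exact: cg.1].
split=> [x Ux|].
  by apply: derivableM; [exact: Ck_on_derivable cf Ux|exact: Ck_on_derivable cg Ux].
have := Ck_onD oU (IH _ _ (Ck_onW cf) (Ck_on_derive v cg))
                  (IH _ _ (Ck_onW cg) (Ck_on_derive v cf)).
apply: (eq_Ck_on oU) => x Ux.
by rewrite deriveM//; [exact: Ck_on_derivable cf Ux|exact: Ck_on_derivable cg Ux].
Qed.

Lemma Ck_onZ U k (a : R) f : open U ->
  Ck_on U k f -> Ck_on U k (fun x => a * f x : R^o).
Proof. by move=> oU cf; apply: Ck_onM => //; exact: Ck_on_cst. Qed.

Lemma Ck_onN U k f : open U -> Ck_on U k f -> Ck_on U k (fun x => - f x : R^o).
Proof.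
move=> oU cf; apply: eq_Ck_on (Ck_onZ (-1) oU cf) => // x _.
by rewrite mulN1r.
Qed.

Lemma Ck_onB U k f g : open U ->
  Ck_on U k f -> Ck_on U k g -> Ck_on U k (fun x => f x - g x : R^o).
Proof. by move=> oU cf cg; apply: Ck_onD => //; exact: Ck_onN. Qed.

Lemma Ck_on_sum U k (I : Type) (r : seq I) (F : I -> V -> R^o) : open U ->
  (forall i, Ck_on U k (F i)) -> Ck_on U k (fun x => \sum_(i <- r) F i x : R^o).
Proof.
move=> oU cF; elim: r => [|i r IH].
  by under eq_fun do rewrite big_nil; exact: Ck_on_cst.
by under eq_fun do rewrite big_cons; apply: Ck_onD.
Qed.

Lemma Ck_on_prod U k (I : Type) (r : seq I) (F : I -> V -> R^o) : open U ->
  (forall i, Ck_on U k (F i)) -> Ck_on U k (fun x => \prod_(i <- r) F i x : R^o).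
Proof.
move=> oU cF; elim: r => [|i r IH].
  by under eq_fun do rewrite big_nil; exact: Ck_on_cst.
by under eq_fun do rewrite big_cons; apply: Ck_onM.
Qed.

(** By induction on [k] for all exponents at once: the derivative of [f^p] is
    [p f^(p-1)] times that of [f]. *)
Lemma Ck_on_powR U k (p : R) f : open U -> (forall x, U x -> 0 < f x) ->
  Ck_on U k f -> Ck_on U k (fun x => f x `^ p : R^o).
Proof.
move=> oU f0; have fcont (q : R) x : U x -> {for x, continuous f} ->
    {for x, continuous (fun x => f x `^ q : R^o)}.
  move=> Ux fc.
  apply: (@continuous_comp _ _ _ f (fun t : R => t `^ q)) => //.
  apply/differentiable_continuous/derivable1_diffP.
  by apply: derivable_powR; rewrite in_itv /= f0.
elim: k p f f0 fcont => [|k IH] p f f0 fcont cf.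
  by split=> // x Ux; apply: fcont => //; exact: cf.1.
have dp (x v : V) : U x -> is_derive x v (fun x => f x `^ p : R^o)
    ((p * f x `^ (p - 1)) * 'D_v f x).
  move=> Ux; apply: (@is_derive_comp_scalar _ _ (fun t : R => t `^ p) f x v).
    exact: Ck_on_is_derive cf Ux.
  by apply: is_derive1_powR; exact: f0.
split=> [x Ux|v]; first by apply: fcont => //; exact: cf.1.
split=> [x Ux|]; first by case: (dp x v Ux).
have := Ck_onM oU (Ck_onZ p oU (IH (p - 1) f f0 fcont (Ck_onW cf))) (Ck_on_derive v cf).
by apply: (eq_Ck_on oU) => x Ux; case: (dp x v Ux).
Qed.

Lemma Ck_on_inv U k f : open U -> (forall x, U x -> 0 < f x) ->
  Ck_on U k f -> Ck_on U k (fun x => (f x)^-1 : R^o).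
Proof.
move=> oU f0 cf; apply: eq_Ck_on (Ck_on_powR (-1) oU f0 cf) => // x Ux.
by rewrite powRN powRr1// ltW// f0.
Qed.

End SmoothFunctions.

Section LinearChangeOfVariable.
Context {R : realType} {V W : normedModType R} (L : V -> W).
Hypotheses (linL : linear L) (contL : continuous L).

Lemma line_quotient_comp (X : normedModType R) (h : W -> X) x v :
  (fun t : R => t^-1 *: (((fun y => h (L y)) \o shift x) (t *: v) - h (L x))) =
  (fun t : R => t^-1 *: ((h \o shift (L x)) (t *: L v) - h (L x))).
Proof. by apply/funext => t /=; rewrite linL. Qed.

Lemma is_derive_complin (X : normedModType R) (h : W -> X) x v d :
  is_derive (L x) (L v) h d -> is_derive x v (fun y => h (L y)) d.
Proof.
by move=> [h1 h2]; split; rewrite /derivable /derive line_quotient_comp.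
Qed.

Lemma derive_complin (X : normedModType R) (h : W -> X) x v :
  'D_v (fun y => h (L y)) x = 'D_(L v) h (L x).
Proof. by rewrite /derive line_quotient_comp. Qed.

Lemma Ck_on_complin (X : normedModType R) U k (h : W -> X) :
  Ck_on U k h -> Ck_on (L @^-1` U) k (fun y => h (L y)).
Proof.
elim: k h => [|k IH] h ch.
  split=> // x Ux; apply: (@continuous_comp _ _ _ L h); first exact: contL.
  exact: ch.1.
split=> [x Ux|v].
  apply: (@continuous_comp _ _ _ L h); [exact: contL|exact: ch.1].
split=> [x Ux|].
  rewrite /derivable line_quotient_comp; exact: Ck_on_derivable ch Ux.
have -> : 'D_v (fun y => h (L y)) = (fun y => 'D_(L v) h (L y)).
  by apply/funext => y; rewrite derive_complin.
exact: (IH _ (Ck_on_derive (L v) ch)).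
Qed.

End LinearChangeOfVariable.

Section Coordinates.
Context {R : realType} {V : normedModType R}.

Lemma Ck_on_coord U k m n (f : V -> 'M[R]_(m, n)) i j : open U ->
  Ck_on U k f -> Ck_on U k (fun x => f x i j : R^o).
Proof.
move=> oU; elim: k f => [|k IH] f cf.
  split=> // x Ux; apply: (@continuous_comp _ _ _ f (fun M => M i j)).
    exact: cf.1.
  exact: coord_continuous.
split=> [x Ux|v].
  apply: (@continuous_comp _ _ _ f (fun M => M i j)); first exact: cf.1.
  exact: coord_continuous.
split=> [x Ux|].
  by have /derivable_mxP := Ck_on_derivable (v := v) cf Ux.
apply: (eq_Ck_on oU _ (IH _ (Ck_on_derive v cf))) => x Ux.
by rewrite (derive_mx (Ck_on_derivable (v := v) cf Ux)) mxE.
Qed.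

End Coordinates.

(** * Wedge products evaluated on vectors *)

Section AlternatingSums.
Context {R : nzRingType} {V : Type}.

(** Sums over permutations do not compute. This recursion, which chooses the
    first entry and goes on with the remaining ones, does. *)
Fixpoint altsum n (Phi : seq V -> R) (f : nat -> V) : R :=
  if n is n'.+1 then
    foldr (fun j => +%R ((-1) ^+ j *
      altsum n' (fun w => Phi (f j :: w)) (fun k => f (bump j k)))) 0 (iota 0 n)
  else Phi [::].

(** A permutation of [n + 1] letters is the image [j] of the first letter
    together with a permutation of the other ones; the sign of [lift_perm] is
    that of [j] times that of the smaller permutation. *)
Lemma sum_perm_lift n (G : 'S_n.+1 -> R) :
  \sum_(s : 'S_n.+1) (-1) ^+ s * G s =
  \sum_(j < n.+1) (-1) ^+ j *
    \sum_(s : 'S_n) (-1) ^+ s * G (lift_perm ord0 j s).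
Proof.
pose h (p : 'I_n.+1 * 'S_n) := lift_perm ord0 p.1 p.2.
have h_inj : injective h.
  move=> [j s] [j' s'] /permP e.
  have ej : j = j' by have := e ord0; rewrite !lift_perm_id.
  subst j'; congr pair; apply/permP => k.
  by apply: (@lift_inj _ j); have := e (lift ord0 k); rewrite !lift_perm_lift.
have h_bij : bijective h.
  by apply: inj_card_bij => //; rewrite card_prod card_ord !card_Sn factS.
rewrite (reindex h); last exact: onW_bij.
under [RHS]eq_bigr do rewrite big_distrr.
rewrite pair_big /=; apply: eq_bigr => -[j s] _ /=.
by rewrite odd_lift_perm /= signr_addb mulrA signr_odd.
Qed.

Lemma sum_perm_altsum n (Phi : seq V -> R) (f : nat -> V) (v : 'I_n -> V) :
  (forall i, v i = f i) ->
  \sum_(s : 'S_n) (-1) ^+ s * Phi [seq v (s i) | i <- enum 'I_n] =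
  altsum n Phi f.
Proof.
elim: n Phi f v => [|n IH] Phi f v vf.
  rewrite (big_pred1 (1%g : 'S_0)) => [|s]; last first.
    by apply/esym/eqP/permP => -[].
  rewrite odd_perm1 mul1r /=; congr Phi; apply: size0nil.
  by rewrite size_map size_enum_ord.
rewrite (sum_perm_lift (fun s => Phi [seq v (s i) | i <- enum 'I_n.+1])).
transitivity (\sum_(j <- iota 0 n.+1) (-1) ^+ j *
    altsum n (fun w => Phi (f j :: w)) (fun k => f (bump j k))); last first.
  by rewrite unlock.
rewrite -[iota 0 n.+1](@val_enum_ord n.+1) big_map big_enum /=.
apply: eq_bigr => j _; congr (_ * _).
rewrite -(IH _ _ (fun k => v (lift j k))); last by move=> k; rewrite vf.
apply: eq_bigr => s _; congr (_ * Phi _).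
rewrite enum_ordSl /= lift_perm_id vf; congr (_ :: _).
by rewrite -map_comp; apply: eq_map => k /=; rewrite lift_perm_lift.
Qed.

End AlternatingSums.

Section WedgeFormulas.
Context {R : realType} {n : nat}.
Implicit Types (v : 'rV[R]_n).

Lemma wedge_altsum p q (a : mform R n p) (b : mform R n q)
    (v : 'I_(p + q) -> 'rV[R]_n) (f : nat -> 'rV[R]_n) :
  (forall i, v i = f i) ->
  wedge a b v = (p`! * q`!)%:R^-1 * altsum (p + q)
    (fun w => a (fun i : 'I_p => nth 0 w i) * b (fun j : 'I_q => nth 0 w (p + j)))
    f.
Proof.
move=> vf; rewrite /wedge -(sum_perm_altsum _ vf); congr (_ * _).
apply: eq_bigr => s _; congr (_ * (a _ * b _)); apply/funext => i.
  have E : nth (lshift q i) (enum 'I_(p + q)) i = lshift q i.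
    exact: (nth_ord_enum _ (lshift q i)).
  by rewrite (nth_map (lshift q i)) ?E// size_enum_ord (ltn_ord (lshift q i)).
have E : nth (rshift p i) (enum 'I_(p + q)) (p + i) = rshift p i.
  exact: (nth_ord_enum _ (rshift p i)).
by rewrite (nth_map (rshift p i)) ?E// size_enum_ord ltn_add2l.
Qed.

Lemma mform1E (a : mform R n 1) (f : 'I_1 -> 'rV[R]_n) : a f = ev1 a (f 0).
Proof. by congr a; apply/funext => i; rewrite ord1. Qed.

Lemma mform2E (a : mform R n 2) (f : 'I_2 -> 'rV[R]_n) :
  a f = ev2 a (f 0) (f 1).
Proof.
congr a; apply/funext => i; case: i => -[|[|//]] i /=;
  by rewrite (tnth_nth 0) /=; congr f; apply: val_inj.
Qed.

Lemma ord_nth m (T : Type) (x : T) (s : seq T) (v : 'I_m -> T) :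
  [seq v i | i <- enum 'I_m] = s -> forall i, v i = nth x s i.
Proof.
by move=> <- i; rewrite (nth_map i) ?size_enum_ord// nth_ord_enum.
Qed.

Lemma wedge11E (a b : mform R n 1) (v : 'I_2 -> 'rV[R]_n) :
  wedge a b v = ev1 a (v 0) * ev1 b (v 1) - ev1 a (v 1) * ev1 b (v 0).
Proof.
rewrite (@wedge_altsum 1 1 _ _ _ (nth 0 [:: v 0; v 1])); last first.
  by apply: ord_nth; rewrite !enum_ordSl enum_ord0 /=;
     congr [:: v _; v _]; apply: val_inj.
rewrite /= !mform1E /=.
have -> : (1`! * 1`! = 1)%N by [].
by field.
Qed.

Lemma wedge111E (a b c : mform R n 1) (v : 'I_3 -> 'rV[R]_n) :
  wedge (wedge a b) c v =
    ev1 a (v 0) * (ev1 b (v 1) * ev1 c (v 2) - ev1 b (v 2) * ev1 c (v 1))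
  - ev1 a (v 1) * (ev1 b (v 0) * ev1 c (v 2) - ev1 b (v 2) * ev1 c (v 0))
  + ev1 a (v 2) * (ev1 b (v 0) * ev1 c (v 1) - ev1 b (v 1) * ev1 c (v 0)).
Proof.
rewrite (@wedge_altsum 2 1 _ _ _ (nth 0 [:: v 0; v 1; v 2])); last first.
  by apply: ord_nth; rewrite !enum_ordSl enum_ord0 /=;
     congr [:: v _; v _; v _]; apply: val_inj.
rewrite /= !mform1E !wedge11E /=.
have -> : (2`! * 1`! = 2)%N by [].
by field.
Qed.

Lemma wedge21_eq0 (a : mform R n 2) (b : mform R n 1) (v : 'I_3 -> 'rV[R]_n) :
  (forall i j, ev2 a (v i) (v j) = 0) -> wedge a b v = 0.
Proof.
move=> a0; rewrite /wedge big1 ?mulr0// => s _.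
by rewrite mform2E a0 mul0r mulr0.
Qed.

(** Half of the value of the 4-form [F /\ F]. *)
Definition pfaffian (F : 'rV[R]_n -> 'rV[R]_n -> R) v0 v1 v2 v3 : R :=
  F v0 v1 * F v2 v3 - F v0 v2 * F v1 v3 + F v0 v3 * F v1 v2.

Lemma wedge_square (a : mform R n 2) (v : 'I_4 -> 'rV[R]_n) :
  (forall v w, ev2 a v w = - ev2 a w v) ->
  wedge a a v = 2 * pfaffian (ev2 a) (v 0) (v 1) (v 2) (v 3).
Proof.
move=> aN; rewrite (@wedge_altsum 2 2 _ _ _ (nth 0 [:: v 0; v 1; v 2; v 3])); last first.
  by apply: ord_nth; rewrite !enum_ordSl enum_ord0 /=;
     congr [:: v _; v _; v _; v _]; apply: val_inj.
rewrite /= !mform2E /= /pfaffian.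
rewrite (aN (v 1) (v 0)) (aN (v 2) (v 0)) (aN (v 3) (v 0)).
rewrite (aN (v 2) (v 1)) (aN (v 3) (v 1)) (aN (v 3) (v 2)).
have -> : (2`! * 2`! = 4)%N by [].
by field.
Qed.

End WedgeFormulas.

(** * The Cayley form *)

Section CayleyForm.
Context {R : realType}.
Implicit Types (v : 'I_4 -> 'rV[R]_8).

(** The signed monomials of the Cayley form. If the indices are read in binary
    as points of the affine space F_2^3, the monomials are its 14 planes: the
    sets of four indices whose sum (exclusive or) vanishes. *)
Definition cayley_terms : seq (bool * seq nat) :=
  [:: (false, [:: 0; 1; 2; 3]); (false, [:: 0; 1; 4; 5]);
      (false, [:: 0; 1; 6; 7]); (false, [:: 0; 2; 4; 6]);
      (true, [:: 0; 2; 5; 7]); (true, [:: 0; 3; 4; 7]);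
      (true, [:: 0; 3; 5; 6]); (true, [:: 1; 2; 4; 7]);
      (true, [:: 1; 2; 5; 6]); (true, [:: 1; 3; 4; 6]);
      (false, [:: 1; 3; 5; 7]); (false, [:: 2; 3; 4; 5]);
      (false, [:: 2; 3; 6; 7]); (false, [:: 4; 5; 6; 7])]%N.

Definition minor (s : seq nat) : mform R 8 4 :=
  fun v => \det (\matrix_(i < 4, j < 4) v i 0 (inord (nth 0%N s j))).

Lemma cayley_minors v :
  cayley v = \sum_(t <- cayley_terms) (-1) ^+ t.1 * minor t.2 v.
Proof.
rewrite !(big_cons, big_nil) /=.
have E a b c d : dx4 a b c d v = minor [:: a; b; c; d] v by [].
by rewrite /cayley !E; ring.
Qed.

Lemma minor_linear s : is_multilinear (minor s).
Proof.
move=> v i a x y; rewrite /minor.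
apply: etrans (determinant_multilinear (i0 := i) (b := a) (c := 1)
   (B := \matrix_(i0, j) dfwith v i x i0 0 (inord (nth 0%N s j)))
   (C := \matrix_(i0, j) dfwith v i y i0 0 (inord (nth 0%N s j))) _ _ _) _.
- by apply/rowP => j; rewrite !mxE !dfwithin !mxE mul1r.
- by apply/matrixP => k l; rewrite !mxE !dfwithout ?neq_lift.
- by apply/matrixP => k l; rewrite !mxE !dfwithout ?neq_lift.
by rewrite mul1r.
Qed.

Lemma minor_alternating s : is_alternating (minor s).
Proof.
move=> v i j ij e; apply: (determinant_alternate (i1 := i) (i2 := j)) => // l.
by rewrite !mxE e.
Qed.

Lemma cayley_linear : is_multilinear (@cayley R).
Proof.
move=> v i a x y; rewrite !cayley_minors.
rewrite scaler_sumr -big_split; apply: eq_bigr => t _ /=.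
rewrite minor_linear /GRing.scale /=.
by move: (minor _ _) (minor _ _) => p q; ring.
Qed.

Lemma cayley_alternating : is_alternating (@cayley R).
Proof.
move=> v i j ij e; rewrite cayley_minors big1// => t _.
by rewrite (minor_alternating _ ij e) mulr0.
Qed.

Lemma minor_altsum s v :
  minor s v = altsum 4 (fun w : seq nat =>
    \prod_(i < 4) v i 0 (inord (nth 0%N s (nth 0%N w i)))) id.
Proof.
rewrite -(@sum_perm_altsum _ _ 4 _ id (@nat_of_ord 4))//; apply: eq_bigr => p _.
congr (_ * _); apply: eq_bigr => i _; rewrite mxE; congr (v i 0 (inord (nth _ _ _))).
by rewrite (nth_map i) ?size_enum_ord// nth_ord_enum.
Qed.

Lemma is_derive_prod (V : normedModType R) n (h : 'I_n -> V -> R^o)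
    (dh : 'I_n -> R) x w : (forall i, is_derive x w (h i) (dh i)) ->
  is_derive x w (fun y => \prod_i h i y : R^o)
    (\sum_m \prod_i dfwith (fun i => h i x) m (dh m) i).
Proof.
elim: n h dh => [|n IH] h dh hd.
  by rewrite big_ord0; under eq_fun do rewrite big_ord0; exact: is_derive_cst.
under eq_fun do rewrite big_ord_recl.
apply: (is_derive_eq (is_deriveM (hd ord0) (IH _ _ (fun i => hd (lift ord0 i))))).
rewrite big_ord_recl big_ord_recl dfwithin addrC /GRing.scale /= mulrC.
congr (_ * _ + _).
  by apply: eq_bigr => i _; rewrite dfwithout// neq_lift.
rewrite big_distrr; apply: eq_bigr => m _ /=.
rewrite big_ord_recl dfwithout 1?eq_sym ?neq_lift//; congr (_ * _).
apply: eq_bigr => i _.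
have [->|mi] := eqVneq m i; first by rewrite !dfwithin.
by rewrite !dfwithout// (inj_eq lift_inj).
Qed.

Lemma is_derive_minor (V : normedModType R) s (r : 'I_4 -> V -> 'rV[R]_8)
    (dr : 'I_4 -> 'rV[R]_8) x w :
  (forall i k, is_derive x w (fun y => r i y 0 k : R^o) (dr i 0 k)) ->
  is_derive x w (fun y => minor s (fun i => r i y) : R^o)
    (\sum_m minor s (dfwith (fun i => r i x) m (dr m))).
Proof.
move=> hr.
have Df : (fun y => minor s (fun i => r i y) : R^o) =
   \sum_(p : 'S_4) (fun y => (-1) ^+ p *:
      (\prod_i r i y 0 (inord (nth 0%N s (p i))) : R^o)).
  apply/funext => y; rewrite fct_sumE; apply: eq_bigr => p _; congr (_ * _).
  by apply: eq_bigr => i _; rewrite mxE.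
have hp (p : 'S_4) : is_derive x w (fun y => (-1) ^+ p *:
      (\prod_i r i y 0 (inord (nth 0%N s (p i))) : R^o))
   ((-1) ^+ p * \sum_m \prod_i dfwith (fun i => r i x 0 (inord (nth 0%N s (p i)))) m
       (dr m 0 (inord (nth 0%N s (p m)))) i).
  by apply: is_deriveZ; apply: is_derive_prod => i; exact: hr.
rewrite Df.
have -> : \sum_m minor s (dfwith (fun i => r i x) m (dr m)) =
  \sum_(p : 'S_4) ((-1) ^+ p * \sum_m \prod_i
     dfwith (fun i => r i x 0 (inord (nth 0%N s (p i)))) m
       (dr m 0 (inord (nth 0%N s (p m)))) i).
  rewrite /minor /determinant exchange_big; apply: eq_bigr => p _ /=.
  rewrite big_distrr; apply: eq_bigr => m _ /=; congr (_ * _).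
  apply: eq_bigr => i _; rewrite mxE.
  have [->|mi] := eqVneq m i; first by rewrite !dfwithin.
  by rewrite !dfwithout.
elim/big_ind2: _ => //.
- exact: (is_derive_cst (0 : R^o)).
- by move=> f1 d1 f2 d2 h1 h2; exact: is_deriveD.
Qed.

Lemma is_derive_cayley (V : normedModType R) (r : 'I_4 -> V -> 'rV[R]_8)
    (dr : 'I_4 -> 'rV[R]_8) x w :
  (forall i k, is_derive x w (fun y => r i y 0 k : R^o) (dr i 0 k)) ->
  is_derive x w (fun y => cayley (fun i => r i y) : R^o)
    (\sum_m cayley (dfwith (fun i => r i x) m (dr m))).
Proof.
move=> hr.
have -> : (fun y => cayley (fun i => r i y) : R^o) =
  \sum_(t <- cayley_terms) (fun y => (-1) ^+ t.1 *: (minor t.2 (fun i => r i y) : R^o)).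
  by apply/funext => y; rewrite fct_sumE cayley_minors.
have -> : \sum_m cayley (dfwith (fun i => r i x) m (dr m)) =
  \sum_(t <- cayley_terms) (-1) ^+ t.1 *
     \sum_m minor t.2 (dfwith (fun i => r i x) m (dr m)).
  under eq_bigr do rewrite cayley_minors.
  by rewrite exchange_big; apply: eq_bigr => t _; rewrite big_distrr.
elim/big_ind2: _ => //.
- exact: (is_derive_cst (0 : R^o)).
- by move=> f1 d1 f2 d2 h1 h2; exact: is_deriveD.
- by move=> t _; apply: is_deriveZ; exact: is_derive_minor.
Qed.

End CayleyForm.

(** * The action of so(8) on the Cayley form *)

(** The determinant of the matrix of Kronecker symbols [g i == q_j]. *)
Fixpoint kron_det (q : seq nat) (g : nat -> nat) : int :=
  if q is x :: q' then
    foldr (fun j acc =>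
      if g j == x then (-1) ^+ j * kron_det q' (fun k => g (bump j k)) + acc
      else acc) 0 (iota 0 (size q))
  else 1.

Definition cayley_coef (q : seq nat) : int :=
  foldr (fun (t : bool * seq nat) =>
     +%R ((-1) ^+ t.1 * kron_det q (nth 0%N t.2))) 0 cayley_terms.

(** For a skew matrix [B] the entries below the diagonal are expressed through
    those above it. *)
Definition normal_term (c : int) (i k : nat) : int * (nat * nat) :=
  if (i < k)%N then (c, (i, k)) else (- c, (k, i)).

(** The value of [act cayley B] on the basis vectors with indices [q], as a
    linear form in the entries of [B]. *)
Definition act_terms (q : seq nat) : seq (int * (nat * nat)) :=
  [seq x <- [seq normal_term (cayley_coef (set_nth 0%N q m k)) (nth 0%N q m) k |
     m <- iota 0 4, k <- iota 0 8] | (x.1 != 0) && (x.2.1 != x.2.2)].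

Definition xor4 (q : seq nat) : nat :=
  foldr (fun a b => PeanoNat.Nat.lxor a b) 0%N q.

(** The linear form [act_terms q] vanishes if [q] is a plane; otherwise it
    depends, up to sign, only on the sum [al] of the four indices, because
    replacing an index [i] of [q] by [i + al] is the only way to obtain a plane.
    These seven forms are the coordinates of so(8) modulo spin(7); [rep_tuple al]
    is a tuple for which the form contains [B 0 al] with coefficient 1. *)
Definition rep_tuple (al : nat) : seq nat :=
  nth [::] [:: [:: 0; 0; 0; 0]; [:: 0; 2; 6; 5]; [:: 0; 1; 4; 7]; [:: 0; 1; 4; 6];
     [:: 0; 1; 6; 3]; [:: 0; 1; 3; 7]; [:: 0; 1; 2; 5]; [:: 0; 1; 2; 4]]%N al.

(** A tuple [q] with sum [al <> 0] that is not a plane contains exactly one of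
    the indices [0] and [al], so that the coefficient of [B 0 al] can be read
    off from a single value of the Cayley form. *)
Definition rep_sign (q : seq nat) : int :=
  let al := xor4 q in
  if al == 0%N then 0 else
  if 0%N \in q then cayley_coef (set_nth 0%N q (index 0%N q) al)
  else - cayley_coef (set_nth 0%N q (index al q) 0%N).

Definition increasing (n k : nat) : seq (seq nat) :=
  iter k (fun l => flatten [seq [seq a :: s | a <- iota 0 (head n s)] | s <- l])
    [:: [::]].

Definition rep_tuple_check : bool :=
  let T := [seq act_terms (rep_tuple al) | al <- iota 0 8] in
  all (fun q => if xor4 q == 0%N then act_terms q == [::] else
    perm_eq (act_terms q)
      [seq (rep_sign q * x.1, x.2) | x <- nth [::] T (xor4 q)])
    (increasing 8 4).

Lemma rep_tuple_checkT : rep_tuple_check.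
Proof. by vm_compute. Qed.

Section Basis.
Context {R : realType}.

Definition basis_vector (i : nat) : 'rV[R]_8 := delta_mx 0 (inord i).

Definition basis_tuple (q : seq nat) : 'I_4 -> 'rV[R]_8 :=
  fun i => basis_vector (nth 0%N q i).

Lemma eq_altsum n (T : Type) (Phi Phi' : seq T -> R) f : Phi =1 Phi' ->
  altsum n Phi f = altsum n Phi' f.
Proof.
by move=> /funext ->.
Qed.

Lemma altsumZ n (T : Type) (Phi : seq T -> R) f c :
  altsum n (fun w => c * Phi w) f = c * altsum n Phi f.
Proof.
elim: n Phi f => [|n IH] Phi f //=.
rewrite mulrDr IH mulrCA; congr (_ + _).
elim: (iota 1 n) => [|j l IHl] /=; first by rewrite mulr0.
by rewrite mulrDr IHl IH mulrCA.
Qed.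

Lemma altsum_kron (q : seq nat) (g f : nat -> nat) :
  altsum (size q) (fun w => \prod_(i < size q)
     (g (nth 0%N w i) == nth 0%N q i)%:R : R) f =
  (kron_det q (g \o f))%:~R.
Proof.
elim: q f => [|x q IH] f; first by rewrite /= big_ord0.
transitivity (\sum_(j <- iota 0 (size q).+1) (-1) ^+ j *
   ((g (f j) == x)%:R * (kron_det q (g \o (fun k => f (bump j k))))%:~R) : R).
  rewrite -[size (x :: q)]/(size q).+1.
  transitivity (\sum_(j <- iota 0 (size q).+1) (-1) ^+ j *
     altsum (size q) (fun w => \prod_(i < (size q).+1)
       (g (nth 0%N (f j :: w) i) == nth 0%N (x :: q) i)%:R : R)
       (fun k => f (bump j k))); first by rewrite unlock.
  apply: eq_bigr => j _; congr (_ * _); rewrite -IH -altsumZ.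
  by apply: eq_altsum => w; rewrite big_ord_recl.
have -> : kron_det (x :: q) (g \o f) = foldr (fun j acc =>
    if g (f j) == x then (-1) ^+ j * kron_det q (g \o (fun k => f (bump j k))) + acc
    else acc) 0 (iota 0 (size q).+1) by [].
elim: (iota _ _) => [|j l IHl]; first by rewrite big_nil.
rewrite big_cons IHl /=; case: eqP => _ /=.
  by rewrite mul1r rmorphD rmorphM rmorphXn rmorphN1.
by rewrite mul0r mulr0 add0r.
Qed.

Lemma minor_basis s q : size q = 4%N -> all (fun a => a < 8)%N s ->
  all (fun a => a < 8)%N q ->
  minor s (basis_tuple q) = (kron_det q (nth 0%N s))%:~R.
Proof.
move=> sq s8 q8; rewrite minor_altsum -[nth 0%N s in RHS]/(nth 0%N s \o id).
rewrite -altsum_kron sq; apply: eq_altsum => w; apply: eq_bigr => i _.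
rewrite mxE eqxx /=; congr (_%:R).
have lt8 (t : seq nat) j : all (fun a => a < 8)%N t -> (nth 0%N t j < 8)%N.
  by move=> t8; have [jt|jt] := ltnP j (size t); [exact: (all_nthP 0%N t8)|rewrite nth_default].
by rewrite -(inj_eq val_inj) /= !inordK// lt8.
Qed.

Lemma cayley_basis q : size q = 4%N -> all (fun a => a < 8)%N q ->
  cayley (basis_tuple q) = (cayley_coef q)%:~R.
Proof.
move=> sq q8; rewrite cayley_minors /cayley_coef.
have : all (fun t : bool * seq nat => all (fun a => a < 8)%N t.2) cayley_terms by [].
elim: cayley_terms => [|t l IH] /=; first by rewrite big_nil.
case/andP=> t8 l8; rewrite big_cons IH// minor_basis//.
by rewrite rmorphD rmorphM rmorphXn rmorphN1.
Qed.

(** The infinitesimal action of [gl_8] on forms, up to sign. *)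
Definition act (C : mform R 8 4) (B : 'M[R]_8) : mform R 8 4 :=
  fun u => \sum_m C (dfwith u m (u m *m B)).

Lemma multilinear_sum n k (C : mform R n k) v i (J : Type) (r : seq J)
    (F : J -> 'rV[R]_n) (a : J -> R) : is_multilinear C ->
  C (dfwith v i (\sum_(j <- r) a j *: F j)) = \sum_(j <- r) a j * C (dfwith v i (F j)).
Proof.
move=> linC; elim: r => [|j r IH].
  rewrite !big_nil; have := linC v i (-1) 0 0.
  by rewrite scaler0 addr0 scaleN1r addNr.
by rewrite !big_cons linC IH.
Qed.

Lemma row_basis (B : 'M[R]_8) i :
  basis_vector i *m B = \sum_(k <- iota 0 8) B (inord i) (inord k) *: basis_vector k.
Proof.
rewrite -rowE; apply/rowP => j; rewrite mxE.
rewrite -[iota 0 8](@val_enum_ord 8) big_map big_enum summxE (bigD1 j)//= big1.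
  by rewrite !mxE inord_val !eqxx mulr1 addr0.
by move=> k kj; rewrite !mxE inord_val eq_sym (negbTE kj) andbF mulr0.
Qed.

Lemma act_basis (B : 'M[R]_8) q : size q = 4%N -> all (fun a => a < 8)%N q ->
  (forall i j, B i j = - B j i) ->
  act cayley B (basis_tuple q) =
  \sum_(x <- act_terms q) x.1%:~R * B (inord x.2.1) (inord x.2.2).
Proof.
move=> sq q8 skB.
have B0 i : B i i = 0 by apply/eqP; have := skB i i; lra.
rewrite /act_terms big_filter.
transitivity (\sum_(x <- [seq normal_term (cayley_coef (set_nth 0%N q m k)) (nth 0%N q m) k |
     m <- iota 0 4, k <- iota 0 8]) x.1%:~R * B (inord x.2.1) (inord x.2.2)); last first.
  rewrite [LHS](bigID (fun x : int * (nat * nat) => (x.1 != 0) && (x.2.1 != x.2.2))) /=.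
  rewrite [X in _ + X]big1 ?addr0// => x.
  by rewrite negb_and !negbK => /orP[/eqP->|/eqP->]; rewrite ?mul0r// B0 mulr0.
rewrite big_allpairs_dep -[iota 0 4](@val_enum_ord 4) big_map big_enum /=.
apply: eq_bigr => m _.
rewrite {2}/basis_tuple row_basis multilinear_sum; last exact: cayley_linear.
rewrite !big_seq; apply: eq_bigr => k; rewrite mem_iota => /= k8.
have -> : dfwith (basis_tuple q) m (basis_vector k) = basis_tuple (set_nth 0%N q m k).
  apply/funext => i; rewrite /basis_tuple nth_set_nth /=.
  have [->|mi] := eqVneq m i; first by rewrite dfwithin eqxx.
  by rewrite dfwithout// (inj_eq val_inj) eq_sym (negbTE mi).
rewrite cayley_basis; first last.
- apply/(all_nthP 0%N) => i _; rewrite nth_set_nth /=; case: eqP => // _.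
  by have [jt|jt] := ltnP i (size q); [exact: (all_nthP 0%N q8)|rewrite nth_default].
- by rewrite size_set_nth sq; apply/maxn_idPr.
rewrite /normal_term; case: ifP => _ /=; first by rewrite mulrC.
by rewrite rmorphN mulNr -mulrN -skB mulrC.
Qed.

Definition rep_value (B : 'M[R]_8) (al : nat) : R :=
  \sum_(x <- act_terms (rep_tuple al)) x.1%:~R * B (inord x.2.1) (inord x.2.2).

Lemma act_basis_rep (B : 'M[R]_8) q : q \in increasing 8 4 ->
  (forall i j, B i j = - B j i) ->
  act cayley B (basis_tuple q) = (rep_sign q)%:~R * rep_value B (xor4 q).
Proof.
move=> qI skB.
have /allP/(_ _ qI)/and3P[/eqP sq q8 x8] : all (fun q => [&& size q == 4,
    all (fun a => a < 8)%N q & xor4 q < 8]%N) (increasing 8 4).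
  by vm_compute.
rewrite act_basis//; move/allP: rep_tuple_checkT => /(_ _ qI); rewrite /rep_sign.
case: eqP => [_ /eqP ->|_]; first by rewrite big_nil mul0r.
rewrite (nth_map 0%N) ?size_iota// nth_iota//.
move=> pq; rewrite (perm_big _ pq) big_map /= /rep_value big_distrr.
by apply: eq_bigr => x _; rewrite /= intrM -mulrA.
Qed.

End Basis.

(** * The algebra of Fernandez' theorem *)

Lemma dfwithE (I : eqType) (T : Type) (f : I -> T) i x j :
  dfwith f i x j = if i == j then x else f j.
Proof. by case: eqP => [<-|/eqP ij]; rewrite ?dfwithin ?dfwithout. Qed.

Lemma dfwithC (I : eqType) (T : Type) (f : I -> T) i j x y : i != j ->
  dfwith (dfwith f i x) j y = dfwith (dfwith f j y) i x.
Proof.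
move=> ij; apply/funext => l; rewrite !dfwithE.
by case: (eqVneq i l) => // il; rewrite eq_sym -il (negbTE ij).
Qed.

Lemma dfwith2 (I : eqType) (T : Type) (f : I -> T) i x y :
  dfwith (dfwith f i x) i y = dfwith f i y.
Proof. by apply/funext => l; rewrite !dfwithE; case: eqP. Qed.

Lemma dfwith_id (I : eqType) (T : Type) (f : I -> T) i : dfwith f i (f i) = f.
Proof. by apply/funext => l; rewrite dfwithE; case: eqP => // ->. Qed.

Section AlternatingForms.
Context {R : realType} {n k : nat} (C : mform R n k).
Hypotheses (linC : is_multilinear C) (altC : is_alternating C).
Implicit Types (v : 'I_k -> 'rV[R]_n).

Lemma multilinearD v i x y :
  C (dfwith v i (x + y)) = C (dfwith v i x) + C (dfwith v i y).
Proof. by have := linC v i 1 x y; rewrite !scale1r. Qed.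

Lemma multilinearN v i x : C (dfwith v i (- x)) = - C (dfwith v i x).
Proof.
have := linC v i (-1) x 0; rewrite addr0 scaleN1r => ->.
have := linC v i (-1) 0 0; rewrite scaler0 addr0 scaleN1r addNr => ->.
by rewrite addr0 scaleN1r.
Qed.

(** Polarization of [C (.., x, .., x, ..) = 0]. *)
Lemma alternating_swap v i j x y : i != j ->
  C (dfwith (dfwith v i x) j y) = - C (dfwith (dfwith v i y) j x).
Proof.
move=> ij; have z w : C (dfwith (dfwith v i w) j w) = 0.
  by apply: (altC ij); rewrite !dfwithE !eqxx eq_sym (negbTE ij).
have := z (x + y); rewrite multilinearD.
have D w : C (dfwith (dfwith v i (x + y)) j w) =
   C (dfwith (dfwith v i x) j w) + C (dfwith (dfwith v i y) j w).
  by rewrite !(dfwithC _ _ _ ij) multilinearD.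
by rewrite !D !z; lra.
Qed.

Lemma alternating_perm0 v (s : 'S_k) : C v = 0 -> C (v \o s) = 0.
Proof.
have [ts -> _] := prod_tpermP s.
elim: ts v => [|t ts IH] v Cv.
  by rewrite big_nil (_ : v \o _ = v)//; apply/funext => i /=; rewrite perm1.
rewrite big_cons.
have -> : v \o (tperm t.1 t.2 * \prod_(t <- ts) tperm t.1 t.2)%g =
  (v \o (\prod_(t <- ts) tperm t.1 t.2)%g) \o tperm t.1 t.2.
  by apply/funext => i /=; rewrite permM.
move: (v \o _) (IH v Cv) => w Cw; case: t => i j /=.
have [<-|ij] := eqVneq i j.
  by rewrite tperm1 (_ : w \o _ = w)//; apply/funext => l /=; rewrite perm1.
have -> : w \o tperm i j = dfwith (dfwith w i (w j)) j (w i).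
  apply/funext => l /=; rewrite !dfwithE; case: tpermP => [->|->|/eqP li /eqP lj].
  - by rewrite eqxx eq_sym (negbTE ij).
  - by rewrite eqxx.
  - by rewrite eq_sym (negbTE lj) eq_sym (negbTE li).
rewrite alternating_swap// (_ : dfwith _ _ _ = w) ?Cw ?oppr0//.
by rewrite !dfwith_id.
Qed.

End AlternatingForms.

Section Action.
Context {R : realType} (C : mform R 8 4) (B : 'M[R]_8).
Hypotheses (linC : is_multilinear C) (altC : is_alternating C).

Lemma act_multilinear : is_multilinear (act C B).
Proof.
move=> v i a x y; rewrite /act scaler_sumr -big_split; apply: eq_bigr => m _ /=.
have [->|mi] := eqVneq m i.
  by rewrite !dfwith2 !dfwithin mulmxDl -scalemxAl linC.
rewrite !dfwithE eq_sym (negbTE mi) ![dfwith (dfwith v i _) m _]dfwithC 1?eq_sym//.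
by rewrite linC.
Qed.

Lemma act_alternating : is_alternating (act C B).
Proof.
move=> v i j ij e; rewrite /act (bigD1 i)//= (bigD1 j) 1?eq_sym//= big1.
  rewrite addr0 e.
  have -> : dfwith v i (v j *m B) = dfwith (dfwith v i (v j *m B)) j (v j).
    by apply/funext => l; rewrite !dfwithE; case: (eqVneq j l) => [<-|//]; rewrite (negbTE ij).
  rewrite alternating_swap// -e dfwith_id.
  by rewrite e addrC addrN.
move=> m /andP[mi mj]; apply: (altC ij).
by rewrite !dfwithE (negbTE mi) (negbTE mj).
Qed.

End Action.

Lemma increasing_sorted n k (q : seq nat) : sorted ltn q -> size q = k ->
  all (fun a => a < n)%N q -> q \in increasing n k.
Proof.
elim: k q => [|k IH] [|a q]//= pq [sq] /andP[an qn].
rewrite [increasing _ _]/= -/(increasing n k).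
apply/flattenP; exists [seq a :: q | a <- iota 0 (head n q)].
  by apply/mapP; exists q => //; apply: IH => //; exact: path_sorted pq.
apply/mapP; exists a => //; rewrite mem_iota /= add0n.
by case: q pq sq qn {IH} => [|b q] //= /andP[].
Qed.

(** Expanding one argument after the other in the basis leaves tuples of basis
    vectors; such a tuple repeats an entry or is a permutation of an increasing
    one. *)
Lemma alternating_eq0 (R : realType) (C : mform R 8 4) :
  is_multilinear C -> is_alternating C ->
  (forall q, q \in increasing 8 4 -> C (basis_tuple q) = 0) ->
  forall v, C v = 0.
Proof.
move=> linC altC C0.
have Cq (q : seq nat) : size q = 4%N -> all (fun a => a < 8)%N q ->
    C (basis_tuple q) = 0.
  move=> sq q8.
  have [uq|] := boolP (uniq q); last first.
    move=> /(uniqPn 0%N) [i [j [ij js e]]].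
    have i4 : (i < 4)%N by rewrite -sq (ltn_trans ij).
    rewrite sq in js.
    apply: (altC _ (Ordinal i4) (Ordinal js)).
      by rewrite -(inj_eq val_inj) /= ltn_eqF.
    by rewrite /basis_tuple /= e.
  pose s := sort leq q.
  have ss : size s = 4%N by rewrite size_sort.
  have ls : sorted ltn s by rewrite ltn_sorted_uniq_leq sort_uniq uq sort_sorted.
  have s8 : all (fun a => a < 8)%N s by rewrite all_sort.
  have st : size s == 4%N by rewrite ss.
  have /tuple_permP[p qE] : perm_eq q (Tuple st) by rewrite perm_sym perm_sort.
  have -> : basis_tuple q = basis_tuple s \o p :> (_ -> 'rV[R]_8).
    apply/funext => i; rewrite /basis_tuple /= qE; congr (basis_vector _).
    by rewrite -tnth_nth tnth_mktuple (tnth_nth 0%N).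
  by apply: alternating_perm0 => //; apply: C0; apply: increasing_sorted.
move=> v.
pose IN := fun (m : nat) (w : 'I_4 -> 'rV[R]_8) =>
  forall i : 'I_4, (m <= i)%N -> exists2 k : nat, (k < 8)%N & w i = basis_vector k.
have step m (mlt : (m < 4)%N) : (forall w, IN m w -> C w = 0) -> forall w, IN m.+1 w -> C w = 0.
  move=> H w wI; pose i := Ordinal mlt.
  rewrite -(dfwith_id w i).
  have -> : w i = \sum_(k < 8) w i 0 k *: basis_vector k.
    rewrite [LHS]row_sum_delta; apply: eq_bigr => k _; congr (_ *: delta_mx _ _).
    by apply/val_inj; rewrite /= inordK.
  rewrite multilinear_sum// big1// => k _; rewrite H ?mulr0// => l ml.
  rewrite dfwithE; case: eqP => [_|/eqP il]; first by exists k.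
  apply: wI; rewrite ltn_neqAle ml andbT; apply: contra il => /eqP e.
  by apply/eqP/val_inj.
have H0 w : IN 0%N w -> C w = 0.
  move=> wI; have /choice[q qP] : forall i : 'I_4, exists k : nat,
      (k < 8)%N /\ w i = basis_vector k.
    by move=> i; have [k k8 wk] := wI i (leq0n _); exists k.
  have -> : w = basis_tuple [seq q i | i <- enum 'I_4].
    apply/funext => i; rewrite /basis_tuple (nth_map i) ?size_enum_ord//.
    by rewrite nth_ord_enum; case: (qP i).
  apply: Cq; first by rewrite size_map size_enum_ord.
  by apply/allP => _ /mapP[i _ ->]; case: (qP i).
have := step 3 isT (step 2 isT (step 1 isT (step 0 isT H0))).
by apply; move=> i; rewrite leqNgt ltn_ord.
Qed.

Section Fernandez.
Context {R : realType} (a : nat -> 'M[R]_8).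
Hypothesis a_skew : forall p i j, a p i j = - a p j i.
Hypothesis a_alt : forall ps, ps \in increasing 8 5 ->
  \sum_(i <- iota 0 5) (-1) ^+ i *
    act cayley (a (nth 0%N ps i))
      (basis_tuple [seq nth 0%N ps (bump i j) | j <- iota 0 4]) = 0.

(** The alternation of [p |-> act cayley (a p)] over five basis vectors, in terms
    of the seven linear forms; an entry records whether the term is present,
    its sign, the index [p] and the sum [al] of the four other indices. *)
Definition alt_terms (ps : seq nat) : seq (bool * bool * (nat * nat)) :=
  [seq (let q := [seq nth 0%N ps (bump i j) | j <- iota 0 4] in
        let s := (-1) ^+ i * rep_sign q in
        (s != 0, s == -1, (nth 0%N ps i, xor4 q))) | i <- iota 0 5].

Definition signed_sum (Y : nat -> nat -> R) (l : seq (bool * bool * (nat * nat))) :=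
  foldr (fun x acc => if x.1.1 then
     (if x.1.2 then acc - Y x.2.1 x.2.2 else acc + Y x.2.1 x.2.2) else acc) 0 l.

Lemma alt_equation ps : ps \in increasing 8 5 ->
  signed_sum (fun p al => rep_value (a p) al) (alt_terms ps) = 0.
Proof.
move=> pI; rewrite -[RHS](a_alt pI).
have /allP/(_ _ pI)/allP pP : all (fun ps => all (fun i =>
   let q := [seq nth 0%N ps (bump i j) | j <- iota 0 4] in
   (q \in increasing 8 4) && (rep_sign q \in [:: 0; 1; -1])) (iota 0 5)) (increasing 8 5).
  by vm_compute.
rewrite /alt_terms; elim: (iota 0 5) pP => [|i l IH] pP.
  by rewrite big_nil.
rewrite big_cons -IH; last by move=> k kl; apply: pP; rewrite inE kl orbT.
have /andP[qI sI] := pP i (mem_head _ _).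
rewrite [LHS]/= act_basis_rep//.
have sE (z : int) : (-1) ^+ i * z%:~R = ((-1) ^+ i * z)%:~R :> R.
  by rewrite intrM rmorphXn rmorphN1.
rewrite mulrA sE.
have : (-1) ^+ i * rep_sign [seq nth 0%N ps (bump i j) | j <- iota 0 4] \in [:: 0; 1; -1].
  move: sI; rewrite -signr_odd; case: (odd i); rewrite ?expr1 ?expr0 ?mulN1r ?mul1r//.
  by rewrite !inE => /or3P[]/eqP->; rewrite ?oppr0 ?opprK eqxx ?orbT.
rewrite !inE => /or3P[]/eqP-> /=.
- by rewrite mul0r add0r.
- by rewrite mul1r addrC.
- by rewrite mulN1r addrC.
Qed.

Local Ltac alt_at E s :=
  let h := fresh "h" in
  have h := E s isT; move: h;
  match goal with |- signed_sum _ ?l = _ -> _ =>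
    let l' := eval vm_compute in l in change l with l' end;
  rewrite /signed_sum /= => h.

Local Ltac by_index p := move: p => [|[|[|[|[|[|[|[|p]]]]]]]] // _ _.

(** Of the five sums of four indices of [ps] one vanishes: the four indices other
    than some [s] form a plane. The equation of [ps] then involves only the
    unknowns [Y p (p + s)] with [p] in this plane, where [+] is exclusive or.
    For each [s] there are seven planes that miss it, hence seven equations for
    seven unknowns, and this system is nonsingular. *)
Lemma alt_system (Y : nat -> nat -> R) :
  (forall ps, ps \in increasing 8 5 -> signed_sum Y (alt_terms ps) = 0) ->
  forall s p, (s < 8)%N -> (p < 8)%N -> p != s -> Y p (PeanoNat.Nat.lxor p s) = 0.
Proof.
move=> E s p s8; move: s8 p; case: s => [|[|[|[|[|[|[|[|s]]]]]]]] // _ p.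
- alt_at E [:: 0; 1; 2; 4; 7]%N; alt_at E [:: 0; 1; 2; 5; 6]%N; alt_at E [:: 0; 1; 3; 4; 6]%N; alt_at E [:: 0; 1; 3; 5; 7]%N; alt_at E [:: 0; 2; 3; 4; 5]%N; alt_at E [:: 0; 2; 3; 6; 7]%N; alt_at E [:: 0; 4; 5; 6; 7]%N;
  by clear E; by_index p; lra.
- alt_at E [:: 0; 1; 2; 4; 6]%N; alt_at E [:: 0; 1; 2; 5; 7]%N; alt_at E [:: 0; 1; 3; 4; 7]%N; alt_at E [:: 0; 1; 3; 5; 6]%N; alt_at E [:: 1; 2; 3; 4; 5]%N; alt_at E [:: 1; 2; 3; 6; 7]%N; alt_at E [:: 1; 4; 5; 6; 7]%N;
  by clear E; by_index p; lra.
- alt_at E [:: 0; 1; 2; 4; 5]%N; alt_at E [:: 0; 1; 2; 6; 7]%N; alt_at E [:: 0; 2; 3; 4; 7]%N; alt_at E [:: 0; 2; 3; 5; 6]%N; alt_at E [:: 1; 2; 3; 4; 6]%N; alt_at E [:: 1; 2; 3; 5; 7]%N; alt_at E [:: 2; 4; 5; 6; 7]%N;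
  by clear E; by_index p; lra.
- alt_at E [:: 0; 1; 3; 4; 5]%N; alt_at E [:: 0; 1; 3; 6; 7]%N; alt_at E [:: 0; 2; 3; 4; 6]%N; alt_at E [:: 0; 2; 3; 5; 7]%N; alt_at E [:: 1; 2; 3; 4; 7]%N; alt_at E [:: 1; 2; 3; 5; 6]%N; alt_at E [:: 3; 4; 5; 6; 7]%N;
  by clear E; by_index p; lra.
- alt_at E [:: 0; 1; 2; 3; 4]%N; alt_at E [:: 0; 1; 4; 6; 7]%N; alt_at E [:: 0; 2; 4; 5; 7]%N; alt_at E [:: 0; 3; 4; 5; 6]%N; alt_at E [:: 1; 2; 4; 5; 6]%N; alt_at E [:: 1; 3; 4; 5; 7]%N; alt_at E [:: 2; 3; 4; 6; 7]%N;
  by clear E; by_index p; lra.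
- alt_at E [:: 0; 1; 2; 3; 5]%N; alt_at E [:: 0; 1; 5; 6; 7]%N; alt_at E [:: 0; 2; 4; 5; 6]%N; alt_at E [:: 0; 3; 4; 5; 7]%N; alt_at E [:: 1; 2; 4; 5; 7]%N; alt_at E [:: 1; 3; 4; 5; 6]%N; alt_at E [:: 2; 3; 5; 6; 7]%N;
  by clear E; by_index p; lra.
- alt_at E [:: 0; 1; 2; 3; 6]%N; alt_at E [:: 0; 1; 4; 5; 6]%N; alt_at E [:: 0; 2; 5; 6; 7]%N; alt_at E [:: 0; 3; 4; 6; 7]%N; alt_at E [:: 1; 2; 4; 6; 7]%N; alt_at E [:: 1; 3; 5; 6; 7]%N; alt_at E [:: 2; 3; 4; 5; 6]%N;
  by clear E; by_index p; lra.
- alt_at E [:: 0; 1; 2; 3; 7]%N; alt_at E [:: 0; 1; 4; 5; 7]%N; alt_at E [:: 0; 2; 4; 6; 7]%N; alt_at E [:: 0; 3; 5; 6; 7]%N; alt_at E [:: 1; 2; 5; 6; 7]%N; alt_at E [:: 1; 3; 4; 6; 7]%N; alt_at E [:: 2; 3; 4; 5; 7]%N;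
  by clear E; by_index p; lra.
Qed.

Lemma rep_value_eq0 p al : (p < 8)%N -> (0 < al < 8)%N -> rep_value (a p) al = 0.
Proof.
move=> p8 /andP[al0 al8].
have -> : al = PeanoNat.Nat.lxor p (PeanoNat.Nat.lxor p al).
  by rewrite -PeanoNat.Nat.lxor_assoc PeanoNat.Nat.lxor_nilpotent PeanoNat.Nat.lxor_0_l.
have x8 : all (fun p => all (fun al =>
    (PeanoNat.Nat.lxor p al < 8) && (p != PeanoNat.Nat.lxor p al))%N (iota 1 7)) (iota 0 8).
  by vm_compute.
have pI : p \in iota 0 8 by rewrite mem_iota.
have alI : al \in iota 1 7 by rewrite mem_iota al0.
have /andP[s8 ps] := allP (allP x8 _ pI) _ alI.
by apply: (alt_system alt_equation).
Qed.

(** A map [a] from R^8 to so(8) whose action on the Cayley form has zero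
    alternation takes values in spin(7): the alternation determines the class of
    [a] modulo spin(7), since both live in spaces of dimension 56. *)
Lemma fernandez p : (p < 8)%N -> forall v, act cayley (a p) v = 0.
Proof.
move=> p8; apply: alternating_eq0.
- by apply: act_multilinear; exact: cayley_linear.
- by apply: act_alternating; [exact: cayley_linear|exact: cayley_alternating].
move=> q qI; rewrite act_basis_rep//.
have /allP/(_ _ qI) x8 : all (fun q => xor4 q < 8)%N (increasing 8 4).
  by vm_compute.
have [e|x0] := eqVneq (xor4 q) 0%N.
  by rewrite {1}/rep_sign e mul0r.
by rewrite rep_value_eq0 ?mulr0// x8 andbT lt0n.
Qed.

End Fernandez.

(** * The Levi-Civita connection in a moving frame *)

Section LeviCivita.
Context {R : realType} (N : manifold R 8) (g : tensor N 2) (c : chart N).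
Context (U : set 'rV[R]_8) (P : 'rV[R]_8 -> 'M[R]_8) (x : 'rV[R]_8).
Hypotheses (oU : open U) (Ux : U x)
  (smoothP : forall i j, Ck_on U 1 (fun y => P y i j : R^o))
  (gP : forall y, U y -> forall v w,
     ev2 (g c y) v w = \sum_i (v *m P y) 0 i * (w *m P y) 0 i)
  (unitP : P x \in unitmx).

Definition frame_derivative (w : 'rV[R]_8) : 'M[R]_8 :=
  \matrix_(i, j) 'D_w (fun y => P y i j : R^o) x.

Definition connection_matrix (w : 'rV[R]_8) : 'M[R]_8 :=
  \matrix_(j, l) \sum_i w 0 i * christoffel g c x i j l.

Lemma frame_derivative_linear a v w :
  frame_derivative (a *: v + w) = a *: frame_derivative v + frame_derivative w.
Proof.
by apply/matrixP => i j; rewrite !mxE (derive_dir_linear _ _ _ oU Ux (smoothP i j)).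
Qed.

Lemma frame_derivative_basis w :
  frame_derivative w = \sum_i w 0 i *: frame_derivative (delta_mx 0 i).
Proof.
have D0 : frame_derivative 0 = 0.
  have := frame_derivative_linear (-1) 0 0.
  by rewrite scaler0 addr0 scaleN1r addNr.
rewrite {1}[w]row_sum_delta.
elim/big_rec2: _ => // i u v _ <-; by rewrite frame_derivative_linear.
Qed.

Lemma connection_linear a v w :
  connection_matrix (a *: v + w) = a *: connection_matrix v + connection_matrix w.
Proof.
apply/matrixP => i j; rewrite !mxE mulr_sumr -big_split; apply: eq_bigr => k _.
by rewrite !mxE /=; ring.
Qed.

Let gram (y : 'rV[R]_8) : 'M[R]_8 := P y *m (P y)^T.

Lemma metric_coefE y i j : U y ->
  ev2 (g c y) (delta_mx 0 i) (delta_mx 0 j) = gram y i j.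
Proof.
by move=> Uy; rewrite gP// mxE; apply: eq_bigr => k _; rewrite -!rowE !mxE.
Qed.

Lemma is_derive_metric w i j :
  is_derive x w (fun y => ev2 (g c y) (delta_mx 0 i) (delta_mx 0 j) : R^o)
    ((frame_derivative w *m (P x)^T + P x *m (frame_derivative w)^T) i j).
Proof.
apply: (@near_eq_is_derive _ _ _ (fun y => \sum_k P y i k * P y j k : R^o)).
  near=> y; rewrite metric_coefE ?mxE; last by near: y; exact: open_nbhs_nbhs.
  by apply: eq_bigr => k _; rewrite mxE.
have -> : (fun y => \sum_k P y i k * P y j k : R^o) =
  \sum_k ((fun y => P y i k : R^o) * (fun y => P y j k : R^o)).
  by apply/funext => y; rewrite fct_sumE.
have dP l m := Ck_on_is_derive w (smoothP l m) Ux.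
have dS := is_derive_sum (fun k => is_deriveM (dP i k) (dP j k)).
apply: (is_derive_eq dS); rewrite !mxE -big_split; apply: eq_bigr => k _ /=.
by rewrite !mxE /GRing.scale /= [_ * P x j k]mulrC addrC.
Unshelve. all: by end_near. Qed.

Let dgram w : 'M[R]_8 := frame_derivative w *m (P x)^T + P x *m (frame_derivative w)^T.

Lemma dgram_sym w : (dgram w)^T = dgram w.
Proof. by rewrite linearD /= !trmx_mul !trmxK addrC. Qed.

Lemma gram_sym : (gram x)^T = gram x.
Proof. by rewrite trmx_mul trmxK. Qed.

(** The Koszul formula: lowering the index with the Gram matrix removes the
    inverse matrix from the Christoffel symbols. *)
Lemma connection_gram w i j : (connection_matrix w *m gram x) i j =
  \sum_l w 0 l * (2^-1 * (dgram (delta_mx 0 l) i j + dgram (delta_mx 0 i) l j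
                          - dgram (delta_mx 0 j) l i)).
Proof.
have uG : gram x \in unitmx by rewrite unitmx_mul unitmx_tr unitP.
rewrite mxE.
transitivity (\sum_l w 0 l * \sum_k christoffel g c x l i k * gram x k j).
  under eq_bigr => k _ do rewrite mxE mulr_suml.
  rewrite exchange_big; apply: eq_bigr => l _.
  by rewrite mulr_sumr; apply: eq_bigr => k _; rewrite mulrA.
apply: eq_bigr => l _; congr (_ * _).
have GE : \matrix_(i, j) ev2 (g c x) (delta_mx 0 i) (delta_mx 0 j) = gram x.
  by apply/matrixP => p q; rewrite mxE metric_coefE.
have dE p q r : 'D_(delta_mx 0 p) (fun y => (\matrix_(i, j)
     ev2 (g c y) (delta_mx 0 i) (delta_mx 0 j)) q r : R^o) x = dgram (delta_mx 0 p) q r.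
  by under eq_fun do rewrite mxE; have [_ ->] := is_derive_metric (delta_mx 0 p) q r.
pose K m := dgram (delta_mx 0 l) i m + dgram (delta_mx 0 i) l m - dgram (delta_mx 0 m) l i.
transitivity (2^-1 * \sum_m K m * \sum_k invmx (gram x) k m * gram x k j).
  rewrite mulr_sumr.
  transitivity (\sum_k \sum_m (2^-1 * (invmx (gram x) k m * K m) * gram x k j)).
    apply: eq_bigr => k _; rewrite /christoffel GE -mulr_suml; congr (_ * _).
    by rewrite mulr_sumr; apply: eq_bigr => m _; rewrite !dE.
  rewrite exchange_big; apply: eq_bigr => m _ /=.
  by rewrite mulr_sumr mulr_sumr; apply: eq_bigr => k _; ring.
congr (_ * _); rewrite (bigD1 j)//= [X in _ + X]big1 => [|m mj].
  rewrite (_ : \sum_k _ = 1) ?mulr1 ?addr0//.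
  transitivity (((invmx (gram x))^T *m gram x) j j).
    by rewrite [RHS]mxE; apply: eq_bigr => k _; rewrite [in X in _ = X * _]mxE.
  by rewrite -{2}gram_sym -trmx_mul mulmxV// trmx1 mxE eqxx.
rewrite (_ : \sum_k _ = 0) ?mulr0//.
transitivity (((invmx (gram x))^T *m gram x) m j).
  by rewrite [RHS]mxE; apply: eq_bigr => k _; rewrite [in X in _ = X * _]mxE.
by rewrite -{2}gram_sym -trmx_mul mulmxV// trmx1 mxE (negbTE mj).
Qed.

(** The covariant derivative of the coframe formed by the columns of [P],
    expressed in this coframe. *)
Definition connection_form (w : 'rV[R]_8) : 'M[R]_8 :=
  invmx (P x) *m (frame_derivative w - connection_matrix w *m P x).

(** Metric compatibility. With [G = P P^T], twice the symmetric part of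
    [P A P^T] is [D_w G - Gamma G - (Gamma G)^T], which vanishes by the Koszul
    formula. *)
Lemma connection_form_skew w i j : connection_form w i j = - connection_form w j i.
Proof.
pose Gw := connection_matrix w *m gram x.
have compat : Gw + Gw^T = dgram w.
  have dgl : dgram w = \sum_l w 0 l *: dgram (delta_mx 0 l).
    rewrite /dgram [in LHS]frame_derivative_basis.
    rewrite mulmx_suml raddf_sum mulmx_sumr -big_split; apply: eq_bigr => l _ /=.
    rewrite (_ : (w 0 l *: _)^T = w 0 l *: (frame_derivative (delta_mx 0 l))^T); last first.
      by apply/matrixP => p q; rewrite !mxE.
    by rewrite -scalemxAl -scalemxAr scalerDr.
  rewrite dgl; apply/matrixP => p q.
  rewrite [LHS]mxE [X in _ + X]mxE /Gw !connection_gram -big_split summxE.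
  apply: eq_bigr => l _ /=; rewrite [RHS]mxE -mulrDr; congr (_ * _).
  have s r t : dgram (delta_mx 0 l) r t = dgram (delta_mx 0 l) t r.
    by rewrite -[in RHS]dgram_sym [RHS]mxE.
  have half (b1 b1' b2 b3 : R) : b1' = b1 ->
      2^-1 * (b1 + b2 - b3) + 2^-1 * (b1' + b3 - b2) = b1.
    by move=> ->; field.
  exact: half (s q p).
pose T := frame_derivative w - connection_matrix w *m P x.
have TT : T *m (P x)^T + P x *m T^T = 0.
  rewrite /T mulmxBl linearB /= mulmxBr trmx_mul.
  have -> : P x *m ((P x)^T *m (connection_matrix w)^T) = Gw^T.
    by rewrite mulmxA -/(gram x) /Gw trmx_mul gram_sym.
  rewrite -mulmxA -/(gram x) -/Gw.
  by rewrite addrACA -opprD compat -/(dgram w) subrr.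
have PA : P x *m connection_form w = T by rewrite mulmxA mulmxV// mul1mx.
have : connection_form w + (connection_form w)^T = 0.
  have : P x *m (connection_form w + (connection_form w)^T) *m (P x)^T = 0.
    by rewrite mulmxDr mulmxDl PA -mulmxA -trmx_mul PA.
  move=> /(congr1 (fun M => invmx (P x) *m M *m (invmx (P x))^T)).
  rewrite mulmx0 mul0mx -!mulmxA -trmx_mul mulVmx// trmx1 mulmx1.
  by rewrite mulmxA mulVmx// mul1mx.
move=> /matrixP/(_ i j); rewrite [LHS]mxE [X in _ + X]mxE [RHS]mxE.
by move=> /eqP; rewrite addr_eq0 => /eqP.
Qed.

Lemma connection_form_linear a v w :
  connection_form (a *: v + w) = a *: connection_form v + connection_form w.
Proof.
rewrite /connection_form frame_derivative_linear connection_linear mulmxDl.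
rewrite opprD addrACA mulmxDr -scalemxAl -scalerBr.
by rewrite scalemxAr.
Qed.

Lemma connection_symmetric v w :
  v *m connection_matrix w = w *m connection_matrix v.
Proof.
have chS i j k : christoffel g c x i j k = christoffel g c x j i k.
  rewrite /christoffel; congr (_ * _); apply: eq_bigr => l _; congr (_ * _).
  rewrite [X in X - _]addrC; congr (_ - _).
  have dE p q r : 'D_(delta_mx 0 p) (fun y => (\matrix_(i, j)
     ev2 (g c y) (delta_mx 0 i) (delta_mx 0 j)) q r : R^o) x = dgram (delta_mx 0 p) q r.
    by under eq_fun do rewrite mxE; have [_ ->] := is_derive_metric (delta_mx 0 p) q r.
  by rewrite !dE -[in RHS]dgram_sym [RHS]mxE.
apply/rowP => l; rewrite !mxE.
under eq_bigr => i _ do rewrite mxE mulr_sumr.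
under [RHS]eq_bigr => i _ do rewrite mxE mulr_sumr.
rewrite exchange_big; apply: eq_bigr => i _; apply: eq_bigr => j _ /=.
by rewrite chS; ring.
Qed.

End LeviCivita.

(** * Closed Spin(7) forms are parallel *)

Section TorsionFree.
Context {R : realType} {n : nat} (C : mform R n 4).
Hypotheses (linC : is_multilinear C) (altC : is_alternating C).
Implicit Types (a b c d : 'rV[R]_n).

Definition args4 a b c d : 'I_4 -> 'rV[R]_n := fun l => nth 0 [:: a; b; c; d] l.

Lemma args4E (v : 'I_4 -> 'rV[R]_n) : v = args4 (v 0) (v 1) (v 2) (v 3).
Proof.
by apply/funext; case=> -[|[|[|[|//]]]] l4; rewrite /args4 /=; congr v; apply: val_inj.
Qed.

Lemma swap01 a b c d : C (args4 a b c d) = - C (args4 b a c d).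
Proof.
have ij : (0 : 'I_4) != 1 by [].
have E p q : dfwith (dfwith (args4 a b c d) (0 : 'I_4) p) (1 : 'I_4) q = args4 p q c d.
  by rewrite [LHS]args4E !dfwithE.
by have := alternating_swap linC altC (args4 a b c d) a b ij; rewrite !E.
Qed.

Lemma swap12 a b c d : C (args4 a b c d) = - C (args4 a c b d).
Proof.
have ij : (1 : 'I_4) != 2 by [].
have E p q : dfwith (dfwith (args4 a b c d) (1 : 'I_4) p) (2 : 'I_4) q = args4 a p q d.
  by rewrite [LHS]args4E !dfwithE.
by have := alternating_swap linC altC (args4 a b c d) b c ij; rewrite !E.
Qed.

Lemma swap23 a b c d : C (args4 a b c d) = - C (args4 a b d c).
Proof.
have ij : (2 : 'I_4) != 3 by [].
have E p q : dfwith (dfwith (args4 a b c d) (2 : 'I_4) p) (3 : 'I_4) q = args4 a b p q.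
  by rewrite [LHS]args4E !dfwithE.
by have := alternating_swap linC altC (args4 a b c d) c d ij; rewrite !E.
Qed.

(** The terms for the arguments [(i, j)] and [(j, i)] contain the same vector
    [G (v i) (v j)] next to the same other arguments; moving it to the front
    shows that their signs are opposite. This is why the exterior derivative is
    the alternation of the covariant derivative of a torsion-free connection. *)
Lemma alternation_symmetric (G : 'rV[R]_n -> 'rV[R]_n -> 'rV[R]_n)
    (v : 'I_5 -> 'rV[R]_n) : (forall x y, G x y = G y x) ->
  \sum_(i < 5) (-1) ^+ i * \sum_(m < 4)
     C (dfwith (fun j => v (lift i j)) m (G (v i) (v (lift i m)))) = 0.
Proof.
move=> symG.
pose f (k : nat) := v (inord k).
have fE i : v i = f i by rewrite /f inord_val.
transitivity (\sum_(i <- iota 0 5) (-1) ^+ i * \sum_(m <- iota 0 4)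
   C (args4 (if m == 0%N then G (f i) (f (bump i m)) else f (bump i 0))
            (if m == 1%N then G (f i) (f (bump i m)) else f (bump i 1))
            (if m == 2%N then G (f i) (f (bump i m)) else f (bump i 2))
            (if m == 3%N then G (f i) (f (bump i m)) else f (bump i 3)))).
  rewrite -[iota 0 5](@val_enum_ord 5) big_map big_enum; apply: eq_bigr => i _.
  congr (_ * _).
  rewrite -[iota 0 4](@val_enum_ord 4) big_map big_enum; apply: eq_bigr => m _ /=.
  congr C; rewrite [LHS]args4E !dfwithE !fE /=.
  by rewrite -!(inj_eq val_inj) /=.
rewrite /= !big_cons !big_nil /= /bump /=.
rewrite !(add0n, add1n).
rewrite !(swap01 _ (G _ _)) !(swap12 _ _ (G _ _)) !(swap01 _ (G _ _)).
rewrite !(swap23 _ _ _ (G _ _)) !(swap12 _ _ (G _ _)) !(swap01 _ (G _ _)).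
rewrite (symG (f 1%N) (f 0%N)) (symG (f 2%N) (f 0%N)) (symG (f 3%N) (f 0%N)).
rewrite (symG (f 4%N) (f 0%N)) (symG (f 2%N) (f 1%N)) (symG (f 3%N) (f 1%N)).
rewrite (symG (f 4%N) (f 1%N)) (symG (f 3%N) (f 2%N)) (symG (f 4%N) (f 2%N)).
rewrite (symG (f 4%N) (f 3%N)).
by ring.
Qed.

End TorsionFree.

Section ClosedParallel.
Context {R : realType} (N : manifold R 8) (g : tensor N 2) (psi : tensor N 4).
Context (c : chart N) (k : R).
Context (U : set 'rV[R]_8) (P : 'rV[R]_8 -> 'M[R]_8) (x : 'rV[R]_8).
Hypotheses (oU : open U) (Ux : U x)
  (smoothP : forall i j, Ck_on U 1 (fun y => P y i j : R^o))
  (gP : forall y, U y -> forall v w,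
     ev2 (g c y) v w = \sum_i (v *m P y) 0 i * (w *m P y) 0 i)
  (unitP : P x \in unitmx) (k0 : k != 0)
  (psiP : forall y, U y -> forall v, psi c y v = k * cayley (fun i => v i *m P y))
  (closed_psi : forall v, extd (psi c) x v = 0).

Lemma is_derive_cayley_frame w (v : 'I_4 -> 'rV[R]_8) :
  is_derive x w (fun y => psi c y v : R^o)
    (k * \sum_m cayley (dfwith (fun i => v i *m P x) m
                               (v m *m frame_derivative P x w))).
Proof.
apply: (@near_eq_is_derive _ _ _ (fun y => k *: (cayley (fun i => v i *m P y) : R^o))).
  by near=> y; rewrite psiP//; near: y; exact: open_nbhs_nbhs.
apply: is_deriveZ.
apply: (is_derive_cayley (r := fun i y => v i *m P y)
   (dr := fun i => v i *m frame_derivative P x w)) => i j.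
have -> : (fun y => (v i *m P y) 0 j : R^o) =
   \sum_l (v i 0 l *: (fun y => P y l j : R^o)).
  by apply/funext => y; rewrite fct_sumE mxE.
have dS := is_derive_sum (fun l => is_deriveZ (v i 0 l) (Ck_on_is_derive w (smoothP l j) Ux)).
apply: (is_derive_eq dS); rewrite mxE; apply: eq_bigr => l _.
by rewrite [in RHS]mxE.
Unshelve. all: by end_near. Qed.

Let u (v : 'I_4 -> 'rV[R]_8) i := v i *m P x.

Lemma psi_dfwith (v : 'I_4 -> 'rV[R]_8) m z :
  psi c x (dfwith v m z) = k * cayley (dfwith (u v) m (z *m P x)).
Proof.
rewrite psiP//; congr (_ * cayley _); apply/funext => i.
by rewrite /u !dfwithE; case: eqP.
Qed.

Lemma connection_row (w z : 'rV[R]_8) : \row_l \sum_i \sum_j w 0 i * z 0 j * christoffel g c x i j l =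
  z *m connection_matrix g c x w.
Proof.
apply/rowP => l; rewrite !mxE exchange_big; apply: eq_bigr => j _ /=.
by rewrite mxE mulr_sumr; apply: eq_bigr => i _; ring.
Qed.

(** Since [psi] is the pull-back of a constant form by [P], only the derivative
    of the coframe contributes to its covariant derivative. *)
Lemma nabla_cayley w v :
  nabla g psi c x w v = k * act cayley (connection_form g c P x w) (u v).
Proof.
rewrite /nabla; have [_ ->] := is_derive_cayley_frame w v.
under [X in _ - X]eq_bigr do rewrite connection_row psi_dfwith.
rewrite -mulr_sumr -mulrBr -sumrB; congr (_ * _); apply: eq_bigr => m _.
have -> : u v m *m connection_form g c P x w =
   v m *m frame_derivative P x w + - (v m *m connection_matrix g c x w *m P x).
  by rewrite /u /connection_form -!mulmxA (mulmxA (P x)) mulmxV// mul1mx mulmxBr.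
rewrite multilinearD; last exact: cayley_linear.
by rewrite multilinearN//; exact: cayley_linear.
Qed.

Lemma alternation_nabla (v : 'I_5 -> 'rV[R]_8) :
  \sum_(i < 5) (-1) ^+ i * nabla g psi c x (v i) (fun j => v (lift i j)) = 0.
Proof.
pose C : mform R 8 4 := psi c x.
have linC : is_multilinear C.
  move=> w i a y z; rewrite /C !psi_dfwith mulmxDl -scalemxAl cayley_linear.
  rewrite /GRing.scale /=; move: (cayley _) (cayley _) => p q.
  by rewrite mulrDr mulrCA.
have altC : is_alternating C.
  move=> w i j ij e; rewrite /C psiP// (cayley_alternating ij) ?mulr0//.
  by rewrite e.
have := alternation_symmetric linC altC v (connection_symmetric oU Ux smoothP gP).
rewrite -[RHS](closed_psi v) /extd => e.
under eq_bigr do rewrite /nabla mulrBr.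
rewrite sumrB; apply/eqP; rewrite subr_eq0; apply/eqP.
rewrite -e; apply: eq_bigr => i _; congr (_ * _); apply: eq_bigr => m _.
by rewrite connection_row -(connection_symmetric oU Ux smoothP gP).
Qed.

(** Fernandez' theorem. The covariant derivative is given by the skew matrices
    [connection_form w], and [d psi = 0] says that its alternation vanishes. *)
Lemma closed_parallel w v : nabla g psi c x w v = 0.
Proof.
pose a p := connection_form g c P x (basis_vector p *m invmx (P x)).
have skA p i j : a p i j = - a p j i by exact: (connection_form_skew oU Ux smoothP gP unitP).
have altA ps : ps \in increasing 8 5 ->
  \sum_(i <- iota 0 5) (-1) ^+ i * act cayley (a (nth 0%N ps i))
      (basis_tuple [seq nth 0%N ps (bump i j) | j <- iota 0 4]) = 0.
  move=> psI.
  have := alternation_nabla (fun i => basis_vector (nth 0%N ps i) *m invmx (P x)).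
  under eq_bigr do rewrite nabla_cayley mulrCA.
  rewrite -mulr_sumr => /eqP; rewrite mulf_eq0 (negbTE k0) orFb => /eqP e.
  rewrite -[RHS]e -[iota 0 5](@val_enum_ord 5) big_map big_enum.
  apply: eq_bigr => i _ /=; congr (_ * act _ _ _); apply/funext => j.
  rewrite /u -mulmxA mulVmx// mulmx1 /basis_tuple.
  by rewrite -[[:: _; _; _; _]]/[seq nth 0%N ps (bump i j) | j <- iota 0 4]
     (nth_map 0%N) ?size_iota// nth_iota.
rewrite nabla_cayley.
pose z := w *m P x.
have -> : w = \sum_(p < 8) z 0 p *: (basis_vector p *m invmx (P x)).
  transitivity (z *m invmx (P x)); first by rewrite -mulmxA mulmxV// mulmx1.
  rewrite {1}[z]row_sum_delta mulmx_suml; apply: eq_bigr => p _.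
  rewrite -scalemxAl; congr (_ *: (delta_mx _ _ *m _)).
  by apply: val_inj; rewrite /= inordK.
have lin := connection_form_linear g c oU Ux smoothP.
have A0 : connection_form g c P x 0 = 0.
  by have := lin (-1) 0 0; rewrite scaler0 addr0 scaleN1r addNr.
have actL (B B' : 'M[R]_8) t : act cayley (t *: B + B') (u v) =
    t * act cayley B (u v) + act cayley B' (u v).
  rewrite /act mulr_sumr -big_split; apply: eq_bigr => m _.
  by rewrite mulmxDr -scalemxAr cayley_linear.
have act0 : act cayley 0 (u v) = 0.
  by have := actL 0 0 (-1); rewrite scaler0 addr0 => ->; ring.
elim: (index_enum _) => [|p r IH]; first by rewrite big_nil A0 act0 mulr0.
rewrite big_cons lin actL (fernandez skA altA (ltn_ord p)).
by rewrite mulr0 add0r.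
Qed.

End ClosedParallel.

(** * Sp(1)Sp(1) structures at a point *)

Section Bilinear.
Context {R : realType} {n : nat}.

Lemma sum3 (V : nmodType) (f : 'I_3 -> V) : \sum_s f s = f 0 + f 1 + f 2.
Proof.
by rewrite !big_ord_recl big_ord0 addr0 addrA; congr (f _ + f _ + f _); apply: val_inj.
Qed.

Lemma ev2_linearl (a : mform R n 2) w : is_multilinear a ->
  linear (fun v => ev2 a v w : R^o).
Proof.
move=> la k u v; have E z : tnth [tuple z; w] = dfwith (fun=> w) (0 : 'I_2) z.
  by apply/funext => -[[|[|//]] i2]; rewrite dfwithE !(tnth_nth 0).
by rewrite /ev2 !E la.
Qed.

Lemma ev2_linearr (a : mform R n 2) v : is_multilinear a ->
  linear (fun w => ev2 a v w : R^o).
Proof.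
move=> la k u w; have E z : tnth [tuple v; z] = dfwith (fun=> v) (1 : 'I_2) z.
  by apply/funext => -[[|[|//]] i2]; rewrite dfwithE !(tnth_nth 0).
by rewrite /ev2 !E la.
Qed.

Lemma ev1_linear (a : mform R n 1) : is_multilinear a ->
  linear (fun w => ev1 a w : R^o).
Proof.
move=> la k u w; have E (z : 'rV[R]_n) : (fun=> z) = dfwith (fun=> 0) (0 : 'I_1) z.
  by apply/funext => i; rewrite ord1 dfwithE.
by rewrite /ev1 (E (k *: u + w)) la -!E.
Qed.

End Bilinear.

Section LinearMaps.
Context {R : realType} {U V : lmodType R} (f : U -> V) (lf : linear f).

Lemma linear_at0 : f 0 = 0.
Proof. by have := lf (-1) 0 0; rewrite scaler0 addr0 scaleN1r addNr. Qed.

Lemma linear_add x y : f (x + y) = f x + f y.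
Proof. by have := lf 1 x y; rewrite !scale1r. Qed.

Lemma linear_scale a x : f (a *: x) = a *: f x.
Proof. by have := lf a x 0; rewrite !addr0 linear_at0 addr0. Qed.

Lemma linear_opp x : f (- x) = - f x.
Proof. by rewrite -scaleN1r linear_scale scaleN1r. Qed.

Lemma linear_combination (I : Type) (r : seq I) (F : I -> U) (a : I -> R) :
  f (\sum_(i <- r) a i *: F i) = \sum_(i <- r) a i *: f (F i).
Proof.
elim: r => [|i r IH]; first by rewrite !big_nil linear_at0.
by rewrite !big_cons lf IH.
Qed.

End LinearMaps.

Section Point.
Context {R : realType} {M : manifold R 7} (S : sp1sp1 M).
Context (j : sp_index S) (c : chart M) (x : 'rV[R]_7).
Hypothesis hx : region c (sp_dom j) x.

Let m := ev2 (sp_metric S c x).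
Let gh := ev2 (sp_gH S c x).
Let eta s := ev1 (sp_eta j s c x).
Let J s := sp_I j s c x.
Let om s := ev2 (sp_omega j s c x).
Let H := sp_H S c x.
Let vertical := Defs.orthogonal (sp_metric S) (@sp_H _ _ S) c x.
Implicit Types (v w : 'rV[R]_7).

Lemma region_setT : region c setT x.
Proof. by case: hx => p [cp _] <-; exists p. Qed.

Let mP := (sp_metricP S).2 _ _ region_setT.

Lemma metric_sym v w : m v w = m w v. Proof. exact: mP.1. Qed.

Lemma metric_pos v : v != 0 -> 0 < m v v. Proof. exact: mP.2. Qed.

Lemma metric_linl w : linear (fun v => m v w : R^o).
Proof. by apply: ev2_linearl; case: (sp_metricP S).1 => /(_ _ _ region_setT). Qed.

Lemma metric_linr v : linear (fun w => m v w : R^o).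
Proof. by apply: ev2_linearr; case: (sp_metricP S).1 => /(_ _ _ region_setT). Qed.

Lemma gH_linl w : linear (fun v => gh v w : R^o).
Proof. by apply: ev2_linearl; case: (sp_gH_tensor S) => /(_ _ _ region_setT). Qed.

Lemma gH_linr v : linear (fun w => gh v w : R^o).
Proof. by apply: ev2_linearr; case: (sp_gH_tensor S) => /(_ _ _ region_setT). Qed.

Lemma eta_lin s : linear (fun v => eta s v : R^o).
Proof. by apply: ev1_linear; case: (sp_eta_form j s) => -[/(_ _ _ hx)]. Qed.

Lemma I_lin s : linear (J s).
Proof. by case: (sp_I_endo j s) => /(_ _ _ hx). Qed.

Lemma horizontalP v : H v <-> forall s, eta s v = 0. Proof. exact: sp_HE hx v. Qed.

(** The [xi s] span V and are dual to the [eta s], so that subtracting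
    [\sum_s eta s v *: xi s] projects [v] to H. *)
Lemma vertical_frame : exists xi : 'I_3 -> 'rV[R]_7,
  [/\ forall s, vertical (xi s),
      forall s t, m (xi s) (xi t) = (s == t)%:R,
      forall s t, eta s (xi t) = (s == t)%:R &
      forall v, H (v - \sum_s eta s v *: xi s)].
Proof.
have [xi xiP] := sp_eta_orthonormal hx; exists xi; split.
- by move=> s; case: (xiP s s).
- by move=> s t; case: (xiP s t).
- by move=> s t; case: (xiP s t).
move=> v; apply/horizontalP => s.
rewrite (linear_add (eta_lin s)) (linear_opp (eta_lin s)) (linear_combination (eta_lin s)).
rewrite (bigD1 s)//= big1 => [|t ts].
  by case: (xiP s s) => _ _ e; rewrite -/(eta s _) /eta e eqxx [_ *: 1]mulr1 addr0 subrr.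
case: (xiP s t) => _ _ e; rewrite /eta e eq_sym (negbTE ts).
by rewrite scaler0.
Qed.

(** [gH] only sees the classes of its arguments modulo V. *)
Lemma gH_horizontal v w h h' :
  H h -> H h' ->
  vertical (v - h) ->
  vertical (w - h') ->
  gh v w = m h h'.
Proof.
move=> Hh Hh' vh wh; have := sp_gHV region_setT w vh => -[e1 _].
have := sp_gHV region_setT h wh => -[_ e2].
rewrite /m -(sp_gHE region_setT Hh Hh') -/(gh _ _).
have -> : gh v w = gh (v - h) w + (gh h (w - h') + gh h h').
  by rewrite -(linear_add (gH_linr h)) subrK -(linear_add (gH_linl w)) subrK.
by rewrite /gh e1 e2 !add0r.
Qed.

Lemma orthogonal_sum (xi : 'I_3 -> 'rV[R]_7) (a : 'I_3 -> R) :
  (forall s, vertical (xi s)) ->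
  vertical (\sum_s a s *: xi s).
Proof.
move=> xiV w Hw; rewrite -/(m _ _) (linear_combination (metric_linl w)) big1// => s _.
by rewrite /m xiV// scaler0.
Qed.

(** This determines the sum of the squares of the [eta s] from the two global
    tensors, whatever the gauge. *)
Lemma metric_split v w : m v w = gh v w + \sum_s eta s v * eta s w.
Proof.
have [xi [xiV xixi xie hor]] := vertical_frame.
pose h u := u - \sum_s eta s u *: xi s.
have hV u : vertical (u - h u).
  by rewrite /h opprB addrC subrK; exact: orthogonal_sum.
have Hh u : H (h u) by exact: hor.
have uE u : u = h u + \sum_s eta s u *: xi s by rewrite /h subrK.
rewrite (gH_horizontal (Hh v) (Hh w) (hV v) (hV w)); clearbody h.
rewrite {1}(uE v) {1}(uE w).
rewrite (linear_add (metric_linl _)) !(linear_add (metric_linr _)) -addrA; congr (_ + _).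
have V0 b u : m (\sum_s b s *: xi s) (h u) = 0.
  exact: (@orthogonal_sum xi b xiV _ (Hh u)).
rewrite [X in X + _]metric_sym !V0 !add0r.
rewrite (linear_combination (metric_linl _)); apply: eq_bigr => s _; congr (_ * _).
rewrite (linear_combination (metric_linr _)) (bigD1 s)//= big1 => [|t ts].
  by rewrite xixi eqxx [_ *: 1]mulr1 addr0.
by rewrite xixi eq_sym (negbTE ts) scaler0.
Qed.

Lemma gH_sym v w : gh v w = gh w v.
Proof.
have := metric_sym v w; rewrite !metric_split.
by under [in X in _ = X -> _]eq_bigr do rewrite mulrC; move/addIr.
Qed.

Lemma gH_ge0 v : 0 <= gh v v.
Proof.
have [xi [xiV _ _ hor]] := vertical_frame.
pose h := v - \sum_s eta s v *: xi s.
have hV : vertical (v - h).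
  by rewrite /h opprB addrC subrK; exact: orthogonal_sum.
rewrite (gH_horizontal (hor v) (hor v) hV hV).
have [->|h0] := eqVneq (v - \sum_s eta s v *: xi s) 0.
  by rewrite (linear_at0 (metric_linl _)).
by rewrite ltW// metric_pos.
Qed.

Lemma gH_H v : H v -> gh v v = m v v.
Proof. by move=> Hv; apply: sp_gHE => //; exact: region_setT. Qed.

Lemma I_H s v : H (J s v).
Proof.
have [xi [xiV _ _ hor]] := vertical_frame.
have -> : J s v = J s (v - \sum_s eta s v *: xi s).
  rewrite (linear_add (I_lin s)) (linear_opp (I_lin s)).
  rewrite [X in _ - X](sp_I_V s hx) ?subr0//; exact: orthogonal_sum.
by apply: sp_I_H => //; exact: hor.
Qed.

(** On H this is the isometry property applied to [J v] and [w], since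
    [J (J v) = - v]; both sides only depend on the horizontal parts. *)
Lemma I_skew s v w : gh (J s v) w = - gh v (J s w).
Proof.
have [xi [xiV _ _ hor]] := vertical_frame.
pose h u := u - \sum_s eta s u *: xi s.
have hV u : vertical (u - h u).
  by rewrite /h opprB addrC subrK; exact: orthogonal_sum.
have Jh u : J s u = J s (h u).
  rewrite (linear_add (I_lin s)) (linear_opp (I_lin s)).
  rewrite [X in _ - X](sp_I_V s hx) ?subr0//; exact: orthogonal_sum.
have O0 : vertical 0.
  by move=> u _; rewrite -/(m _ _) (linear_at0 (metric_linl _)).
have E u u' : H u -> gh u u' = gh u (h u').
  move=> Hu; rewrite (gH_horizontal Hu (hor u'))// ?subrr//.
  by rewrite (gH_horizontal Hu (hor u'))// ?subrr.
have sk a b : H a -> H b -> gh (J s a) b = - gh a (J s b).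
  move=> Ha Hb; rewrite -[LHS](sp_I_isometry s hx)//; last exact: I_H.
  by rewrite (sp_I_sqr s hx Ha) -/(gh _ _) (linear_opp (gH_linl _)).
rewrite (E _ w (I_H s v)) (Jh v) (sk _ _ (hor v) (hor w)) -(Jh w).
by rewrite [in RHS]gH_sym (E _ v (I_H s w)) [in RHS]gH_sym.
Qed.

(** In dimension seven, seven orthonormal vectors form a basis: for the square
    matrices [Q] of the vectors and [C] of the dual covectors, [Q C = 1] implies
    [C Q = 1]. *)
Lemma parseval (q : 'I_7 -> 'rV[R]_7) : (forall a b, m (q a) (q b) = (a == b)%:R) ->
  forall v w, m v w = \sum_a m (q a) v * m (q a) w.
Proof.
move=> qq v w.
pose Q := \matrix_(i, k) q i 0 k.
pose C := \matrix_(k, i) m (delta_mx 0 k) (q i).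
have mE u i : m u (q i) = (u *m C) 0 i.
  rewrite {1}[u]row_sum_delta (linear_combination (metric_linl _)) mxE.
  by apply: eq_bigr => k _; rewrite mxE.
have QC : Q *m C = 1%:M.
  apply/matrixP => a b; rewrite !mxE -(qq a b) mE mxE.
  by apply: eq_bigr => k _; rewrite !mxE.
have vE : v = \sum_a m v (q a) *: q a.
  rewrite -[LHS]mulmx1 -(mulmx1C QC) mulmxA {1}[v *m C]row_sum_delta mulmx_suml.
  apply: eq_bigr => a _; rewrite -scalemxAl mE -rowE; congr (_ *: _).
  by apply/rowP => k; rewrite !mxE.
rewrite {1}vE (linear_combination (metric_linl _)); apply: eq_bigr => a _.
by rewrite metric_sym.
Qed.

(** As the [I_s] are skew isometries with the relations of the quaternions, [E],
    [I_1 E], [I_2 E], [I_3 E] are orthonormal. Together with the [xi s] they are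
    an orthonormal basis of the tangent space, and the relations give the images
    of [E], [I_1 E], [I_2 E], [I_3 E] under each [I_s]. *)
Lemma adapted_coframe (E : 'rV[R]_7) : H E -> gh E E = 1 ->
  let e0 := gh E in let e1 := gh (J 0 E) in
  let e2 := gh (J 1 E) in let e3 := gh (J 2 E) in
  [/\ forall v w, gh v w = e0 v * e0 w + e1 v * e1 w + e2 v * e2 w + e3 v * e3 w,
      forall v w, gh (J 0 v) w = e0 v * e1 w - e1 v * e0 w + (e2 v * e3 w - e3 v * e2 w),
      forall v w, gh (J 1 v) w = e0 v * e2 w - e2 v * e0 w - (e1 v * e3 w - e3 v * e1 w) &
      forall v w, gh (J 2 v) w = e0 v * e3 w - e3 v * e0 w + (e1 v * e2 w - e2 v * e1 w)].
Proof.
move=> HE' EE e0 e1 e2 e3.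
have J01 v : H v -> J 0 (J 1 v) = J 2 v by move=> Hv; case: (sp_I_quaternion hx Hv).
have J10 v : H v -> J 1 (J 0 v) = - J 2 v by move=> Hv; case: (sp_I_quaternion hx Hv).
have JJ s v : H v -> J s (J s v) = - v by exact: sp_I_sqr.
have JN s v : J s (- v) = - J s v by exact: (linear_opp (I_lin s)).
have HJ s : H (J s E) by exact: I_H.
have ghNl v w : gh (- v) w = - gh v w by exact: (linear_opp (gH_linl w)).
have ghNr v w : gh v (- w) = - gh v w by exact: (linear_opp (gH_linr v)).
have iso s v w : H v -> H w -> gh (J s v) (J s w) = gh v w by exact: sp_I_isometry.
have J02 : J 0 (J 2 E) = - J 1 E by rewrite -J01// JJ.
have J20 : J 2 (J 0 E) = J 1 E.
  by rewrite -J01 ?HJ// J10// JN J02 opprK.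
have J12 : J 1 (J 2 E) = J 0 E.
  by rewrite -[J 2 E]opprK -J10// JN JJ// opprK.
have J21 : J 2 (J 1 E) = - J 0 E by rewrite -J01 ?HJ// JJ// JN.
have EJ s : gh E (J s E) = 0.
  by have := I_skew s E E; rewrite gH_sym; lra.
have e01 : gh (J 0 E) (J 1 E) = 0.
  by rewrite -(iso 0)// JJ// J01// ghNl EJ oppr0.
have e02 : gh (J 0 E) (J 2 E) = 0.
  by rewrite -J01// iso// EJ.
have e12 : gh (J 1 E) (J 2 E) = 0.
  by rewrite -[J 2 E]opprK -J10// ghNr iso// EJ oppr0.
have nrm s : gh (J s E) (J s E) = 1 by rewrite iso.
have [xi [xiV xixi xie hor]] := vertical_frame.
pose q (a : 'I_7) : 'rV[R]_7 :=
  nth 0 [:: E; J 0 E; J 1 E; J 2 E; xi 0; xi 1; xi 2] a.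
have eH v s : H v -> eta s v = 0 by move=> /horizontalP.
have mH v w : H v -> m v w = gh v w.
  by move=> Hv; rewrite metric_split big1 ?addr0// => s _; rewrite eH// mul0r.
have mxi v s : H v -> m v (xi s) = 0.
  by move=> Hv; rewrite metric_sym; exact: xiV.
have qq a b : m (q a) (q b) = (a == b)%:R.
  rewrite -(inj_eq val_inj) /q.
  case: a b => -[|[|[|[|[|[|[|//]]]]]]] a7 [[|[|[|[|[|[|[|//]]]]]]] b7] /=;
    first [by rewrite xixi | by rewrite mxi | by rewrite metric_sym mxi | rewrite mH//];
    by rewrite ?nrm ?EE ?EJ ?e01 ?e02 ?e12// gH_sym ?EJ ?e01 ?e02 ?e12.
have ghE v w : gh v w = e0 v * e0 w + e1 v * e1 w + e2 v * e2 w + e3 v * e3 w.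
  have := metric_split v w; rewrite sum3 (parseval qq) !big_ord_recl big_ord0 /q /=.
  have mx s u : m (xi s) u = eta s u.
    have [xiL _] := sp_gHV region_setT u (xiV s).
    rewrite metric_split -/(gh _ _) /gh xiL add0r (bigD1 s)//= big1 => [|t ts].
      by rewrite xie eqxx mul1r addr0.
    by rewrite xie (negbTE ts) mul0r.
  rewrite !mx !mH// -/e0 -/e1 -/e2 -/e3; lra.
have tr s v w : gh (J s v) w = - (gh (J s E) v * e0 w + gh (J s (J 0 E)) v * e1 w
   + gh (J s (J 1 E)) v * e2 w + gh (J s (J 2 E)) v * e3 w).
  have sk u : gh u (J s v) = - gh (J s u) v by rewrite I_skew opprK.
  by rewrite ghE /e0 /e1 /e2 /e3 !sk !mulNr !opprD.
split=> // v w; rewrite tr ?JJ// ?J10 ?J20 ?J02 ?J12 ?J21 ?J01// !ghNl -/e0 -/e1 -/e2 -/e3; ring.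
Qed.

End Point.

(** * Change of gauge *)

Lemma det_mx33 (R : comNzRingType) (A : 'M[R]_3) : \det A =
  A 0 0 * (A 1 1 * A 2 2 - A 1 2 * A 2 1) - A 0 1 * (A 1 0 * A 2 2 - A 1 2 * A 2 0)
  + A 0 2 * (A 1 0 * A 2 1 - A 1 1 * A 2 0).
Proof.
pose A' (i j : nat) := A (inord i) (inord j).
have AE (i j : 'I_3) : A i j = A' i j by rewrite /A' !inord_val.
rewrite /determinant.
transitivity (altsum 3 (fun w : seq nat => \prod_(i < 3) A' i (nth 0%N w i)) id).
  rewrite -(@sum_perm_altsum _ _ 3 _ id (@nat_of_ord 3))//; apply: eq_bigr => p _.
  congr (_ * _); apply: eq_bigr => i _; rewrite AE.
  by rewrite (nth_map i) ?size_enum_ord// nth_ord_enum.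
by rewrite !AE /= !big_ord_recl !big_ord0 /= /bump /= !(add0n, add1n); ring.
Qed.

Section Regions.
Context {R : realType} {n : nat} (M : manifold R n).

Lemma region_open (c : chart M) (W : set (man_space M)) : open W -> open (region c W).
Proof.
move=> oW; rewrite openE => _ [p [cp Wp] <-].
have Up : (cmap c @` cdom c) (cmap c p) by exists p.
have := cinv_continuous Up; rewrite /prop_for /continuous_at cmapK// => cc.
have Vp : \forall y \near cmap c p, W (cinv c y).
  by apply: cc; apply: open_nbhs_nbhs.
have Up' : \forall y \near cmap c p, (cmap c @` cdom c) y.
  by apply: open_nbhs_nbhs; split=> //; exact: cmap_open.
rewrite /interior; near=> y.
have [q cq qy] : (cmap c @` cdom c) y by near: y.
by exists q => //; split=> //; rewrite -(cmapK cq) qy; near: y.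
Unshelve. all: by end_near. Qed.

Lemma region_sub (c : chart M) (W W' : set (man_space M)) :
  W `<=` W' -> region c W `<=` region c W'.
Proof. by move=> s _ [p [cp Wp] <-]; exists p => //; split=> //; exact: s. Qed.

End Regions.

Section Gauge.
Context {R : realType} {M : manifold R 7} (S : sp1sp1 M) (tau : R).
Hypotheses (phi_global : globally_defined (@sp_phi R M S))
  (struct_eq : structure_equations S tau).
Context (j j' : sp_index S) (c : chart M) (x : 'rV[R]_7).
Hypothesis hx2 : region c (sp_dom j `&` sp_dom j') x.

Let hx : region c (sp_dom j) x. Proof. by apply: region_sub hx2 => p []. Qed.
Let hx' : region c (sp_dom j') x. Proof. by apply: region_sub hx2 => p []. Qed.

Lemma sum_eta_sqr (y v w : 'rV[R]_7) : region c (sp_dom j `&` sp_dom j') y ->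
  \sum_s ev1 (sp_eta j s c y) v * ev1 (sp_eta j s c y) w =
  \sum_s ev1 (sp_eta j' s c y) v * ev1 (sp_eta j' s c y) w.
Proof.
move=> hy; have hy1 : region c (sp_dom j) y by apply: region_sub hy => p [].
have hy2 : region c (sp_dom j') y by apply: region_sub hy => p [].
by have := metric_split hy1 v w; rewrite (metric_split hy2) => /addrI ->.
Qed.

Lemma omega_horizontal (k : sp_index S) (hk : region c (sp_dom k) x) s v w h h' :
  sp_H S c x h -> sp_H S c x h' ->
  Defs.orthogonal (sp_metric S) (@sp_H _ _ S) c x (v - h) ->
  Defs.orthogonal (sp_metric S) (@sp_H _ _ S) c x (w - h') ->
  ev2 (sp_omega k s c x) v w = ev2 (sp_omega k s c x) h h'.
Proof.
move=> Hh Hh' vh wh; rewrite /ev2 /sp_omega /= !(tnth_nth 0) /=.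
have -> : sp_I k s c x v = sp_I k s c x h.
  rewrite -[v in LHS](subrK h) (linear_add (I_lin hk s)).
  by rewrite (sp_I_V s hk vh) add0r.
have V0 : Defs.orthogonal (sp_metric S) (@sp_H _ _ S) c x 0.
  by move=> u _; rewrite (linear_at0 (metric_linl hk _)).
rewrite !(gH_horizontal hk (I_H hk s h) Hh') ?subrr//.
Qed.

Lemma extd1E (al : 'rV[R]_7 -> mform R 7 1) v w :
  extd al x (tnth [tuple v; w]) =
  'D_v (fun y => ev1 (al y) w : R^o) x - 'D_w (fun y => ev1 (al y) v : R^o) x.
Proof.
rewrite /extd big_ord_recl big_ord_recl big_ord0 addr0 expr0 mul1r expr1 mulN1r.
rewrite !(tnth_nth 0) /=.
by congr ('D_v _ x - 'D_w _ x); apply/funext => y; congr (al y _);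
   apply/funext => -[[|//] i1]; rewrite (tnth_nth 0).
Qed.

Lemma eta_smooth (k : sp_index S) s v :
  smooth_on (region c (sp_dom k)) (fun y => ev1 (sp_eta k s c y) v : R^o).
Proof. by case: (sp_eta_form k s) => -[_ /(_ c (fun=> v))]. Qed.

Lemma deta_omega (k : sp_index S) (hk : region c (sp_dom k) x) s v w :
  'D_v (fun y => ev1 (sp_eta k s c y) w : R^o) x -
  'D_w (fun y => ev1 (sp_eta k s c y) v : R^o) x =
  2 * ev2 (sp_omega k s c x) v w + 2 * tau *
    (ev1 (sp_eta k (s + 1) c x) v * ev1 (sp_eta k (s + 2) c x) w -
     ev1 (sp_eta k (s + 1) c x) w * ev1 (sp_eta k (s + 2) c x) v).
Proof.
rewrite -extd1E (struct_eq s hk).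
rewrite -[LHS]/(2 * ev2 (sp_omega k s c x) v w + 2 * tau * wedge _ _ _).
by rewrite wedge11E !(tnth_nth 0).
Qed.

(** The triples [eta] and [eta'] are orthonormal coframes of V, hence differ by
    an orthogonal matrix [B]. Differentiating the equality of the sums of their
    squares at [x] shows that [d eta'] and [d eta] restricted to H differ by the
    same [B]; these restrictions are [2 omega'] and [2 omega]. Comparing the two
    expressions of [phi] on vertical vectors gives [\det B = 1]. *)
Lemma gauge_rotation : exists B : 'M[R]_3,
  [/\ forall i v, ev1 (sp_eta j' i c x) v = \sum_t B i t * ev1 (sp_eta j t c x) v,
      forall i v w, ev2 (sp_omega j' i c x) v w =
         \sum_t B i t * ev2 (sp_omega j t c x) v w,
      B *m B^T = 1%:M & \det B = 1].
Proof.
have [xi [xiV xixi xie hor]] := vertical_frame hx'.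
pose eta s v := ev1 (sp_eta j s c x) v.
pose eta' s v := ev1 (sp_eta j' s c x) v.
pose B := \matrix_(i, t) eta t (xi i).
have etaB i v : eta' i v = \sum_t B i t * eta t v.
  transitivity (\sum_t eta t v * eta t (xi i)).
    rewrite (sum_eta_sqr v (xi i) hx2) (bigD1 i)//= big1 => [|t ti].
      by rewrite xie eqxx mulr1 addr0.
    by rewrite xie (negbTE ti) mulr0.
  by apply: eq_bigr => t _; rewrite mxE mulrC.
exists B; split.
- exact: etaB.
- move=> i v w.
  have [X HX vX] : exists2 X, sp_H S c x X &
      Defs.orthogonal (sp_metric S) (@sp_H _ _ S) c x (v - X).
    exists (v - \sum_s eta' s v *: xi s); first exact: hor.
    rewrite opprB addrC subrK; exact: (orthogonal_sum hx' _ xiV).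
  have [Y HY wY] : exists2 X, sp_H S c x X &
      Defs.orthogonal (sp_metric S) (@sp_H _ _ S) c x (w - X).
    exists (w - \sum_s eta' s w *: xi s); first exact: hor.
    rewrite opprB addrC subrK; exact: (orthogonal_sum hx' _ xiV).
  rewrite (omega_horizontal hx' i HX HY vX wY).
  under eq_bigr do rewrite (omega_horizontal hx _ HX HY vX wY).
  have d2 (k : sp_index S) (hk : region c (sp_dom k) x) s :
    2 * ev2 (sp_omega k s c x) X Y =
      'D_X (fun y => ev1 (sp_eta k s c y) Y : R^o) x -
      'D_Y (fun y => ev1 (sp_eta k s c y) X : R^o) x.
    rewrite (deta_omega hk).
    have e t : ev1 (sp_eta k t c x) X = 0 by move/(horizontalP hk) : HX.
    have e' t : ev1 (sp_eta k t c x) Y = 0 by move/(horizontalP hk) : HY.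
    by rewrite !e !e'; ring.
  have oW : open (region c (sp_dom j `&` sp_dom j')).
    by apply: region_open; apply: openI; exact: sp_dom_open.
  (* In the derivative of the sum of squares, evaluated on [W] and [xi i], the
     values on [W] vanish at [x], so that only their derivatives survive. *)
  have key (Z W : 'rV[R]_7) : sp_H S c x W ->
    'D_Z (fun y => ev1 (sp_eta j' i c y) W : R^o) x =
    \sum_t B i t * 'D_Z (fun y => ev1 (sp_eta j t c y) W : R^o) x.
    move=> HW.
    pose sq (k : sp_index S) : 'rV[R]_7 -> R^o :=
      \sum_s ((fun y => ev1 (sp_eta k s c y) W : R^o) *
              (fun y => ev1 (sp_eta k s c y) (xi i) : R^o)).
    have dsq (k : sp_index S) (hk : region c (sp_dom k) x) : 'D_Z (sq k) x =
       \sum_s ev1 (sp_eta k s c x) (xi i) * 'D_Z (fun y => ev1 (sp_eta k s c y) W : R^o) x.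
      have dP s v' : is_derive x Z (fun y => ev1 (sp_eta k s c y) v' : R^o)
          ('D_Z (fun y => ev1 (sp_eta k s c y) v' : R^o) x).
        exact: (Ck_on_is_derive _ (eta_smooth k s v' 1) hk).
      have [_ ->] := is_derive_sum (fun s => is_deriveM (dP s W) (dP s (xi i))).
      apply: eq_bigr => s _; have -> : ev1 (sp_eta k s c x) W = 0 by move/(horizontalP hk) : HW.
      by rewrite scale0r add0r.
    have : 'D_Z (sq j) x = 'D_Z (sq j') x.
      apply: near_eq_derive; near=> y; rewrite /sq !fct_sumE.
      by apply: sum_eta_sqr; near: y; exact: open_nbhs_nbhs.
    rewrite (dsq j hx) (dsq j' hx') => e.
    under [RHS]eq_bigr do rewrite mxE; rewrite e (bigD1 i)//= big1 => [|t ti].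
      by rewrite xie eqxx mul1r addr0.
    by rewrite xie (negbTE ti) mul0r.
  apply: (@mulfI _ 2) => //; rewrite mulr_sumr.
  under eq_bigr do rewrite mulrCA (d2 _ hx).
  rewrite (d2 _ hx') !key// -sumrB; apply: eq_bigr => t _.
  by rewrite mulrBr.
- apply/matrixP => i k; rewrite !mxE.
  transitivity (\sum_t eta t (xi i) * eta t (xi k)).
    by apply: eq_bigr => t _; rewrite !mxE.
  rewrite (sum_eta_sqr _ _ hx2) (bigD1 i)//= big1 => [|t ti].
    by rewrite !xie eqxx mul1r addr0.
  by rewrite xie (negbTE ti) mul0r.
have := phi_global hx2.
move=> /(congr1 (fun f : mform R 7 3 => f (tnth [tuple xi 0; xi 1; xi 2]))).
have phiE (k : sp_index S) (hk : region c (sp_dom k) x) :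
    sp_phi k c x (tnth [tuple xi 0; xi 1; xi 2]) =
    2 * wedge (wedge (sp_eta k 0 c x) (sp_eta k 1 c x)) (sp_eta k 2 c x)
      (tnth [tuple xi 0; xi 1; xi 2] : 'I_3 -> 'rV[R]_7).
  have w0 s : wedge (sp_omega k s c x) (sp_eta k s c x)
      (tnth [tuple xi 0; xi 1; xi 2] : 'I_3 -> 'rV[R]_7) = 0.
    apply: wedge21_eq0 => p q; rewrite /ev2 /sp_omega (tnth_nth 0) /=.
    have -> : sp_I k s c x (tnth [tuple xi 0; xi 1; xi 2] p) = 0.
      apply: sp_I_V => //; rewrite (tnth_nth 0).
      by case: p => -[|[|[|//]]] p3 /=; exact: xiV.
    exact: (linear_at0 (gH_linl hk _)).
  rewrite -[LHS]/(2 * wedge (sp_omega k 0 c x) (sp_eta k 0 c x) _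
     + 2 * wedge (sp_omega k 1 c x) (sp_eta k 1 c x) _
     - 2 * wedge (sp_omega k 2 c x) (sp_eta k 2 c x) _ + 2 * wedge _ _ _).
  by rewrite !w0; ring.
rewrite (phiE j hx) (phiE j' hx') !wedge111E !(tnth_nth 0) /= !xie /=.
move=> e.
rewrite det_mx33 !mxE /eta; lra.
Unshelve. all: by end_near. Qed.

End Gauge.

(** * Triples of 2-forms and rotations *)

Lemma ord3_add : ((((0 + 1 = 1 :> 'I_3)%R * (0 + 2 = 2 :> 'I_3)%R) *
  ((1 + 1 = 2 :> 'I_3)%R * (1 + 2 = 0 :> 'I_3)%R)) *
  ((2 + 1 = 0 :> 'I_3)%R * (2 + 2 = 1 :> 'I_3)%R))%type.
Proof. by do !split; apply: val_inj. Qed.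

Lemma ord3_ind (P : 'I_3 -> Prop) : P 0 -> P 1 -> P 2 -> forall i, P i.
Proof.
by move=> P0 P1 P2 [[|[|[|//]]] i3];
   [rewrite (_ : Ordinal i3 = 0)//|rewrite (_ : Ordinal i3 = 1)//
   |rewrite (_ : Ordinal i3 = 2)//]; apply: val_inj.
Qed.

Section Rotations.
Context {R : realType} (B : 'M[R]_3).
Hypotheses (BB : B *m B^T = 1%:M) (detB : \det B = 1).

Lemma rotation_dot (a b : 'I_3 -> R) :
  \sum_i (\sum_s B i s * a s) * (\sum_t B i t * b t) = \sum_s a s * b s.
Proof.
pose A := \col_s a s; pose C := \col_s b s.
have E (f g : 'I_3 -> R) : \sum_s f s * g s = ((\col_s f s)^T *m (\col_s g s)) 0 0.
  by rewrite mxE; apply: eq_bigr => s _; rewrite !mxE.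
rewrite !E.
have D (f : 'I_3 -> R) : \col_i (\sum_s B i s * f s) = B *m \col_s f s.
  by apply/matrixP => i k; rewrite !mxE; apply: eq_bigr => s _; rewrite !mxE.
by rewrite !D trmx_mul mulmxA -[in X in X *m _](mulmxA _ B^T) (mulmx1C BB) mulmx1.
Qed.

(** The cofactor matrix [K] satisfies [K B^T = det B], and here [B^T] is the
    inverse of [B]. *)
Lemma rotation_cofactor i s :
  B (i + 1) (s + 1) * B (i + 2) (s + 2) - B (i + 1) (s + 2) * B (i + 2) (s + 1) = B i s.
Proof.
pose K : 'M[R]_3 := \matrix_(i, s)
  (B (i + 1) (s + 1) * B (i + 2) (s + 2) - B (i + 1) (s + 2) * B (i + 2) (s + 1)).
have KB : K *m B^T = 1%:M.
  apply/matrixP; elim/ord3_ind; elim/ord3_ind;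
    rewrite !mxE sum3 !mxE !ord3_add /= -?detB ?det_mx33; ring.
suff /matrixP/(_ i s) : K = B by rewrite [LHS]mxE.
by rewrite -[LHS]mulmx1 -(mulmx1C BB) mulmxA KB mul1mx.
Qed.

Lemma rotation_cross (a b : 'I_3 -> R) i :
  (\sum_s B (i + 1) s * a s) * (\sum_s B (i + 2) s * b s) -
  (\sum_s B (i + 1) s * b s) * (\sum_s B (i + 2) s * a s) =
  \sum_s B i s * (a (s + 1) * b (s + 2) - b (s + 1) * a (s + 2)).
Proof. rewrite !sum3 -!(rotation_cofactor i) !ord3_add; ring. Qed.

End Rotations.

Section Triples.
Context {R : realType} {n : nat}.
Local Notation V := 'rV[R]_n.
Implicit Types (A G : 'I_3 -> V -> V -> R) (u : R).

(** The value of the 4-form [F /\ G]. *)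
Definition polar (F G : V -> V -> R) (v0 v1 v2 v3 : V) : R :=
  F v0 v1 * G v2 v3 + F v2 v3 * G v0 v1 - (F v0 v2 * G v1 v3 + F v1 v3 * G v0 v2)
  + (F v0 v3 * G v1 v2 + F v1 v2 * G v0 v3).

Definition conformal_triple A := forall i v0 v1 v2 v3,
  pfaffian (A i) v0 v1 v2 v3 = pfaffian (A 0) v0 v1 v2 v3.

(** What the signed sum of the squares of the [u A_i - eps_i G_i] becomes when the
    squares of the [A_i] agree, and those of the [G_i] as well: the signs cancel
    in the mixed terms and [\sum_i eps_i = 1], so that an expression without
    signs remains. *)
Definition triple_form u A G (v0 v1 v2 v3 : V) : R :=
  2 * (u ^+ 2 / 3 * \sum_i pfaffian (A i) v0 v1 v2 v3
       - u * \sum_i polar (A i) (G i) v0 v1 v2 v3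
       + 3^-1 * \sum_i pfaffian (G i) v0 v1 v2 v3).

Lemma signed_squares u A G (v0 v1 v2 v3 : V) :
  conformal_triple A -> conformal_triple G ->
  \sum_i eps i * (2 * pfaffian (fun v w => u * A i v w - eps i * G i v w) v0 v1 v2 v3)
  = triple_form u A G v0 v1 v2 v3.
Proof.
move=> cA cG.
transitivity (\sum_i 2 * (eps i * u ^+ 2 * pfaffian (A i) v0 v1 v2 v3
    - u * polar (A i) (G i) v0 v1 v2 v3 + eps i * pfaffian (G i) v0 v1 v2 v3)).
  apply: eq_bigr => i _.
  have e2 : eps i ^+ 2 = 1 :> R by rewrite /eps; case: ifP; rewrite ?sqrrN ?expr1n.
  rewrite -[X in u * X]mul1r -[X in _ + eps i * X]mul1r -e2 /pfaffian /polar; ring.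
rewrite /triple_form !sum3 (cA 1) (cA 2) (cG 1) (cG 2) /eps /=.
by field.
Qed.

(** [triple_form] is built from scalar products of triples of numbers. *)
Lemma triple_form_rotation (B : 'M[R]_3) u A G A' G' (v0 v1 v2 v3 : V) :
  B *m B^T = 1%:M ->
  (forall i v w, A' i v w = \sum_s B i s * A s v w) ->
  (forall i v w, G' i v w = \sum_s B i s * G s v w) ->
  triple_form u A' G' v0 v1 v2 v3 = triple_form u A G v0 v1 v2 v3.
Proof.
move=> BB hA hG.
have dot (X Y X' Y' : 'I_3 -> V -> V -> R) v w v' w' :
    (forall i v w, X' i v w = \sum_s B i s * X s v w) ->
    (forall i v w, Y' i v w = \sum_s B i s * Y s v w) ->
    \sum_i X' i v w * Y' i v' w' = \sum_i X i v w * Y i v' w'.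
  move=> hX hY; rewrite -(rotation_dot BB (fun s => X s v w) (fun s => Y s v' w')).
  by apply: eq_bigr => i _; rewrite hX hY.
have pf (X X' : 'I_3 -> V -> V -> R) : (forall i v w, X' i v w = \sum_s B i s * X s v w) ->
    \sum_i pfaffian (X' i) v0 v1 v2 v3 = \sum_i pfaffian (X i) v0 v1 v2 v3.
  by move=> hX; rewrite /pfaffian !big_split !sumrN !(dot X X X' X')//.
have po : \sum_i polar (A' i) (G' i) v0 v1 v2 v3 = \sum_i polar (A i) (G i) v0 v1 v2 v3.
  by rewrite /polar !(big_split, sumrN) /= !(dot A G A' G')//.
by rewrite /triple_form (pf A A')// (pf G G')// po.
Qed.

(** With [b = bcoef tau a u] these are the 2-forms [G_i] for which
    [F_i = u omega_i - eps_i G_i]. *)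
Definition vertical_form (b : R) (eta : 'I_3 -> V -> R) (t : V -> R) (i : 'I_3)
    (v w : V) : R :=
  b * (eta (i + 1) v * eta (i + 2) w - eta (i + 1) w * eta (i + 2) v)
  + 6^-1 * (eta i v * t w - eta i w * t v).

Lemma vertical_form_conformal b eta t : conformal_triple (vertical_form b eta t).
Proof.
move=> i v0 v1 v2 v3; rewrite /pfaffian /vertical_form.
elim/ord3_ind: i; rewrite ?ord3_add ?add0r; ring.
Qed.

Lemma vertical_form_rotation (B : 'M[R]_3) b eta eta' t i v w :
  B *m B^T = 1%:M -> \det B = 1 ->
  (forall i v, eta' i v = \sum_s B i s * eta s v) ->
  vertical_form b eta' t i v w = \sum_s B i s * vertical_form b eta t s v w.
Proof.
move=> BB dB h; rewrite /vertical_form !h rotation_cross// !sum3; ring.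
Qed.

End Triples.

(** * The forms on the cylinder *)

Section Point.
Context {R : realType} {M : manifold R 7} (S : sp1sp1 M).
Context (j : sp_index S) (c : chart M) (x : 'rV[R]_7).
Hypothesis hx : region c (sp_dom j) x.

(** H is the kernel of three linear forms on a space of dimension seven. *)
Lemma exists_horizontal : exists2 X, sp_H S c x X & X != 0.
Proof.
pose A : 'M[R]_(7, 3) := \matrix_(k, s) ev1 (sp_eta j s c x) (delta_mx 0 k).
have K0 : kermx A != 0.
  rewrite -mxrank_eq0 mxrank_ker subn_eq0 -ltnNge.
  by apply: leq_ltn_trans (rank_leq_col A) _.
have /rowV0Pn[i /sub_kermxP iA i0] := K0.
exists i => //.
apply/(horizontalP hx) => s.
have -> : ev1 (sp_eta j s c x) i = (i *m A) 0 s.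
  rewrite [i in LHS]row_sum_delta (linear_combination (eta_lin hx s)) mxE.
  by apply: eq_bigr => k _; rewrite mxE.
by rewrite iA mxE.
Qed.

Lemma omegaE s v w : ev2 (sp_omega j s c x) v w = ev2 (sp_gH S c x) (sp_I j s c x v) w.
Proof. by rewrite {1}/ev2 /sp_omega !(tnth_nth 0). Qed.

Lemma omega_skew s v w : ev2 (sp_omega j s c x) v w = - ev2 (sp_omega j s c x) w v.
Proof. by rewrite !omegaE (I_skew hx) (gH_sym hx). Qed.

Lemma gH_horizontal_gt0 X : sp_H S c x X -> X != 0 -> 0 < ev2 (sp_gH S c x) X X.
Proof. by move=> HX X0; rewrite (gH_H hx HX) (metric_pos hx). Qed.

Lemma exists_unit_horizontal :
  exists2 E, sp_H S c x E & ev2 (sp_gH S c x) E E = 1.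
Proof.
have [X HX X0] := exists_horizontal.
have p := gH_horizontal_gt0 HX X0.
pose N := ev2 (sp_gH S c x) X X.
exists ((Num.sqrt N)^-1 *: X).
  by apply/(horizontalP hx) => s; rewrite (linear_scale (eta_lin hx s)) ((horizontalP hx X).1 HX) scaler0.
rewrite (linear_scale (gH_linl hx _)) (linear_scale (gH_linr hx _)) -/N /GRing.scale /=.
have s0 : Num.sqrt N != 0 by rewrite gt_eqF// sqrtr_gt0.
have e : Num.sqrt N ^+ 2 = N := sqr_sqrtr (ltW p).
by rewrite mulrA -expr2 -[X in _ * X]e -exprMn mulVf ?expr1n.
Qed.

Lemma omega_normal_form : exists e0 e1 e2 e3 : 'rV[R]_7 -> R, let om s := ev2 (sp_omega j s c x) in
  [/\ forall v w, om 0 v w = e0 v * e1 w - e1 v * e0 w + (e2 v * e3 w - e3 v * e2 w),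
      forall v w, om 1 v w = e0 v * e2 w - e2 v * e0 w - (e1 v * e3 w - e3 v * e1 w) &
      forall v w, om 2 v w = e0 v * e3 w - e3 v * e0 w + (e1 v * e2 w - e2 v * e1 w)].
Proof.
have [E HE' E1] := exists_unit_horizontal.
have [_ o0 o1 o2] := adapted_coframe hx HE' E1.
by do 4 eexists; split=> v w; rewrite omegaE; [exact: o0|exact: o1|exact: o2].
Qed.

Lemma omega_conformal : conformal_triple (fun s => ev2 (sp_omega j s c x)).
Proof.
have [e0 [e1 [e2 [e3 [q0 q1 q2]]]]] := omega_normal_form.
move=> i v0 v1 v2 v3; rewrite /pfaffian; elim/ord3_ind: i => //.
  by rewrite !q0 !q1; ring.
by rewrite !q0 !q2; ring.
Qed.

End Point.

Section CylinderPoint.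
Context {R : realType} {M : manifold R 7} (I : set R) (oI : open I) (S : sp1sp1 M).
Context (tau a : R).
Local Notation N := (cylinder M oI).
Implicit Types (c : chart N) (y : 'rV[R]_8).

Definition base (y : 'rV[R]_8) : 'rV[R]_7 := @lsubmx R 1 7 1 y.

Lemma base_linear : linear base.
Proof. by move=> k u v; rewrite /base linearP. Qed.

Lemma ucoord_linear : linear (@ucoord R : _ -> R^o).
Proof. by move=> k u v; rewrite /ucoord linearP !mxE. Qed.

Lemma region_cylinder c (W : set (man_space M)) y :
  region c (W `*` I) y <-> region c.1 W (base y) /\ I (ucoord y).
Proof.
split=> [[[p u] [[/= cp _] [Wp Iu]] <-]|[[p [cp Wp] py] Iu]].
  by rewrite /base /ucoord row_mxKl row_mxKr /= mxE; split=> //; exists p.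
exists (p, ucoord y) => //; rewrite -[RHS](@hsubmxK _ 1 7 1 y).
apply: (f_equal2 (@row_mx R 1 7 1)); first exact: py.
transitivity (const_mx (ucoord y) : 'rV[R]_1) => //.
by apply/rowP => i; rewrite ord1 mxE.
Qed.

Lemma region_cylinderT c y :
  region c setT y <-> region c.1 setT (base y) /\ I (ucoord y).
Proof.
rewrite -region_cylinder; split=> -[[p u] [[cp Iu] _] <-]; by exists (p, u).
Qed.

Section Gauge.
Context (j : sp_index S) (c : chart N) (y : 'rV[R]_8).
Hypothesis hy : region c.1 (sp_dom j) (base y).

Let om i v w := ev2 (sp_omega j i c.1 (base y)) (base v) (base w).
Let vf := vertical_form (bcoef tau a (ucoord y))
  (fun s v => ev1 (sp_eta j s c.1 (base y)) (base v)) (@ucoord R).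

Lemma cyl_FE i v w : ev2 (cyl_F tau a j i c y) v w =
  ucoord y * om i v w - eps i * vf i v w.
Proof.
rewrite {1}/ev2 /cyl_F.
rewrite -[LHS]/(ucoord y * pullback (sp_omega j i) c y _
  - (eps i * bcoef tau a (ucoord y)) * wedge _ _ _ - eps i / 6 * wedge _ _ _).
rewrite !wedge11E !(tnth_nth 0) /= /vf /vertical_form /om.
rewrite (_ : pullback _ _ _ _ = ev2 (sp_omega j i c.1 (base y)) (base v) (base w)); last first.
  by rewrite /pullback mform2E !(tnth_nth 0).
by rewrite /ev1 /pullback /du /base; ring.
Qed.

Lemma cyl_F_skew i v w :
  ev2 (cyl_F tau a j i c y) v w = - ev2 (cyl_F tau a j i c y) w v.
Proof.
rewrite !cyl_FE /om (omega_skew hy) /vf /vertical_form; ring.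
Qed.

Lemma cyl_psiE (v : 'I_4 -> 'rV[R]_8) : cyl_psi tau a j c y v =
  \sum_i eps i * (2 * pfaffian (ev2 (cyl_F tau a j i c y)) (v 0) (v 1) (v 2) (v 3)).
Proof.
rewrite -[LHS]/(wedge _ _ _ + wedge _ _ _ - wedge _ _ _) sum3.
rewrite !wedge_square; try exact: cyl_F_skew.
by rewrite /eps /= !mul1r mulN1r.
Qed.

Lemma cyl_psi_triple (v : 'I_4 -> 'rV[R]_8) : cyl_psi tau a j c y v =
  triple_form (ucoord y) om vf (v 0) (v 1) (v 2) (v 3).
Proof.
rewrite cyl_psiE -signed_squares; last exact: vertical_form_conformal.
  apply: eq_bigr => i _; congr (_ * (_ * _)).
  by rewrite /pfaffian !cyl_FE.
by move=> i v0 v1 v2 v3; exact: (omega_conformal hy).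
Qed.

Lemma cyl_metricE v w : ev2 (cyl_metric tau a j c y) v w =
  ucoord y * ev2 (sp_gH S c.1 (base y)) (base v) (base w)
  + bcoef tau a (ucoord y) * (\sum_s ev1 (sp_eta j s c.1 (base y)) (base v) *
                                   ev1 (sp_eta j s c.1 (base y)) (base w))
  + (5 * ucoord y `^ (2 / 3) / (36 * (tau * ucoord y `^ (5 / 3) - a)))
      * (ucoord v * ucoord w).
Proof.
rewrite {1}/ev2 /cyl_metric.
rewrite -[LHS]/(ucoord y * pullback (sp_gH S) c y _ + bcoef tau a (ucoord y) *
  ((\sum_(s < 3) tsquare (pullback (sp_eta j s) c y) : mform R 8 2) _) + _ * tsquare du _).
congr (_ * _ + _ * _ + _ * _).
- by rewrite /pullback mform2E !(tnth_nth 0).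
- rewrite fct_sumE; apply: eq_bigr => s _.
  by rewrite /tsquare !(tnth_nth 0).
Qed.

End Gauge.

Hypotheses (phi_global : globally_defined (@sp_phi R M S))
  (struct_eq : structure_equations S tau).

(** The vertical 2-forms [G_i] transform like the [omega_i], as a rotation
    commutes with the cross product. *)
Lemma cyl_psi_gauge (j j' : sp_index S) (c : chart N) y :
  region c.1 (sp_dom j `&` sp_dom j') (base y) ->
  cyl_psi tau a j c y = cyl_psi tau a j' c y.
Proof.
move=> hy; have hy1 : region c.1 (sp_dom j) (base y) by apply: region_sub hy => p [].
have hy2 : region c.1 (sp_dom j') (base y) by apply: region_sub hy => p [].
have [B [hB1 hB2 BB dB]] := gauge_rotation phi_global struct_eq hy.
apply/funext => v; rewrite (cyl_psi_triple hy1) (cyl_psi_triple hy2).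
apply/esym; apply: (triple_form_rotation (B := B)) => //.
by move=> i v' w'; exact: vertical_form_rotation.
Qed.

Lemma cyl_metric_gauge (j j' : sp_index S) (c : chart N) y :
  region c.1 (sp_dom j `&` sp_dom j') (base y) ->
  cyl_metric tau a j c y = cyl_metric tau a j' c y.
Proof.
by move=> hy; apply/funext => v; rewrite !mform2E !cyl_metricE (sum_eta_sqr _ _ hy).
Qed.

End CylinderPoint.

(** * Smooth adapted coframes *)

Section SmoothTensors.
Context {R : realType} {n : nat} (M : manifold R n).

Lemma tensor2_smooth (g : tensor M 2) (W : set (man_space M)) c
    (U : set 'rV[R]_n) (A B : 'rV[R]_n -> 'rV[R]_n) k :
  is_tensor W g -> open U -> U `<=` region c W ->
  (forall i, Ck_on U k (fun x => A x 0 i : R^o)) ->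
  (forall i, Ck_on U k (fun x => B x 0 i : R^o)) ->
  Ck_on U k (fun x => ev2 (g c x) (A x) (B x) : R^o).
Proof.
move=> [lg sg _] oU UW sA sB.
apply: (eq_Ck_on (f := fun x => \sum_i A x 0 i * \sum_l B x 0 l *
    ev2 (g c x) (delta_mx 0 i) (delta_mx 0 l) : R^o)) => //.
  move=> x Ux; have lx := lg _ _ (UW _ Ux).
  rewrite [A x in RHS]row_sum_delta (linear_combination (ev2_linearl _ lx)); apply: eq_bigr => i _.
  rewrite [B x in RHS]row_sum_delta (linear_combination (ev2_linearr _ lx)).
  by congr (_ * _).
apply: Ck_on_sum => // i; apply: Ck_onM => //.
apply: Ck_on_sum => // l; apply: Ck_onM => //.
exact: (Ck_on_subset UW (sg c (tnth [tuple delta_mx 0 i; delta_mx 0 l]) k)).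
Qed.

End SmoothTensors.

Lemma open_positive (R : realType) (V : normedModType R) (U : set V) (f : V -> R^o) :
  open U -> Ck_on U 0 f -> open [set x | U x /\ 0 < f x].
Proof.
move=> oU cf; rewrite openE => x [Ux fx]; rewrite /interior /=.
near=> y; split; first by near: y; exact: open_nbhs_nbhs.
near: y; have fc : {for x, continuous f} := Ck_on_continuous cf Ux.
exact: (cvgr_gt _ fc _ fx).
Unshelve. all: by end_near. Qed.

Section HorizontalCoframe.
Context {R : realType} {M : manifold R 7} (S : sp1sp1 M).
Context (j : sp_index S) (c : chart M) (x0 : 'rV[R]_7).
Hypothesis hx0 : region c (sp_dom j) x0.

(** For a fixed vector [Z], the field [I_1 Z] is smooth, and horizontal at every
    point because [I_1] takes values in H. Choosing [Z] such that it does not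
    vanish at [x0] and normalizing it gives the field [E] of
    [adapted_coframe]. *)
Lemma smooth_coframe : exists (U : set 'rV[R]_7) (e : 'I_4 -> 'rV[R]_7 -> 'rV[R]_7 -> R),
  [/\ open U, U x0, U `<=` region c (sp_dom j),
      forall i v k, Ck_on U k (fun x => e i x v : R^o) &
   forall x, U x -> let gh := ev2 (sp_gH S c x) in
     let om s := ev2 (sp_omega j s c x) in
     let p i v := e i x v in
    [/\ forall i, linear (p i : _ -> R^o),
       forall v w, gh v w = p 0 v * p 0 w + p 1 v * p 1 w + p 2 v * p 2 w + p 3 v * p 3 w,
       forall v w, om 0 v w = p 0 v * p 1 w - p 1 v * p 0 w + (p 2 v * p 3 w - p 3 v * p 2 w),
       forall v w, om 1 v w = p 0 v * p 2 w - p 2 v * p 0 w - (p 1 v * p 3 w - p 3 v * p 1 w) &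
       forall v w, om 2 v w = p 0 v * p 3 w - p 3 v * p 0 w + (p 1 v * p 2 w - p 2 v * p 1 w)]].
Proof.
have oW : open (region c (sp_dom j)) by apply: region_open; exact: sp_dom_open.
have [X HX X0] := exists_horizontal hx0.
(* This makes [I_1 Z] equal to [X] at [x0]. *)
pose Z := - sp_I j 0 c x0 X.
pose Y x := sp_I j 0 c x Z.
have Yx0 : Y x0 = X.
  by rewrite /Y /Z (linear_opp (I_lin hx0 0)) (sp_I_sqr 0 hx0 HX) opprK.
pose Nm x : R^o := ev2 (sp_gH S c x) (Y x) (Y x).
have sI s v i k : Ck_on (region c (sp_dom j)) k (fun x => sp_I j s c x v 0 i : R^o).
  by apply: Ck_on_coord => //; case: (sp_I_endo j s) => _ /(_ c v k).
have sN k : Ck_on (region c (sp_dom j)) k Nm.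
  apply: (tensor2_smooth (sp_gH_tensor S)) => //.
  - exact: region_sub.
  - by move=> i; exact: sI.
  - by move=> i; exact: sI.
pose U := [set x | region c (sp_dom j) x /\ 0 < Nm x].
have oU : open U by apply: open_positive.
have UW : U `<=` region c (sp_dom j) by move=> x [].
have UT : U `<=` region c setT by apply: subset_trans UW _; exact: region_sub.
pose J (i : 'I_4) x v := nth 0 [:: v; - sp_I j 0 c x v; - sp_I j 1 c x v; - sp_I j 2 c x v] i.
pose e (i : 'I_4) x v := Nm x `^ (- 2^-1) * ev2 (sp_gH S c x) (Y x) (J i x v).
exists U, e; split=> //.
- by split=> //; rewrite /Nm Yx0; exact: (gH_horizontal_gt0 hx0 HX X0).
- move=> i v k; apply: Ck_onM => //.
    by apply: Ck_on_powR => //; [move=> x []|exact: (Ck_on_subset UW (sN k))].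
  apply: (tensor2_smooth (sp_gH_tensor S)) => // l.
    exact: (Ck_on_subset UW (sI 0 Z l k)).
  rewrite /J; case: i => -[|[|[|[|//]]]] i4 /=; first exact: Ck_on_cst.
  1-3: apply: (eq_Ck_on oU _ (Ck_onN oU (Ck_on_subset UW (sI _ v l k)))).
  1-3: by move=> x _; rewrite mxE.
move=> x [hx Nx] gh om p.
pose E := Nm x `^ (- 2^-1) *: Y x.
have HY : sp_H S c x (Y x) by exact: I_H.
have HE' : sp_H S c x E.
  by apply/(horizontalP hx) => s; rewrite (linear_scale (eta_lin hx s)) ((horizontalP hx _).1 HY) scaler0.
have EE : gh E E = 1.
  rewrite /gh (linear_scale (gH_linl hx _)) (linear_scale (gH_linr hx _)) -/(Nm x) /GRing.scale /=.
  rewrite mulrA -powRD; last by rewrite (gt_eqF Nx) implybT.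
  have -> : - 2^-1 + - 2^-1 = -1 :> R by field.
  by rewrite powRN powRr1 ?mulVf ?gt_eqF// ltW.
have pE i v : p i v = gh (nth 0 [:: E; sp_I j 0 c x E; sp_I j 1 c x E; sp_I j 2 c x E] i) v.
  have EN s u : gh (sp_I j s c x E) u = - gh E (sp_I j s c x u) by exact: (I_skew hx).
  have sc u : Nm x `^ (- 2^-1) * ev2 (sp_gH S c x) (Y x) u = gh E u.
    by rewrite /gh /E (linear_scale (gH_linl hx _)).
  have gN u : gh E (- u) = - gh E u by exact: (linear_opp (gH_linr hx _)).
  rewrite /p /e /J sc; case: i => -[|[|[|[|//]]]] i4 //=;
    by rewrite gN EN.
have [gE o0 o1 o2] := adapted_coframe hx HE' EE.
split.
- by move=> i a v w; rewrite !pE /gh (gH_linr hx).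
- by move=> v w; rewrite !pE; exact: gE.
- by move=> v w; rewrite !pE /om omegaE; exact: o0.
- by move=> v w; rewrite !pE /om omegaE; exact: o1.
- by move=> v w; rewrite !pE /om omegaE; exact: o2.
Qed.

End HorizontalCoframe.

Definition dx2 (R : realType) (a b : nat) (v w : 'rV[R]_8) : R :=
  v 0 (inord a) * w 0 (inord b) - w 0 (inord a) * v 0 (inord b).

Arguments dx2 {R} (a b)%_N v w.

Lemma minor_polar (R : realType) a b c d (v : 'I_4 -> 'rV[R]_8) :
  minor [:: a; b; c; d] v = polar (dx2 a b) (dx2 c d) (v 0) (v 1) (v 2) (v 3).
Proof.
have E (i : 'I_4) : v i = nth 0 [:: v 0; v 1; v 2; v 3] i.
  by case: i => -[|[|[|[|//]]]] i4 /=; congr v; apply: val_inj.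
rewrite minor_altsum.
transitivity (altsum 4 (fun w : seq nat =>
    v 0 0 (inord (nth 0%N [:: a; b; c; d] (nth 0%N w 0))) *
   (v 1 0 (inord (nth 0%N [:: a; b; c; d] (nth 0%N w 1))) *
   (v 2 0 (inord (nth 0%N [:: a; b; c; d] (nth 0%N w 2))) *
    v 3 0 (inord (nth 0%N [:: a; b; c; d] (nth 0%N w 3)))))) id).
  apply: eq_altsum => w.
  by rewrite !big_ord_recl big_ord0 mulr1 !(E (lift _ _)) /bump /=.
by rewrite /= /polar /dx2; ring.
Qed.

(** Every monomial is a product of two [dx_a /\ dx_b], and the fourteen of them
    are the terms of [w1 /\ t1 + w2 /\ t2 - w3 /\ t3] and of half the squares of
    [w1] and [t1]. *)
Lemma cayley_pfaffians (R : realType) (v : 'I_4 -> 'rV[R]_8)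
  (w1 := fun x y => dx2 0 1 x y + dx2 2 3 x y) (w2 := fun x y => dx2 0 2 x y - dx2 1 3 x y)
  (w3 := fun x y => dx2 0 3 x y + dx2 1 2 x y) (t1 := fun x y => dx2 4 5 x y + dx2 6 7 x y)
  (t2 := fun x y => dx2 4 6 x y - dx2 5 7 x y) (t3 := fun x y => dx2 4 7 x y + dx2 5 6 x y) :
  cayley v = pfaffian w1 (v 0) (v 1) (v 2) (v 3) + polar w1 t1 (v 0) (v 1) (v 2) (v 3)
   + polar w2 t2 (v 0) (v 1) (v 2) (v 3) - polar w3 t3 (v 0) (v 1) (v 2) (v 3)
   + pfaffian t1 (v 0) (v 1) (v 2) (v 3).
Proof.
have pl a b : pfaffian (@dx2 R a b) (v 0) (v 1) (v 2) (v 3) = 0.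
  by rewrite /pfaffian /dx2; ring.
have pf (F G : 'rV[R]_8 -> 'rV[R]_8 -> R) v0 v1 v2 v3 :
    pfaffian (fun x y => F x y + G x y) v0 v1 v2 v3 =
    pfaffian F v0 v1 v2 v3 + pfaffian G v0 v1 v2 v3 + polar F G v0 v1 v2 v3.
  by rewrite /pfaffian /polar; ring.
rewrite cayley_minors !big_cons big_nil !minor_polar /w1 /t1.
rewrite (pf (dx2 0 1) (dx2 2 3)) (pf (dx2 4 5) (dx2 6 7)) !pl /=.
by rewrite /polar /w2 /w3 /t2 /t3; ring.
Qed.

Section CylinderCoframe.
Context {R : realType} {M : manifold R 7} (I : set R) (oI : open I) (S : sp1sp1 M).
Context (tau a : R).
Local Notation N := (cylinder M oI).
Hypothesis I_pos : forall u, I u -> 0 < u /\ 0 < tau * u `^ (5 / 3) - a.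

Lemma bcoef_gt0 u : I u -> 0 < bcoef tau a u.
Proof. by move=> /I_pos[u0 ta0]; rewrite divr_gt0// mulr_gt0// powR_gt0. Qed.

Lemma base_continuous : continuous (@base R).
Proof. exact: (@lsubmx_continuous R 7 1). Qed.

Lemma ucoord_smooth (U : set 'rV[R]_8) k : open U -> Ck_on U k (@ucoord R : _ -> R^o).
Proof.
move=> oU.
have -> : @ucoord R = (fun y : 'rV[R]_8 => y 0 ord_max).
  apply/funext => y; rewrite /ucoord mxE.
  by congr (y 0 _); apply: val_inj.
exact: (Ck_on_coord _ _ oU (smooth_on_id U k)).
Qed.

Lemma bcoef_smooth (U : set 'rV[R]_8) k : open U -> (forall y, U y -> I (ucoord y)) ->
  Ck_on U k (fun y => bcoef tau a (ucoord y) : R^o).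
Proof.
move=> oU UI; have u0 y : U y -> 0 < ucoord y by move=> /UI/I_pos[].
have sp p : Ck_on U k (fun y => ucoord y `^ p : R^o).
  by apply: Ck_on_powR => //; exact: ucoord_smooth.
apply: Ck_onM => //.
  by apply: Ck_onB => //; [exact: Ck_onZ|exact: Ck_on_cst].
apply: Ck_on_inv => // [y Uy|]; last exact: Ck_onZ.
by rewrite mulr_gt0// powR_gt0// u0.
Qed.

(** In the coframe [s p_0, .., s p_3, f, r q_1, r q_2, - r q_3] the 2-forms
    [w_i] of [cayley_pfaffians] are the [s^2 A_i], and the [t_i] are the [G_i] up
    to sign. *)
Lemma cayley_standard (A : 'I_3 -> 'rV[R]_8 -> 'rV[R]_8 -> R) (p : 'I_4 -> 'rV[R]_8 -> R)
    (q : 'I_3 -> 'rV[R]_8 -> R) (t f : 'rV[R]_8 -> R) (s r : R) (P : 'M[R]_8) :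
  (forall v w, A 0 v w = p 0 v * p 1 w - p 1 v * p 0 w + (p 2 v * p 3 w - p 3 v * p 2 w)) ->
  (forall v w, A 1 v w = p 0 v * p 2 w - p 2 v * p 0 w - (p 1 v * p 3 w - p 3 v * p 1 w)) ->
  (forall v w, A 2 v w = p 0 v * p 3 w - p 3 v * p 0 w + (p 1 v * p 2 w - p 2 v * p 1 w)) ->
  conformal_triple A ->
  (forall v, t v = 6 * r * f v) ->
  (forall v i, (v *m P) 0 i = nth 0 [:: s * p 0 v; s * p 1 v; s * p 2 v; s * p 3 v;
      f v; r * q 0 v; r * q 1 v; - (r * q 2 v)] i) ->
  forall v : 'I_4 -> 'rV[R]_8,
  triple_form (s ^+ 2) A (vertical_form (r ^+ 2) q t) (v 0) (v 1) (v 2) (v 3) =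
  2 * cayley (fun i => v i *m P).
Proof.
move=> A0 A1 A2 cA tE PE v.
have PE' w k : (k < 8)%N -> (w *m P) 0 (inord k) =
    nth 0 [:: s * p 0 w; s * p 1 w; s * p 2 w; s * p 3 w;
      f w; r * q 0 w; r * q 1 w; - (r * q 2 w)] k.
  by move=> k8; rewrite PE inordK.
pose G := vertical_form (r ^+ 2) q t.
have w1E x y : dx2 0 1 (x *m P) (y *m P) + dx2 2 3 (x *m P) (y *m P) = s ^+ 2 * A 0 x y.
  by rewrite /dx2 !PE'// A0 /=; ring.
have w2E x y : dx2 0 2 (x *m P) (y *m P) - dx2 1 3 (x *m P) (y *m P) = s ^+ 2 * A 1 x y.
  by rewrite /dx2 !PE'// A1 /=; ring.
have w3E x y : dx2 0 3 (x *m P) (y *m P) + dx2 1 2 (x *m P) (y *m P) = s ^+ 2 * A 2 x y.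
  by rewrite /dx2 !PE'// A2 /=; ring.
have t1E x y : dx2 4 5 (x *m P) (y *m P) + dx2 6 7 (x *m P) (y *m P) = - G 0 x y.
  by rewrite /dx2 !PE'// /G /vertical_form !ord3_add !tE /=; field.
have t2E x y : dx2 4 6 (x *m P) (y *m P) - dx2 5 7 (x *m P) (y *m P) = - G 1 x y.
  by rewrite /dx2 !PE'// /G /vertical_form !ord3_add !tE /=; field.
have t3E x y : dx2 4 7 (x *m P) (y *m P) + dx2 5 6 (x *m P) (y *m P) = G 2 x y.
  by rewrite /dx2 !PE'// /G /vertical_form !ord3_add !tE /=; field.
rewrite /triple_form !sum3 (cA 1) (cA 2).
rewrite !(vertical_form_conformal _ _ _ 1) !(vertical_form_conformal _ _ _ 2) -/G.
rewrite cayley_pfaffians /pfaffian /polar !w1E !w2E !w3E !t1E !t2E !t3E.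
by field.
Qed.

(** The coframe consists of [sqrt u] times the horizontal one, of [du] divided by
    [6 sqrt b], and of [sqrt b] times the [eta_s], where the sign of the last one
    turns the orientation of the triple into that of the Cayley form. *)
Lemma local_coframe (j : sp_index S) (c : chart N) y0 :
  region c (sp_dom j `*` I) y0 ->
  exists (U : set 'rV[R]_8) (P : 'rV[R]_8 -> 'M[R]_8),
  [/\ open U, U y0, U `<=` region c (sp_dom j `*` I),
      forall i l k, Ck_on U k (fun y => P y i l : R^o) &
   forall y, U y ->
    [/\ forall v w, ev2 (cyl_metric tau a j c y) v w =
          \sum_i (v *m P y) 0 i * (w *m P y) 0 i,
       forall v, cyl_psi tau a j c y v = 2 * cayley (fun i => v i *m P y) &
       P y \in unitmx]].
Proof.
move=> /region_cylinder[hx0 Iu0].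
have [U7 [e [oU7 U7x U7W es ep]]] := smooth_coframe hx0.
pose U := [set y : 'rV[R]_8 | U7 (base y) /\ I (ucoord y)].
have oU : open U.
  apply: openI; first by apply: open_comp => // y _; exact: base_continuous.
  apply: open_comp => // y _.
  exact: (Ck_on_continuous (ucoord_smooth 0 openT)).
pose bb y := bcoef tau a (ucoord y).
pose s y : R := ucoord y `^ 2^-1.
pose r y : R := bb y `^ 2^-1.
have u0 y : U y -> 0 < ucoord y by move=> [_ /I_pos[]].
have b0 y : U y -> 0 < bb y by move=> [_ /bcoef_gt0].
have sq (z : R) : 0 < z -> (z `^ 2^-1) ^+ 2 = z.
  move=> z0; rewrite -powR_mulrn ?powR_ge0// -powRrM.
  by rewrite mulVf// powRr1// ltW.
pose eta y q v := ev1 (sp_eta j q c.1 (base y)) (base v).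
pose th y (v : 'rV[R]_8) : seq R :=
  [:: s y * e 0 (base y) (base v); s y * e 1 (base y) (base v);
      s y * e 2 (base y) (base v); s y * e 3 (base y) (base v);
      (6 * r y)^-1 * ucoord v; r y * eta y 0 v; r y * eta y 1 v;
      - (r y * eta y 2 v)].
pose P y : 'M[R]_8 := \matrix_(k, i) nth 0 (th y (delta_mx 0 k)) i.
have UW y : U y -> region c.1 (sp_dom j) (base y) by move=> [/U7W].
have PE y (v : 'rV[R]_8) i : U y -> (v *m P y) 0 i = nth 0 (th y v) i.
  move=> Uy; have [el _ _ _ _] := ep _ Uy.1.
  have L : linear (fun v => nth 0 (th y v) i : R^o).
    have bl k (x w : 'rV[R]_8) : base (k *: x + w) = k *: base x + base w by exact: base_linear.
    have etal q k x w : eta y q (k *: x + w) = k * eta y q x + eta y q w.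
      by rewrite /eta bl (eta_lin (UW y Uy)).
    have el' q k x w : e q (base y) (base (k *: x + w)) =
        k * e q (base y) (base x) + e q (base y) (base w) by rewrite bl el.
    have ul k (x w : 'rV[R]_8) : ucoord (k *: x + w) = k * ucoord x + ucoord w.
      exact: ucoord_linear.
    move=> k x w; rewrite /th /GRing.scale /= !etal !el' ul.
    by case: i => -[|[|[|[|[|[|[|[|//]]]]]]]] i8 /=; ring.
  rewrite [v in RHS]row_sum_delta (linear_combination L) mxE.
  by apply: eq_bigr => k _; rewrite mxE.
have r0 y : U y -> r y != 0 by move=> Uy; rewrite gt_eqF// powR_gt0// b0.
have cbE y : U y -> 5 * ucoord y `^ (2 / 3) / (36 * (tau * ucoord y `^ (5 / 3) - a)) =
    ((6 * r y)^-1) ^+ 2.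
  move=> Uy; rewrite exprVn exprMn sq ?b0// /bb /bcoef.
  have t0 : tau * ucoord y `^ (5 / 3) - a != 0 by rewrite gt_eqF//; case: (I_pos Uy.2).
  have p0 : ucoord y `^ (2 / 3) != 0 by rewrite gt_eqF// powR_gt0// u0.
  by field; rewrite p0 t0.
have gE y v w : U y -> ev2 (cyl_metric tau a j c y) v w =
    \sum_i (v *m P y) 0 i * (w *m P y) 0 i.
  move=> Uy; have [_ ghE _ _ _] := ep _ Uy.1.
  rewrite cyl_metricE ghE sum3 cbE// -/(bb y) -[in LHS](sq _ (b0 _ Uy)) -/(r y).
  rewrite -[X in X * (_ + _ + _ + _)](sq _ (u0 _ Uy)) -/(s y).
  by rewrite !big_ord_recl big_ord0 !PE//= /eta; ring.
exists U, P; split=> //.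
- by move=> y Uy; apply/region_cylinder; split; [exact: UW|exact: Uy.2].
- move=> i l k.
  apply: (eq_Ck_on (f := fun y => nth 0 (th y (delta_mx 0 i)) l : R^o)) => //.
    by move=> y _; rewrite mxE.
  have ss : Ck_on U k (fun y => s y : R^o).
    by apply: Ck_on_powR => //; exact: ucoord_smooth.
  have sr : Ck_on U k (fun y => r y : R^o).
    by apply: Ck_on_powR => //; apply: bcoef_smooth => // y [].
  have se q v : Ck_on U k (fun y => e q (base y) v : R^o).
    apply: (@Ck_on_subset _ _ _ (@base R @^-1` U7)) => [y []//|].
    exact: (Ck_on_complin base_linear base_continuous (es q v k)).
  have sh q v : Ck_on U k (fun y => ev1 (sp_eta j q c.1 (base y)) v : R^o).
    apply: (@Ck_on_subset _ _ _ (@base R @^-1` region c.1 (sp_dom j))) => [y /UW//|].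
    exact: (Ck_on_complin base_linear base_continuous (eta_smooth c.1 j q v k)).
  case: l => -[|[|[|[|[|[|[|[|//]]]]]]]] l8; rewrite /th /=.
  1-4: by apply: Ck_onM => //; exact: se.
  2-3: by apply: Ck_onM => //; exact: sh.
  2: by apply: Ck_onN => //; apply: Ck_onM => //; exact: sh.
  apply: Ck_onM => //; last exact: Ck_on_cst.
  by apply: Ck_on_inv => // [y Uy|]; [rewrite mulr_gt0// powR_gt0// b0|exact: Ck_onZ].
move=> y Uy; split.
- by move=> v w; exact: gE.
- move=> v; have [_ _ o0 o1 o2] := ep _ Uy.1.
  rewrite (cyl_psi_triple _ _ (UW y Uy)) -/(bb y) -[bb y](sq _ (b0 _ Uy)) -/(r y).
  rewrite -[X in triple_form X _ _](sq _ (u0 _ Uy)) -/(s y).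
  apply: (cayley_standard (p := fun i v => e i (base y) (base v))
    (f := fun v => (6 * r y)^-1 * ucoord v)).
  + by move=> v' w'; rewrite o0.
  + by move=> v' w'; rewrite o1.
  + by move=> v' w'; rewrite o2.
  + by move=> i v0 v1 v2 v3; exact: (omega_conformal (UW y Uy)).
  + by move=> v'; rewrite mulrA mulfV ?mul1r// mulf_neq0// r0.
  by move=> v' i; rewrite PE.
rewrite -row_free_unit -kermx_eq0; apply/rowV0P => v /sub_kermxP vP.
have g0 : ev2 (cyl_metric tau a j c y) v v = 0.
  by rewrite gE// big1// => i _; rewrite vP mxE mul0r.
have hx := UW y Uy.
move: g0; rewrite cyl_metricE cbE//.
set A := ucoord y * _; set B := bcoef _ _ _ * _; set C := _ * (ucoord v * _) => g0.
have A0 : 0 <= A by rewrite mulr_ge0 ?(gH_ge0 hx)// ltW// u0.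
have S0 : 0 <= \sum_q ev1 (sp_eta j q c.1 (base y)) (base v) *
                      ev1 (sp_eta j q c.1 (base y)) (base v).
  by rewrite sumr_ge0// => q _; rewrite -expr2 sqr_ge0.
have B0 : 0 <= B by rewrite mulr_ge0// ltW// b0.
have C0 : 0 <= C by rewrite mulr_ge0 ?sqr_ge0// -expr2 sqr_ge0.
have /eqP : A = 0 by lra.
rewrite mulf_eq0 gt_eqF ?u0//= => /eqP gh0.
have /eqP : B = 0 by lra.
rewrite mulf_eq0 gt_eqF ?b0//= => /eqP sum0.
have /eqP : C = 0 by lra.
rewrite mulf_eq0 sqrf_eq0 invr_eq0 mulf_eq0 (negbTE (r0 _ Uy)) orbF pnatr_eq0 /=.
rewrite -expr2 sqrf_eq0 => /eqP t0.
have bv0 : base v = 0.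
  apply/eqP/negPn/negP => /(metric_pos hx).
  by rewrite (metric_split hx) gh0 sum0 addr0 ltxx.
rewrite -[v](@hsubmxK _ 1 7 1) -[lsubmx _]/(base v) bv0.
rewrite (_ : rsubmx _ = 0) ?row_mx0//.
by apply/rowP => i; rewrite ord1 [RHS]mxE.
Qed.

End CylinderCoframe.

(** * The 4-form is closed *)

Section ExteriorAlgebra.
Context {R : realType} {V : Type}.
Implicit Types (t e : V -> R) (F G : V -> V -> R) (T : V -> V -> V -> R).

Definition wedge1 e F (a b c : V) : R := e a * F b c - e b * F a c + e c * F a b.

(** The wedge product of a 3-form and a 2-form, as a sum over shuffles. *)
Definition wedge3 T F (v0 v1 v2 v3 v4 : V) : R :=
  T v0 v1 v2 * F v3 v4 - T v0 v1 v3 * F v2 v4 + T v0 v1 v4 * F v2 v3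
  + T v0 v2 v3 * F v1 v4 - T v0 v2 v4 * F v1 v3 + T v0 v3 v4 * F v1 v2
  - T v1 v2 v3 * F v0 v4 + T v1 v2 v4 * F v0 v3 - T v1 v3 v4 * F v0 v2
  + T v2 v3 v4 * F v0 v1.

End ExteriorAlgebra.

Section ClosedIdentity.
Context {R : realType} {n : nat}.
Local Notation V := 'rV[R]_n.
Context (om : 'I_3 -> V -> V -> R) (eta : 'I_3 -> V -> R) (t : V -> R).
Context (u c tau : R).

Let deta i v w := 2 * om i v w +
  2 * tau * (eta (i + 1) v * eta (i + 2) w - eta (i + 1) w * eta (i + 2) v).
Let ee i v w := eta (i + 1) v * eta (i + 2) w - eta (i + 1) w * eta (i + 2) v.
Let dee i x y z := wedge1 (eta (i + 2)) (deta (i + 1)) x y z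
                   - wedge1 (eta (i + 1)) (deta (i + 2)) x y z.
Let et i v w := eta i v * t w - eta i w * t v.

(** The sum of the [eps_i dF_i /\ F_i], where [b = u c] and [(tau - 2 c) / 3] is
    the derivative of [b]. Modulo the products [omega_i /\ omega_j], the terms in
    [omega_i /\ omega_i /\ du] have coefficients proportional to the
    [u (eps_i - 1 / 3)], whose sum is zero, and the coefficient of
    [omega_i /\ eta_j /\ eta_k /\ du] is proportional to
    [(tau u - 2 b) / 3 - u b'], which vanishes as well. *)
Lemma closed_identity (v0 v1 v2 v3 v4 : V) : conformal_triple om ->
  (forall x y z w, polar (om 0) (om 1) x y z w = 0) ->
  (forall x y z w, polar (om 0) (om 2) x y z w = 0) ->
  (forall x y z w, polar (om 1) (om 2) x y z w = 0) ->
  \sum_i eps i * wedge3 (fun x y z => wedge1 t (om i) x y z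
      - (u * tau + eps i * (u * c)) * dee i x y z
      - eps i * ((tau - 2 * c) / 3) * wedge1 t (ee i) x y z
      - eps i / 6 * wedge1 t (deta i) x y z)
    (fun v w => u * om i v w - eps i * vertical_form (u * c) eta t i v w)
    v0 v1 v2 v3 v4 = 0.
Proof.
move=> cf h01 h02 h12.
pose alt (e : V -> R) (Q : V -> V -> V -> V -> R) :=
  e v0 * Q v1 v2 v3 v4 - e v1 * Q v0 v2 v3 v4 + e v2 * Q v0 v1 v3 v4
  - e v3 * Q v0 v1 v2 v4 + e v4 * Q v0 v1 v2 v3.
(* The terms that contain products of two [omega]; all others cancel. *)
transitivity (u * alt t (fun x y z w => 4 / 3 * pfaffian (om 0) x y z w
    + 4 / 3 * pfaffian (om 1) x y z w - 8 / 3 * pfaffian (om 2) x y z w)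
  - 4 * u ^+ 2 * tau * alt (eta 0) (polar (om 1) (om 2))
  + 4 * u ^+ 2 * tau * alt (eta 1) (polar (om 0) (om 2))); last first.
  by rewrite /alt !h12 !h02 !(cf 1) !(cf 2); field.
rewrite sum3 /eps /= /dee /wedge3 /wedge1 /deta /ee /vertical_form !ord3_add /alt /pfaffian /polar.
by field.
Qed.

End ClosedIdentity.

Section OmegaOrthogonal.
Context {R : realType} {M : manifold R 7} (S : sp1sp1 M).
Context (j : sp_index S) (c : chart M) (x : 'rV[R]_7).
Hypothesis hx : region c (sp_dom j) x.

Lemma omega_orthogonal (om := fun s => ev2 (sp_omega j s c x)) v0 v1 v2 v3 :
  [/\ polar (om 0) (om 1) v0 v1 v2 v3 = 0, polar (om 0) (om 2) v0 v1 v2 v3 = 0 &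
      polar (om 1) (om 2) v0 v1 v2 v3 = 0].
Proof.
have [e0 [e1 [e2 [e3 [q0 q1 q2]]]]] := omega_normal_form hx.
by rewrite /om /polar; split; rewrite ?q0 ?q1 ?q2; ring.
Qed.

Lemma omega_smooth s v w k :
  Ck_on (region c (sp_dom j)) k (fun x => ev2 (sp_omega j s c x) v w : R^o).
Proof.
have oW : open (region c (sp_dom j)) by apply: region_open; exact: sp_dom_open.
have := tensor2_smooth (c := c) (U := region c (sp_dom j))
  (A := fun x => sp_I j s c x v) (B := fun=> w) (k := k) (sp_gH_tensor S) oW.
have -> : (fun x => ev2 (sp_omega j s c x) v w : R^o) =
  (fun x => ev2 (sp_gH S c x) (sp_I j s c x v) w : R^o).
  by apply/funext => z; rewrite omegaE.
apply.
- exact: region_sub.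
- move=> i; apply: Ck_on_coord => //.
  by case: (sp_I_endo j s) => _ /(_ c v k).
- by move=> i; exact: Ck_on_cst.
Qed.

End OmegaOrthogonal.

(** The second derivatives [D] are symmetric in their first two arguments and
    drop out; what remains is [- tau] times the derivative of a product. *)
Lemma alternated_second_derivatives (R : realType) (V : Type) (tau : R)
    (e1 e2 : V -> R) (D1 D2 : V -> V -> R) (D : V -> V -> V -> R) (v0 v1 v2 : V)
  (d := fun z v w => 2^-1 * (D z v w - D z w v)
    - tau * (e1 v * D2 w z + e2 w * D1 v z - (e1 w * D2 v z + e2 v * D1 w z))) :
  (forall z v w, D z v w = D v z w) ->
  d v0 v1 v2 - d v1 v0 v2 + d v2 v0 v1 =
  - tau * (wedge1 e2 (fun v w => D1 w v - D1 v w) v0 v1 v2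
           - wedge1 e1 (fun v w => D2 w v - D2 v w) v0 v1 v2).
Proof.
by move=> sD; rewrite /d (sD v1 v0) (sD v2 v0) (sD v2 v1) /wedge1; field.
Qed.

Section DerivativeOmega.
Context {R : realType} {M : manifold R 7} (S : sp1sp1 M) (tau : R).
Hypothesis struct_eq : structure_equations S tau.
Context (j : sp_index S) (c : chart M) (x : 'rV[R]_7).
Hypothesis hx : region c (sp_dom j) x.

Let W := region c (sp_dom j).
Let oW : open W. Proof. by apply: region_open; exact: sp_dom_open. Qed.
Let eta s v y : R^o := ev1 (sp_eta j s c y) v.
Let om s v w y : R^o := ev2 (sp_omega j s c y) v w.
Let deta s v w := 2 * om s v w x + 2 * tau *
   (eta (s + 1) v x * eta (s + 2) w x - eta (s + 1) w x * eta (s + 2) v x).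

Let is_derive_eta s v z : is_derive x z (eta s v) ('D_z (eta s v) x).
Proof. exact: (Ck_on_is_derive _ (eta_smooth c j s v 1) hx). Qed.

Lemma is_derive_eta_eta s v w z :
  is_derive x z (fun y => eta (s + 1) v y * eta (s + 2) w y - eta (s + 1) w y * eta (s + 2) v y : R^o)
  (eta (s + 1) v x * 'D_z (eta (s + 2) w) x + eta (s + 2) w x * 'D_z (eta (s + 1) v) x
   - (eta (s + 1) w x * 'D_z (eta (s + 2) v) x + eta (s + 2) v x * 'D_z (eta (s + 1) w) x)).
Proof.
exact: is_deriveB (is_deriveM (is_derive_eta (s + 1) v z) (is_derive_eta (s + 2) w z))
  (is_deriveM (is_derive_eta (s + 1) w z) (is_derive_eta (s + 2) v z)).
Qed.

(** The structure equation expresses [omega_s] by [d eta_s] and the product of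
    the two other 1-forms, and [d (d eta_s) = 0]. *)
Lemma domega s v0 v1 v2 :
  'D_v0 (om s v1 v2) x - 'D_v1 (om s v0 v2) x + 'D_v2 (om s v0 v1) x =
  - tau * (wedge1 (fun v => eta (s + 2) v x) (deta (s + 1)) v0 v1 v2
           - wedge1 (fun v => eta (s + 1) v x) (deta (s + 2)) v0 v1 v2).
Proof.
have dd v w z : 'D_z (om s v w) x = 2^-1 * ('D_z ('D_v (eta s w)) x - 'D_z ('D_w (eta s v)) x)
  - tau * (eta (s + 1) v x * 'D_z (eta (s + 2) w) x + eta (s + 2) w x * 'D_z (eta (s + 1) v) x
   - (eta (s + 1) w x * 'D_z (eta (s + 2) v) x + eta (s + 2) v x * 'D_z (eta (s + 1) w) x)).
  have E : {near x, om s v w =1 (fun y : 'rV[R]_7 => 2^-1 *: ('D_v (eta s w) y - 'D_w (eta s v) y : R^o)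
     - tau *: (eta (s + 1) v y * eta (s + 2) w y - eta (s + 1) w y * eta (s + 2) v y : R^o) : R^o)}.
    near=> y.
    have hy : W y by near: y; exact: open_nbhs_nbhs.
    rewrite /eta (deta_omega struct_eq hy) /om /GRing.scale /=; by field.
  rewrite (near_eq_derive _ E).
  have dE v' w' : is_derive x z ('D_v' (eta s w')) ('D_z ('D_v' (eta s w')) x).
    exact: (Ck_on_is_derive _ (Ck_on_derive v' (eta_smooth c j s w' 2)) hx).
  have [_ ->] := is_deriveB (is_deriveZ 2^-1 (is_deriveB (dE v w) (dE w v)))
                            (is_deriveZ tau (is_derive_eta_eta s v w z)).
  by [].
have DD v w q : 'D_v ('D_w (eta s q)) x = 'D_w ('D_v (eta s q)) x.
  exact: (derive_comm _ _ oW hx (eta_smooth c j s q 2)).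
have de i v w : deta i v w = 'D_v (eta i w) x - 'D_w (eta i v) x.
  by rewrite /eta (deta_omega struct_eq hx).
have dfE i : deta i = (fun v w => 'D_v (eta i w) x - 'D_w (eta i v) x).
  by apply/funext => v; apply/funext => w.
rewrite !dd !dfE.
exact: (@alternated_second_derivatives _ _ tau (fun v => eta (s + 1) v x)
  (fun v => eta (s + 2) v x) (fun v z => 'D_z (eta (s + 1) v) x)
  (fun v z => 'D_z (eta (s + 2) v) x) (fun z v w => 'D_z ('D_v (eta s w)) x)).
Unshelve. all: by end_near. Qed.

End DerivativeOmega.

Section Alternation.
Context {R : realType} {n : nat}.
Local Notation V := 'rV[R]_n.
Implicit Types (F : V -> V -> R) (D : V -> V -> V -> R).

Definition alternate D (a b c : V) : R := D a b c - D b a c + D c a b.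

Lemma alternated_polar D F v0 v1 v2 v3 v4 :
  polar (D v0) F v1 v2 v3 v4 - polar (D v1) F v0 v2 v3 v4 + polar (D v2) F v0 v1 v3 v4
  - polar (D v3) F v0 v1 v2 v4 + polar (D v4) F v0 v1 v2 v3 =
  wedge3 (alternate D) F v0 v1 v2 v3 v4.
Proof. by rewrite /wedge3 /alternate /polar; ring. Qed.

(** The derivative of [F = u om - e G], where [d om = - tau d (e1 /\ e2)] combines
    with the term [- e b d (e1 /\ e2)] of the derivative of [e G]. *)
Lemma alternated_derivative (t e0 e1 e2 : V -> R) (D0 D1 D2 : V -> V -> R)
    (om : V -> V -> R) (dom : V -> V -> V -> R) (u b b' e tau : R) (v0 v1 v2 : V)
    (d0 := fun v w => D0 w v - D0 v w)
    (dee := fun a b c => wedge1 e2 (fun v w => D1 w v - D1 v w) a b c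
                         - wedge1 e1 (fun v w => D2 w v - D2 v w) a b c) :
  alternate dom v0 v1 v2 = - tau * dee v0 v1 v2 ->
  alternate (fun z v w => t z * om v w + u * dom z v w
    - e * (b' * t z * (e1 v * e2 w - e1 w * e2 v)
           + b * (e1 v * D2 w z + e2 w * D1 v z - (e1 w * D2 v z + e2 v * D1 w z))
           + 6^-1 * (D0 v z * t w - D0 w z * t v))) v0 v1 v2 =
  wedge1 t om v0 v1 v2 - (u * tau + e * b) * dee v0 v1 v2
  - e * b' * wedge1 t (fun v w => e1 v * e2 w - e1 w * e2 v) v0 v1 v2
  - e / 6 * wedge1 t d0 v0 v1 v2.
Proof.
move=> h; rewrite mulrDl [u * tau * _](_ : _ = - (u * alternate dom v0 v1 v2)).
  by rewrite /alternate /dee /d0 /wedge1; field.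
by rewrite h; ring.
Qed.

End Alternation.

Section Closed.
Context {R : realType} {M : manifold R 7} (I : set R) (oI : open I) (S : sp1sp1 M).
Context (tau a : R).
Local Notation N := (cylinder M oI).
Hypothesis I_pos : forall u, I u -> 0 < u /\ 0 < tau * u `^ (5 / 3) - a.
Hypothesis struct_eq : structure_equations S tau.
Context (j : sp_index S) (c : chart N) (y : 'rV[R]_8).
Hypotheses (hx : region c.1 (sp_dom j) (base y)) (Iu : I (ucoord y)).

Lemma is_derive_ucoord z : is_derive y z (@ucoord R : _ -> R^o) (ucoord z).
Proof.
by apply: (@is_derive_complin _ _ _ _ (@ucoord_linear R) _ (id : R^o -> R^o)).
Qed.

(** The differential equation [(u b)' = (tau u + b) / 3] satisfied by [b]. *)
Lemma is_derive_bcoef z : is_derive y z (fun y => bcoef tau a (ucoord y) : R^o)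
  ((tau - 2 * (bcoef tau a (ucoord y) / ucoord y)) / 3 * ucoord z).
Proof.
have [u0 _] := I_pos Iu.
apply: (is_derive_comp_scalar (is_derive_ucoord z)).
set u := ucoord y in u0 *.
have dp (p : R) : is_derive u (1 : R) (fun v : R => v `^ p : R^o) (p * u `^ (p - 1)).
  exact: is_derive1_powR.
have pn0 : 5 * u `^ (2 / 3) != 0 by rewrite mulf_neq0// gt_eqF// powR_gt0.
have := is_deriveM (is_deriveB (is_deriveZ tau (dp (5 / 3))) (is_derive_cst (a : R^o) u 1))
  (is_deriveV (f := fun v : R => 5 * v `^ (2 / 3)) pn0 (is_deriveZ 5 (dp (2 / 3)))).
move=> H; apply: (is_derive_eq H).
rewrite -[LHS]/((tau * u `^ (5 / 3) - a) * (- (5 * u `^ (2 / 3)) ^- 2 *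
    (5 * (2 / 3 * u `^ (2 / 3 - 1)))) +
  (5 * u `^ (2 / 3))^-1 * (tau * (5 / 3 * u `^ (5 / 3 - 1)) - 0)) /bcoef.
have -> : u `^ (5 / 3 - 1) = u `^ (2 / 3) by congr (_ `^ _); field.
have -> : u `^ (5 / 3) = u * u `^ (2 / 3).
  by rewrite -{2}[u]powRr1 ?ltW// -powRD ?(gt_eqF u0) ?implybT//; congr (_ `^ _); field.
have -> : u `^ (2 / 3 - 1) = u `^ (2 / 3) / u.
  by rewrite powRB ?(gt_eqF u0) ?implybT// powRr1// ltW.
have p0 : u `^ (2 / 3) != 0 by rewrite gt_eqF// powR_gt0.
have un0 : u != 0 by rewrite gt_eqF.
by move: (u `^ (2 / 3)) p0 => p p0; field; rewrite p0 un0.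
Qed.

Let u := ucoord y.
Let b := bcoef tau a u.
Let t : 'rV[R]_8 -> R := @ucoord R.
Let om s (v w : 'rV[R]_8) := ev2 (sp_omega j s c.1 (base y)) (base v) (base w).
Let eta s (v : 'rV[R]_8) := ev1 (sp_eta j s c.1 (base y)) (base v).
Let dom s (z v w : 'rV[R]_8) : R :=
  'D_(base z) (fun x => ev2 (sp_omega j s c.1 x) (base v) (base w) : R^o) (base y).
Let D s (v z : 'rV[R]_8) : R :=
  'D_(base z) (fun x => ev1 (sp_eta j s c.1 x) (base v) : R^o) (base y).
Let F s v w := ev2 (cyl_F tau a j s c y) v w.
Let dF s z v w : R := t z * om s v w + u * dom s z v w
  - eps s * ((tau - 2 * (b / u)) / 3 * t z *
               (eta (s + 1) v * eta (s + 2) w - eta (s + 1) w * eta (s + 2) v)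
           + b * (eta (s + 1) v * D (s + 2) w z + eta (s + 2) w * D (s + 1) v z
                  - (eta (s + 1) w * D (s + 2) v z + eta (s + 2) v * D (s + 1) w z))
           + 6^-1 * (D s v z * t w - D s w z * t v)).

Lemma is_derive_omega s v w z : is_derive y z
  (fun y => ev2 (sp_omega j s c.1 (base y)) (base v) (base w) : R^o) (dom s z v w).
Proof.
apply: (is_derive_complin (@base_linear R)
  (h := fun x => ev2 (sp_omega j s c.1 x) (base v) (base w) : R^o)).
exact: (Ck_on_is_derive _ (@omega_smooth _ _ S j c.1 s (base v) (base w) 1) hx).
Qed.

Lemma is_derive_eta s v z : is_derive y z
  (fun y => ev1 (sp_eta j s c.1 (base y)) (base v) : R^o) (D s v z).
Proof.
apply: (is_derive_complin (@base_linear R)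
  (h := fun x => ev1 (sp_eta j s c.1 x) (base v) : R^o)).
exact: (Ck_on_is_derive _ (eta_smooth c.1 j s (base v) 1) hx).
Qed.

Lemma is_derive_F s v w z :
  is_derive y z (fun y => ev2 (cyl_F tau a j s c y) v w : R^o) (dF s z v w).
Proof.
pose e k q : 'rV[R]_8 -> R^o := fun y => ev1 (sp_eta j k c.1 (base y)) (base q).
pose ub : 'rV[R]_8 -> R^o := @ucoord R.
pose bb : 'rV[R]_8 -> R^o := fun y => bcoef tau a (ucoord y).
pose o : 'rV[R]_8 -> R^o := fun y => ev2 (sp_omega j s c.1 (base y)) (base v) (base w).
have -> : (fun y => ev2 (cyl_F tau a j s c y) v w : R^o) =
  ub * o - (eps s : R) *: (bb * (e (s + 1) v * e (s + 2) w - e (s + 1) w * e (s + 2) v)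
     + (6^-1 : R) *: (t w *: e s v - t v *: e s w)).
  apply/funext => y'; rewrite cyl_FE /vertical_form.
  rewrite -[RHS]/(ucoord y' * o y' - eps s * (bcoef tau a (ucoord y') *
    (e (s + 1) v y' * e (s + 2) w y' - e (s + 1) w y' * e (s + 2) v y')
    + 6^-1 * (t w * e s v y' - t v * e s w y'))).
  by rewrite [t w * _]mulrC [t v * _]mulrC.
have de k q : is_derive y z (e k q) (D k q z) by exact: is_derive_eta.
have dee := is_deriveB (is_deriveM (de (s + 1) v) (de (s + 2) w))
                       (is_deriveM (de (s + 1) w) (de (s + 2) v)).
have H := is_deriveB (is_deriveM (is_derive_ucoord z) (is_derive_omega s v w z))
  (is_deriveZ (eps s) (is_deriveD (is_deriveM (is_derive_bcoef z) dee)
     (is_deriveZ 6^-1 (is_deriveB (is_deriveZ (t w) (de s v)) (is_deriveZ (t v) (de s w)))))).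
apply: (is_derive_eq H).
rewrite -[LHS]/(u * dom s z v w + om s v w * t z - eps s * (
    b * (eta (s + 1) v * D (s + 2) w z + eta (s + 2) w * D (s + 1) v z
         - (eta (s + 1) w * D (s + 2) v z + eta (s + 2) v * D (s + 1) w z))
  + (eta (s + 1) v * eta (s + 2) w - eta (s + 1) w * eta (s + 2) v) *
     ((tau - 2 * (b / u)) / 3 * t z)
  + 6^-1 * (t w * D s v z - t v * D s w z))).
rewrite /dF; move: (D s v z) (D s w z) (dom s z v w) (om s v w) (D (s + 1) _ z)
  (D (s + 2) _ z) (D (s + 1) _ z) (D (s + 2) _ z) (b / u) => *.
by ring.
Qed.

Lemma is_derive_psi (w : 'I_4 -> 'rV[R]_8) z :
  is_derive y z (fun y => cyl_psi tau a j c y w : R^o)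
    (\sum_s eps s * (2 * polar (dF s z) (F s) (w 0) (w 1) (w 2) (w 3))).
Proof.
pose f s p q : 'rV[R]_8 -> R^o := fun y => ev2 (cyl_F tau a j s c y) p q.
apply: (@near_eq_is_derive _ _ _ (\sum_s (eps s : R) *: ((2 : R) *:
  (f s (w 0) (w 1) * f s (w 2) (w 3) - f s (w 0) (w 2) * f s (w 1) (w 3)
   + f s (w 0) (w 3) * f s (w 1) (w 2))))).
  near=> y'; rewrite fct_sumE cyl_psiE//.
  suff : region c (sp_dom j `*` I) y' by move=> /region_cylinder[].
  near: y'; apply: open_nbhs_nbhs; split; last by apply/region_cylinder.
  apply: region_open; apply: open_prod => //; exact: sp_dom_open.
have df s p q : is_derive y z (f s p q) (dF s z p q) by exact: is_derive_F.
have H := is_derive_sum (fun s => is_deriveZ (eps s) (is_deriveZ 2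
  (is_deriveD (is_deriveB (is_deriveM (df s (w 0) (w 1)) (df s (w 2) (w 3)))
                          (is_deriveM (df s (w 0) (w 2)) (df s (w 1) (w 3))))
              (is_deriveM (df s (w 0) (w 3)) (df s (w 1) (w 2)))))).
apply: (is_derive_eq H); apply: eq_bigr => s _; congr (_ * (_ * _)).
rewrite -[LHS]/(F s (w 0) (w 1) * dF s z (w 2) (w 3) + F s (w 2) (w 3) * dF s z (w 0) (w 1)
  - (F s (w 0) (w 2) * dF s z (w 1) (w 3) + F s (w 1) (w 3) * dF s z (w 0) (w 2))
  + (F s (w 0) (w 3) * dF s z (w 1) (w 2) + F s (w 1) (w 2) * dF s z (w 0) (w 3))).
rewrite /polar; move: (dF s z) (F s) => G G'; ring.
Unshelve. all: by end_near. Qed.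

Lemma cyl_psi_closed (v : 'I_5 -> 'rV[R]_8) : extd (cyl_psi tau a j c) y v = 0.
Proof.
have [u0 _] := I_pos Iu.
transitivity (\sum_s eps s * (2 * (
    polar (dF s (v 0)) (F s) (v 1) (v 2) (v 3) (v 4)
  - polar (dF s (v 1)) (F s) (v 0) (v 2) (v 3) (v 4)
  + polar (dF s (v 2)) (F s) (v 0) (v 1) (v 3) (v 4)
  - polar (dF s (v 3)) (F s) (v 0) (v 1) (v 2) (v 4)
  + polar (dF s (v 4)) (F s) (v 0) (v 1) (v 2) (v 3)))).
  rewrite /extd; under eq_bigr => i _.
    have [_ ->] := is_derive_psi (fun l => v (lift i l)) (v i); rewrite mulr_sumr; over.
  rewrite exchange_big; apply: eq_bigr => s _ /=.
  pose f k := v (inord k).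
  have vE (i : 'I_5) : v i = f i by rewrite /f inord_val.
  under eq_bigr do rewrite !vE.
  rewrite !vE !big_ord_recl big_ord0 /= /bump /= !(add0n, add1n).
  have comb (x0 x1 x2 x3 x4 e : R) : (-1) ^+ 0 * (e * (2 * x0)) + ((-1) ^+ 1 * (e * (2 * x1))
      + ((-1) ^+ 2 * (e * (2 * x2)) + ((-1) ^+ 3 * (e * (2 * x3))
      + ((-1) ^+ 4 * (e * (2 * x4)) + 0)))) = e * (2 * (x0 - x1 + x2 - x3 + x4)) by ring.
  exact: comb.
under eq_bigr do rewrite alternated_polar.
pose cc := b / u.
have bE : b = u * cc by rewrite /cc mulrC divfK// gt_eqF.
transitivity (2 * \sum_s eps s * wedge3 (fun x y z => wedge1 t (om s) x y z
      - (u * tau + eps s * (u * cc)) * (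
        wedge1 (eta (s + 2)) (fun v w => D (s + 1) w v - D (s + 1) v w) x y z
      - wedge1 (eta (s + 1)) (fun v w => D (s + 2) w v - D (s + 2) v w) x y z)
      - eps s * ((tau - 2 * cc) / 3) *
          wedge1 t (fun v w => eta (s + 1) v * eta (s + 2) w - eta (s + 1) w * eta (s + 2) v) x y z
      - eps s / 6 * wedge1 t (fun v w => D s w v - D s v w) x y z)
    (fun v w => u * om s v w - eps s * vertical_form (u * cc) eta t s v w)
    (v 0) (v 1) (v 2) (v 3) (v 4)).
  rewrite mulr_sumr; apply: eq_bigr => s _; rewrite mulrCA; congr (_ * (_ * _)).
  have dE x z w : alternate (dF s) x z w = wedge1 t (om s) x z w
      - (u * tau + eps s * (u * cc)) * (
        wedge1 (eta (s + 2)) (fun v w => D (s + 1) w v - D (s + 1) v w) x z w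
      - wedge1 (eta (s + 1)) (fun v w => D (s + 2) w v - D (s + 2) v w) x z w)
      - eps s * ((tau - 2 * cc) / 3) *
          wedge1 t (fun v w => eta (s + 1) v * eta (s + 2) w - eta (s + 1) w * eta (s + 2) v) x z w
      - eps s / 6 * wedge1 t (fun v w => D s w v - D s v w) x z w.
    rewrite -bE; apply: (@alternated_derivative _ _ t (eta s) (eta (s + 1)) (eta (s + 2)) (D s) (D (s + 1)) (D (s + 2)) (om s) (dom s)).
    rewrite /alternate /dom (domega struct_eq hx) /wedge1.
    by rewrite -!(deta_omega struct_eq hx).
  rewrite /wedge3 !dE.
  by rewrite -bE /F !cyl_FE.
have dE s : (fun v w => D s w v - D s v w) = (fun v w => 2 * om s v w +
  2 * tau * (eta (s + 1) v * eta (s + 2) w - eta (s + 1) w * eta (s + 2) v)).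
  apply/funext => v'; apply/funext => w'; exact: (deta_omega struct_eq hx).
under eq_bigr do rewrite !dE.
rewrite closed_identity ?mulr0//.
- by move=> i v0 v1 v2 v3; exact: (omega_conformal hx).
- by move=> x z v' w; case: (omega_orthogonal hx (base x) (base z) (base v') (base w)).
- by move=> x z v' w; case: (omega_orthogonal hx (base x) (base z) (base v') (base w)).
- by move=> x z v' w; case: (omega_orthogonal hx (base x) (base z) (base v') (base w)).
Qed.

End Closed.

(** * Change of chart *)

Lemma congr3 (A B C T : Type) (f : A -> B -> C -> T) x x' y y' z z' :
  x = x' -> y = y' -> z = z' -> f x y z = f x' y' z'.
Proof. by move=> -> -> ->. Qed.

Section Overlaps.
Context {R : realType} {n : nat} (M : manifold R n).

Lemma region_setI (c : chart M) W W' x :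
  region c W x -> region c W' x -> region c (W `&` W') x.
Proof.
move=> [p [cp Wp] <-] [q [cq Wq] /(congr1 (cinv c))].
rewrite !cmapK// => qp; exists p => //; split=> //; split=> //.
by rewrite -qp.
Qed.

Lemma region_transition (c c' : chart M) W x :
  region c (cdom c' `&` W) x -> region c' W (transition c c' x).
Proof. by move=> [p [cp [c'p Wp]] <-]; rewrite /transition cmapK//; exists p. Qed.

Lemma derivable_transition (c c' : chart M) W x v :
  region c (cdom c' `&` W) x -> derivable (transition c c') x v.
Proof.
move=> hx; apply: (Ck_on_derivable (transition_smooth c c' 1)).
by case: hx => p [cp [c'p _]] <-; exists p.
Qed.

Lemma tensor2_transition (W : set (man_space M)) (g : tensor M 2) (c c' : chart M) x v w :
  is_tensor W g -> region c (cdom c' `&` W) x ->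
  ev2 (g c x) v w = ev2 (g c' (transition c c' x))
    ('D_v (transition c c') x) ('D_w (transition c c') x).
Proof.
by move=> [_ _ tg] hx; rewrite {1}/ev2 (tg _ _ _ _ hx) mform2E !(tnth_nth 0).
Qed.

Lemma tensor1_transition (W : set (man_space M)) (e : tensor M 1) (c c' : chart M) x v :
  is_tensor W e -> region c (cdom c' `&` W) x ->
  ev1 (e c x) v = ev1 (e c' (transition c c' x)) ('D_v (transition c c') x).
Proof. by move=> [_ _ te] hx; rewrite {1}/ev1 (te _ _ _ _ hx) mform1E. Qed.

End Overlaps.

Section CylinderChange.
Context {R : realType} {M : manifold R 7} (I : set R) (oI : open I) (S : sp1sp1 M).
Context (tau a : R).
Local Notation N := (cylinder M oI).
Context (c c' : chart N) (y y' : 'rV[R]_8) (D : 'rV[R]_8 -> 'rV[R]_8) (j : sp_index S).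
Hypotheses (hu : ucoord y' = ucoord y) (ht : forall v, ucoord (D v) = ucoord v)
  (he : forall s v, ev1 (sp_eta j s c.1 (base y)) (base v) =
                    ev1 (sp_eta j s c'.1 (base y')) (base (D v))).

Lemma cyl_metric_change :
  (forall v w, ev2 (sp_gH S c.1 (base y)) (base v) (base w) =
               ev2 (sp_gH S c'.1 (base y')) (base (D v)) (base (D w))) ->
  forall v, cyl_metric tau a j c y v = cyl_metric tau a j c' y' (fun i => D (v i)).
Proof.
move=> hg v; rewrite !mform2E !cyl_metricE hu !ht hg.
by under eq_bigr do rewrite !he.
Qed.

Lemma cyl_psi_change :
  (forall s v w, ev2 (sp_omega j s c.1 (base y)) (base v) (base w) =
               ev2 (sp_omega j s c'.1 (base y')) (base (D v)) (base (D w))) ->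
  region c.1 (sp_dom j) (base y) -> region c'.1 (sp_dom j) (base y') ->
  forall v, cyl_psi tau a j c y v = cyl_psi tau a j c' y' (fun i => D (v i)).
Proof.
move=> ho h1 h2 v; rewrite (cyl_psiE _ _ h1) (cyl_psiE _ _ h2); apply: eq_bigr => i _.
have E v' w' : ev2 (cyl_F tau a j i c y) v' w' = ev2 (cyl_F tau a j i c' y') (D v') (D w').
  by rewrite !cyl_FE /vertical_form hu !ht -ho -!he.
by rewrite /pfaffian !E.
Qed.

End CylinderChange.

Section CylinderTransition.
Context {R : realType} {M : manifold R 7} (I : set R) (oI : open I) (S : sp1sp1 M).
Context (tau a : R).
Local Notation N := (cylinder M oI).
Context (c c' : chart N) (y : 'rV[R]_8) (j : sp_index S).
Hypothesis hy : region c.1 (cdom c'.1 `&` sp_dom j) (base y).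
Let x := base y.

(** The coordinate [u] is the same in all charts of the cylinder. *)
Lemma transitionE : transition c c' =
  (fun z => row_mx (transition c.1 c'.1 (base z)) (@rsubmx R 1 7 1 z) : 'rV[R]_8).
Proof.
apply/funext => z; apply: (f_equal2 (@row_mx R 1 7 1)) => //.
transitivity (const_mx (ucoord z) : 'rV[R]_1) => //.
by apply/rowP => i; rewrite ord1 mxE.
Qed.

Lemma derive_transition (v : 'rV[R]_8) : 'D_v (transition c c') y =
  row_mx ('D_(base v) (transition c.1 c'.1) x) (@rsubmx R 1 7 1 v) :> 'rV[R]_8.
Proof.
have d1 : is_derive y v (fun z => transition c.1 c'.1 (base z))
    ('D_(base v) (transition c.1 c'.1) x).
  apply: (is_derive_complin (@base_linear R) (h := transition c.1 c'.1)).
  by apply: derivableP; exact: derivable_transition hy.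
have d2 : is_derive y v (@rsubmx R 1 7 1 : 'rV[R]_8 -> 'rV[R]_1) (@rsubmx R 1 7 1 v).
  have L : linear (@rsubmx R 1 7 1) by move=> k p q; rewrite linearP.
  by apply: (is_derive_complin L (h := id)).
rewrite transitionE.
case: d1 => dd1 e1; case: d2 => dd2 e2.
transitivity (row_mx ('D_v (fun z => transition c.1 c'.1 (base z)) y)
                     ('D_v (@rsubmx R 1 7 1) y)); first exact: (@derive_row_mx R _ 7 1 _ _ y v dd1 dd2).
by rewrite e1 e2.
Qed.

Lemma base_transition : base (transition c c' y) = transition c.1 c'.1 x.
Proof. by rewrite transitionE /base row_mxKl. Qed.

Lemma ucoord_transition : ucoord (transition c c' y) = ucoord y.
Proof. by rewrite transitionE /ucoord row_mxKr. Qed.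

Lemma base_derive_transition (v : 'rV[R]_8) :
  base ('D_v (transition c c') y) = 'D_(base v) (transition c.1 c'.1) x.
Proof. by rewrite derive_transition /base row_mxKl. Qed.

Lemma ucoord_derive_transition (v : 'rV[R]_8) : ucoord ('D_v (transition c c') y) = ucoord v.
Proof. by rewrite derive_transition /ucoord row_mxKr. Qed.

Lemma eta_transition s (v : 'rV[R]_8) : ev1 (sp_eta j s c.1 x) (base v) =
  ev1 (sp_eta j s c'.1 (base (transition c c' y))) (base ('D_v (transition c c') y)).
Proof.
rewrite [RHS](f_equal2 (fun p q => ev1 (sp_eta j s c'.1 p) q)
  base_transition (base_derive_transition v)).
exact: (tensor1_transition _ (sp_eta_form j s).1 hy).
Qed.

Lemma gH_transition (v w : 'rV[R]_8) : ev2 (sp_gH S c.1 x) (base v) (base w) =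
  ev2 (sp_gH S c'.1 (base (transition c c' y))) (base ('D_v (transition c c') y))
    (base ('D_w (transition c c') y)).
Proof.
rewrite [RHS](congr3 (fun p q r => ev2 (sp_gH S c'.1 p) q r)
  base_transition (base_derive_transition v) (base_derive_transition w)).
apply: (tensor2_transition _ _ (sp_gH_tensor S)).
by apply: region_sub hy => p [].
Qed.

Lemma omega_transition s (v w : 'rV[R]_8) : ev2 (sp_omega j s c.1 x) (base v) (base w) =
  ev2 (sp_omega j s c'.1 (base (transition c c' y))) (base ('D_v (transition c c') y))
    (base ('D_w (transition c c') y)).
Proof.
rewrite [RHS](congr3 (fun p q r => ev2 (sp_omega j s c'.1 p) q r)
  base_transition (base_derive_transition v) (base_derive_transition w)) !omegaE.
rewrite (tensor2_transition _ _ (sp_gH_tensor S) (c' := c'.1)); last first.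
  by apply: region_sub hy => p [].
congr (ev2 _ _ _).
by case: (sp_I_endo j s) => _ _ /(_ _ _ _ _ hy) ->.
Qed.

Lemma cyl_metric_transition (v : 'I_2 -> 'rV[R]_8) : cyl_metric tau a j c y v =
  cyl_metric tau a j c' (transition c c' y) (fun i => 'D_(v i) (transition c c') y).
Proof.
exact: (cyl_metric_change _ _ ucoord_transition ucoord_derive_transition
          eta_transition gH_transition).
Qed.

Lemma cyl_psi_transition (v : 'I_4 -> 'rV[R]_8) : cyl_psi tau a j c y v =
  cyl_psi tau a j c' (transition c c' y) (fun i => 'D_(v i) (transition c c') y).
Proof.
apply: (cyl_psi_change _ _ ucoord_transition ucoord_derive_transition
          eta_transition omega_transition).
  by apply: region_sub hy => p [].
by rewrite base_transition; exact: region_transition.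
Qed.

End CylinderTransition.

(** * The global Spin(7) structure *)

Section GlobalStructure.
Context {R : realType} {M : manifold R 7} (I : set R) (oI : open I) (S : sp1sp1 M).
Context (tau a : R).
Local Notation N := (cylinder M oI).
Hypotheses (phi_global : globally_defined (@sp_phi R M S))
  (struct_eq : structure_equations S tau)
  (I_pos : forall u, I u -> 0 < u /\ 0 < tau * u `^ (5 / 3) - a).

(** An arbitrary gauge is chosen at every point. *)
Definition glue k (T : sp_index S -> tensor N k) : tensor N k := fun c y =>
  if pselect (exists j, region c (sp_dom j `*` I) y) is left e
  then T (projT1 (cid e)) c y else 0.

Let g := glue (@cyl_metric R M I oI S tau a).
Let psi := glue (@cyl_psi R M I oI S tau a).

Lemma glueE k (T : sp_index S -> tensor N k) :
  (forall j j' (c : chart N) y, region c.1 (sp_dom j `&` sp_dom j') (base y) ->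
    T j c y = T j' c y) ->
  forall j (c : chart N) y, region c (sp_dom j `*` I) y -> glue T c y = T j c y.
Proof.
move=> eT j c y hy; rewrite /glue; case: pselect => [e|]; last by case; exists j.
case: (cid e) => j' /= /region_cylinder[h' _]; apply: eT.
by apply: region_setI => //; case/region_cylinder : hy.
Qed.

Lemma glue_metricE (j : sp_index S) (c : chart N) y : region c (sp_dom j `*` I) y -> g c y = cyl_metric tau a j c y.
Proof.
apply: glueE => {}j j' {}c {}y; exact: (cyl_metric_gauge (oI := oI) tau a (j := j)).
Qed.

Lemma glue_psiE (j : sp_index S) (c : chart N) y : region c (sp_dom j `*` I) y -> psi c y = cyl_psi tau a j c y.
Proof.
by apply: glueE => {}j j' {}c {}y; exact: (cyl_psi_gauge (oI := oI) a phi_global struct_eq).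
Qed.

Lemma region_cover (c : chart N) y : region c setT y ->
  exists j : sp_index S, region c (sp_dom j `*` I) y.
Proof.
move=> /region_cylinderT[[p [cp _] py] Iu].
have [j jp] := sp_dom_cover S cp; exists j; apply/region_cylinder; split=> //.
by exists p.
Qed.

(** All that remains to be used of the construction: local orthonormal coframes
    in which [psi] is twice the Cayley form, and [d psi = 0]. *)
Lemma global_coframe (c : chart N) y0 : region c setT y0 ->
  exists (U : set 'rV[R]_8) (P : 'rV[R]_8 -> 'M[R]_8),
  [/\ open U, U y0,
      forall i l k, Ck_on U k (fun y => P y i l : R^o),
      forall v, extd (psi c) y0 v = 0 &
   forall y, U y ->
    [/\ forall v w, ev2 (g c y) v w = \sum_i (v *m P y) 0 i * (w *m P y) 0 i,
       forall v, psi c y v = 2 * cayley (fun i => v i *m P y) &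
       P y \in unitmx]].
Proof.
move=> /region_cover[j hy0].
have [U [P [oU Uy UW sP hP]]] := local_coframe I_pos hy0.
exists U, P; split=> //.
- move=> v; have /region_cylinder[hx Iu] := hy0.
  rewrite -(cyl_psi_closed I_pos struct_eq hx Iu v) /extd.
  apply: eq_bigr => i _; congr (_ * _); apply: near_eq_derive; near=> y.
  by rewrite (glue_psiE (j := j))//; apply: UW; near: y; exact: open_nbhs_nbhs.
- move=> y Uy'; have [h1 h2 h3] := hP y Uy'; split=> //.
    by move=> v w; rewrite (glue_metricE (UW _ Uy')) h1.
  by move=> v; rewrite (glue_psiE (UW _ Uy')) h2.
Unshelve. all: by end_near. Qed.

Lemma region_transition_cover (c c' : chart N) y : region c (cdom c' `&` setT) y ->
  exists j : sp_index S, [/\ region c.1 (cdom c'.1 `&` sp_dom j) (base y),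
    region c (sp_dom j `*` I) y & region c' (sp_dom j `*` I) (transition c c' y)].
Proof.
move=> [[p u] [[cp Iu] [[c'p _] _]] <-].
have [j jp] := sp_dom_cover S cp; exists j; split.
- by exists p => //; rewrite /base row_mxKl.
- by exists (p, u).
by rewrite /transition cmapK//; exists (p, u).
Qed.

Lemma g_tensor : is_tensor setT g.
Proof.
split.
- move=> c y hy; have [U [P [_ Uy _ _ /(_ _ Uy)[gP _ _]]]] := global_coframe hy.
  move=> v i k p q; rewrite !mform2E !gP.
  rewrite /GRing.scale /= mulr_sumr -big_split; apply: eq_bigr => l _ /=.
  rewrite !dfwithE.
  have [->|i0] := eqVneq i 0.
    by rewrite /= mulmxDl -scalemxAl !mxE; ring.
  have -> : i = 1 by apply: val_inj; case: i i0 => -[|[|//]].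
  by rewrite /= mulmxDl -scalemxAl !mxE; ring.
- move=> c v k; apply: Ck_on_local => y0 hy0.
  have [U [P [oU Uy sP _ gP]]] := global_coframe hy0; exists U => //.
  apply: (eq_Ck_on (f := fun y => \sum_i (\sum_l v 0 0 l * P y l i) * (\sum_l v 1 0 l * P y l i) : R^o)) => //.
    by move=> y /gP[h _ _]; rewrite mform2E h; apply: eq_bigr => i _; rewrite !mxE.
  apply: Ck_on_sum => // i; apply: Ck_onM => //; apply: Ck_on_sum => // l;
    by apply: Ck_onM => //; exact: Ck_on_cst.
move=> c c' y v /region_transition_cover[j [h1 h2 h3]].
by rewrite (glue_metricE h2) (glue_metricE h3); exact: cyl_metric_transition.
Qed.

Lemma psi_form : is_form setT psi.
Proof.
split; last first.
  move=> c y hy v i j ij e.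
  have [U [P [_ Uy _ _ /(_ _ Uy)[_ -> _]]]] := global_coframe hy.
  by rewrite (cayley_alternating ij) ?mulr0// e.
split.
- move=> c y hy v i k p q.
  have [U [P [_ Uy _ _ /(_ _ Uy)[_ pE _]]]] := global_coframe hy.
  have E z : (fun l => dfwith v i z l *m P y) = dfwith (fun l => v l *m P y) i (z *m P y).
    by apply/funext => l; rewrite !dfwithE; case: eqP.
  rewrite !pE !E mulmxDl -scalemxAl cayley_linear /GRing.scale /=.
  by rewrite mulrDr mulrCA.
- move=> c v k; apply: Ck_on_local => y0 hy0.
  have [U [P [oU Uy sP _ pP]]] := global_coframe hy0; exists U => //.
  apply: (eq_Ck_on (f := fun y => 2 * \sum_(t <- cayley_terms) (-1) ^+ t.1 *
    \sum_(s : 'S_4) (-1) ^+ s * \prod_i \sum_l v i 0 l * P y l (inord (nth 0%N t.2 (s i))) : R^o)) => //.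
    move=> y /pP[_ -> _]; rewrite cayley_minors; congr (_ * _); apply: eq_bigr => t _.
    congr (_ * _); apply: eq_bigr => s _; congr (_ * _); apply: eq_bigr => i _.
    by rewrite !mxE.
  apply: Ck_onZ => //; apply: Ck_on_sum => // t; apply: Ck_onZ => //.
  apply: Ck_on_sum => // s; apply: Ck_onZ => //; apply: Ck_on_prod => // i.
  by apply: Ck_on_sum => // l; apply: Ck_onZ.
move=> c c' y v /region_transition_cover[j [h1 h2 h3]].
by rewrite (glue_psiE h2) (glue_psiE h3); exact: cyl_psi_transition.
Qed.

Lemma g_psi_spin7 : is_spin7 g psi.
Proof.
split; last 1 first.
- exists 2 => // c y hy.
  have [U [P [_ Uy _ _ /(_ _ Uy)[gP pP _]]]] := global_coframe hy.
  by exists (P y).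
- split; first exact: g_tensor.
  move=> c y hy; have [U [P [_ Uy _ _ /(_ _ Uy)[gP _ uP]]]] := global_coframe hy.
  split=> [v w|v v0]; rewrite !gP; first by apply: eq_bigr => i _; rewrite mulrC.
  have sq_ge0 i : 0 <= (v *m P y) 0 i * (v *m P y) 0 i by rewrite -expr2 sqr_ge0.
  rewrite lt_neqAle sumr_ge0// andbT; apply: contra v0 => /eqP/esym/eqP.
  rewrite psumr_eq0// => /allP h.
  have vP : v *m P y = 0.
    apply/rowP => i; rewrite [RHS]mxE; apply/eqP.
    by have := h i (mem_index_enum _); rewrite /= -expr2 sqrf_eq0.
  by rewrite -[v]mulmx1 -(mulmxV uP) mulmxA vP mul0mx.
exact: psi_form.
Qed.

Lemma g_psi_parallel : is_parallel g psi.
Proof.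
move=> c y w v hy; have [U [P [oU Uy sP dpsi hP]]] := global_coframe hy.
have [_ _ uP] := hP _ Uy.
apply: (closed_parallel (k := 2) oU Uy (fun i l => sP i l 1%N) _ uP _ _ dpsi).
- by move=> z /hP[].
- by [].
- by move=> z /hP[].
Qed.

End GlobalStructure.

Theorem theorem6p1 (R : realType) (M : manifold R 7) (S : sp1sp1 M) (tau : R)
  (tau_neq0 : tau != 0)
  (phi_global : globally_defined (@sp_phi R M S))
  (struct_eq : structure_equations S tau)
  (a : R) (I : set R) (I_open : open I) (I_itv : is_interval I)
  (I_pos : forall u, I u -> 0 < u /\ 0 < tau * u `^ (5 / 3) - a) :
  exists (g : tensor (cylinder M I_open) 2) (psi : tensor (cylinder M I_open) 4),
    [/\ forall j (c : chart (cylinder M I_open)) y,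
          region c (@sp_dom R M S j `*` I) y ->
          g c y = cyl_metric tau a j c y /\
          psi c y = cyl_psi tau a j c y,
        is_spin7 g psi & is_parallel g psi].
Proof.
exists (glue (@cyl_metric R M I I_open S tau a)), (glue (@cyl_psi R M I I_open S tau a)).
split.
- by move=> j c y hy; split; [exact: glue_metricE|exact: glue_psiE].
- exact: g_psi_spin7.
- exact: g_psi_parallel.
Qed.
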